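(* Let $m$ and $p$ be positive integers. Then for every integer $N\ge 1$, $$ J_N(K_{(m,p)};q)=q^{p(1-N^2)}\sum_{\substack{n\ge 0\\ n=n_m\ge n_{m-1}\ge\cdots\ge n_1\ge 0\\ n=s_p\ge s_{p-1}\ge\cdots\ge s_1\ge 0}} \frac{(q^{1+N})_n(q^{1-N})_n}{(q)_{n_1}}\,q^n\prod_{i=1}^{m-1}q^{n_i^2+n_i}\begin{bmatrix} n_{i+1}\\ n_i\end{bmatrix}\prod_{j=1}^{p-1}q^{s_j^2+s_j}\begin{bmatrix} s_{j+1}\\ s_j\end{bmatrix} $$ and $$ J_N(K_{(m,-p)};q)=q^{-p(1-N^2)}\sum_{\substack{n\ge 0\\ n=n_m\ge n_{m-1}\ge\cdots\ge n_1\ge 0\\ n=s_p\ge s_{p-1}\ge\cdots\ge s_1\ge 0}} \frac{(q^{1+N})_n(q^{1-N})_n}{(q)_{n_1}}\,(-1)^nq^{-\binom{n+1}{2}}\prod_{i=1}^{m-1}q^{n_i^2+n_i}\begin{bmatrix} n_{i+1}\\ n_i\end{bmatrix}\prod_{j=1}^{p-1}q^{-s_j-s_{j+1}s_j}\begin{bmatrix} s_{j+1}\\ s_j\end{bmatrix}. $$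
   Context: Notation: $(a)_n=(a;q)_n=\prod_{k=0}^{n-1}(1-aq^k)$, and for $0\le k\le n$, $\begin{bmatrix} n\\k\end{bmatrix}=\frac{(q)_n}{(q)_{n-k}(q)_k}$, where $(q)_n=(q;q)_n$. Empty products equal $1$. The sums run over all integers $n\ge 0$ and all integer tuples $(n_1,\dots,n_m)$, $(s_1,\dots,s_p)$ satisfying the displayed inequalities with $n_m=s_p=n$; they are finite since $(q^{1-N})_n=0$ for $n\ge N$. Knots: $K_{(m,p)}$ ($m,p\in\mathbb{Z}$, $p\neq 0$) is the double twist knot with two twist regions having $2m-1$ and $2p$ half-twists respectively, positive integers meaning right-handed and negative integers left-handed half-twists. In terms of 2-bridge knots $\mathfrak{b}(l,t)$: for integers $m\ge 0$, $p\ge 1$ one has $K_{(m+1,p)}=\mathfrak{b}(4mp+2p-1,\,4mp-1)$ and $K_{(m+1,-p)}=\mathfrak{b}(4mp+2p+1,\,4mp+1)$; the mirror image of $K_{(m+1,p)}$ is $K_{(-m,-p)}$ and the mirror image of $K_{(m+1,-p)}$ is $K_{(-m,p)}$. Here $\mathfrak{b}(l,t)$ is the 2-bridge knot whose double branched cover is the lens space $L(l,t)$ ($\mathfrak{b}(1,\cdot)$ being the unknot), with the chirality convention that $\mathfrak{b}(2p+1,1)=K_{(1,-p)}$ is the left-handed torus knot $T(2,2p+1)$ (so $K_{(0,p)}$ is the right-handed one), and $\mathfrak{b}(l,-t)$ is the mirror image of $\mathfrak{b}(l,t)$. Colored Jones polynomial: $J_N(K;q)$ is the usual $N$th colored Jones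 polynomial of $K$ (coloring by the $N$-dimensional irreducible representation of quantum $\mathfrak{sl}_2$, zero framing), normalized to be $1$ for the unknot. With $K^*$ the mirror image of $K$, $J_N(K;q^{-1})=J_N(K^*;q)$. The convention for $q$ versus $q^{-1}$ is the one in which the right-handed trefoil has $J_2=q^{-1}+q^{-3}-q^{-4}$. *)

(* Defs.v *)
From HB Require Import structures.
From mathcomp Require Import all_boot all_order all_algebra.

Set Implicit Arguments.
Unset Strict Implicit.
Unset Printing Implicit Defensive.

Import Order.TTheory GRing.Theory Num.Theory.
Local Open Scope ring_scope.

(* Oriented link diagrams in Morse position, read from bottom to top as a list
   of elementary events; strands are numbered from 0, left to right.
   - [Cup i b] creates two adjacent strands at positions i, i+1; the left one
     points up iff b, and the right one points the opposite way.
   - [Cap i] joins strands i and i+1.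
   - [Cross i s] is a half-twist of strands i and i+1, right-handed iff s.
     The handedness of a half-twist does not depend on the orientations; a
     right-handed one is a positive crossing iff its strands are parallel. *)
Inductive event := Cup of nat & bool | Cap of nat | Cross of nat & bool.

Definition diagram := seq event.

(* The orientations of the strands at a given level, [true] for upward. *)
Definition levels := seq bool.

Definition up (o : levels) (i : nat) : bool := nth true o i.

Definition orient_step (o : levels) (e : event) : levels :=
  match e with
  | Cup i b => take i o ++ [:: b; ~~ b] ++ drop i o
  | Cap i => take i o ++ drop i.+2 o
  | Cross i _ => take i o ++ [:: up o i.+1; up o i] ++ drop i.+2 o
  end.

Definition event_sign (o : levels) (e : event) : int :=
  if e is Cross i s then (if s == (up o i == up o i.+1) then 1 else -1) else 0.

Fixpoint writhe_from (o : levels) (D : diagram) : int :=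
  if D is e :: D' then event_sign o e + writhe_from (orient_step o e) D' else 0.

Definition writhe (D : diagram) : int := writhe_from [::] D.

(* k half-twists of strands i and i+1, right-handed for k > 0 and left-handed
   for k < 0. *)
Definition half_twists (i : nat) (k : int) : diagram :=
  nseq `|k|%N (Cross i (0 <= k)).

(* The double twist knot K_(m,p) as a 4-plat: two cups, 2p half-twists of the
   middle strands, 2m-1 half-twists of the two left strands, and two nested
   caps.  The orientations are up, down, down, up below the second twist
   region and down, up, down, up above it. *)
Definition double_twist (m p : int) : diagram :=
  [:: Cup 0 true; Cup 2 false]
  ++ half_twists 1 (2 * p) ++ half_twists 0 (2 * m - 1)
  ++ [:: Cap 1; Cap 0].

(* The Reshetikhin-Turaev operator invariant for the N-dimensional irreducible
   representation V of U_q(sl_2), over a field containing a = q^(1/4).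
   The Hopf algebra conventions are
     K = q^(H/2),  [E, F] = (K - K^-1) / (q^(1/2) - q^(-1/2)),
     Delta E = 1 (x) E + E (x) K,  Delta F = K^-1 (x) F + F (x) 1,
     S E = - E K^-1,  S F = - K F,
   for which S^2 is conjugation by K and the universal R-matrix is
     R = q^(H (x) H / 4) \sum_n q^(n(n-1)/4) (q^(1/2) - q^(-1/2))^n / [n]!
                                E^n (x) F^n.
   Upward strands carry V and downward strands its dual, with the dual basis. *)
Section QuantumSl2.

Variables (F : fieldType) (a : F) (N : nat).

Definition qint (n : nat) : F := (a ^+ n.*2 - a ^- n.*2) / (a ^+ 2 - a ^- 2).

Definition qfact (n : nat) : F := \prod_(1 <= k < n.+1) qint k.

(* The eigenvalue of H on the i-th basis vector of V. *)
Definition weight (i : 'I_N) : int := N%:Z - 1 - (2 * i)%:Z.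

Definition matK : 'M[F]_N := diag_mx (\row_i a ^ (2 * weight i)).
Definition matKV : 'M[F]_N := diag_mx (\row_i a ^ (- (2 * weight i))).

(* Matrices act on columns: E e_j = [N - j] e_(j-1), F e_j = [j + 1] e_(j+1). *)
Definition matE : 'M[F]_N :=
  \matrix_(i, j) if (i.+1 == j :> nat) then qint (N - j) else 0.
Definition matF : 'M[F]_N :=
  \matrix_(i, j) if (i == j.+1 :> nat) then qint i else 0.

(* The actions of H, E, F on V (if the boolean is true) or on its dual, where
   x acts by the transpose of S x. *)
Definition strandH (b : bool) (i : 'I_N) : int :=
  if b then weight i else - weight i.
Definition strandE (b : bool) : 'M[F]_N :=
  if b then matE else (- (matE *m matKV))^T.
Definition strandF (b : bool) : 'M[F]_N :=
  if b then matF else (- (matK *m matF))^T.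

(* The coefficient of e_u (x) e_v in R (e_x (x) e_y), resp. R^-1 (e_x (x) e_y),
   on the tensor product of the representations given by b and c.  The sums
   stop at N because E^N = 0. *)
Definition Rcoef (b c : bool) (u v x y : 'I_N) : F :=
  a ^ (strandH b u * strandH c v) *
  \sum_(n < N) a ^+ (n * n.-1) * (a ^+ 2 - a ^- 2) ^+ n / qfact n
               * (strandE b ^+ n) u x * (strandF c ^+ n) v y.

Definition RVcoef (b c : bool) (u v x y : 'I_N) : F :=
  a ^ (- (strandH b x * strandH c y)) *
  \sum_(n < N) (-1) ^+ n * a ^- (n * n.-1) * (a ^+ 2 - a ^- 2) ^+ n / qfact n
               * (strandE b ^+ n) u x * (strandF c ^+ n) v y.

(* The coefficient of e_x (x) e_y in the image of e_x' (x) e_y' under the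
   braiding P R, if s, or the inverse braiding R^-1 P, otherwise, where P is
   the flip; b and c are the orientations of the strands x' and y'. *)
Definition cross_coef (s b c : bool) (x y x' y' : 'I_N) : F :=
  if s then Rcoef b c y x x' y' else RVcoef c b x y y' x'.

(* Coevaluations: \sum_i e_i (x) e^i if the left strand points up, and
   \sum_i e^i (x) K^-1 e_i otherwise. *)
Definition cup_coef (b : bool) (x y : 'I_N) : F :=
  if x == y then (if b then 1 else a ^ (- (2 * weight x))) else 0.

(* Evaluations: v (x) f |-> f (K v) if the left strand points up, and
   f (x) v |-> f v otherwise. *)
Definition cap_coef (b : bool) (x y : 'I_N) : F :=
  if x == y then (if b then a ^ (2 * weight x) else 1) else 0.

(* Vectors of a tensor product of k copies of V and its dual are given by their
   coordinates on the basis, which is indexed by the sequences of length k. *)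
Definition apply_event (o : levels) (e : event) (psi : seq 'I_N -> F) :
    seq 'I_N -> F :=
  fun s =>
  match e with
  | Cup i b =>
      if drop i s is x :: y :: t then cup_coef b x y * psi (take i s ++ t)
      else 0
  | Cap i =>
      \sum_x \sum_y cap_coef (up o i) x y
                    * psi (take i s ++ [:: x; y] ++ drop i s)
  | Cross i b =>
      if drop i s is x :: y :: t then
        \sum_x' \sum_y' cross_coef b (up o i) (up o i.+1) x y x' y'
                        * psi (take i s ++ [:: x'; y'] ++ t)
      else 0
  end.

Fixpoint apply_diagram (o : levels) (D : diagram) (psi : seq 'I_N -> F) :
    seq 'I_N -> F :=
  if D is e :: D' then apply_diagram (orient_step o e) D' (apply_event o e psi)
  else psi.

Definition bracket (D : diagram) : F :=
  apply_diagram [::] D (fun s => (s == [::])%:R) [::].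

(* The twist acts on V by q^((N^2 - 1)/4), so the power of a corrects the
   framing to zero; the unknot has bracket [N]. *)
Definition colored_jones (D : diagram) : F :=
  a ^ (- (writhe D * (N%:Z ^+ 2 - 1))) * bracket D / qint N.

End QuantumSl2.

Section QSeries.

Variables (F : fieldType) (q : F).

Definition qpoch (x : F) (n : nat) : F := \prod_(0 <= k < n) (1 - x * q ^+ k).

Definition qbinom (n k : nat) : F := qpoch q n / (qpoch q (n - k) * qpoch q k).

(* The series in n terminates: its terms with n >= N vanish. *)
Lemma qpoch_eq0 (N n : nat) :
  q != 0 -> (0 < N <= n)%N -> qpoch (q ^ (1 - N%:Z)) n = 0.
Proof.
case: N => // N q0 /= Nn; rewrite /qpoch (big_cat_nat (n := N.+1)) //=.
rewrite big_nat_recr //= exprnP -expfzDr // intS opprD addrA subrr add0r.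
by rewrite addNr expr0z subrr mulr0 mul0r.
Qed.

End QSeries.

(* The sequence (t_1, ..., t_k), k > 0, satisfies 0 <= t_1 <= ... <= t_k = n. *)
Definition chain_to (n : nat) (k N : nat) (t : k.-tuple 'I_N) : bool :=
  sorted leq (map val t) && (last 0%N (map val t) == n).

(* The entry t_i, numbered from 1. *)
Definition entry (k N : nat) (t : k.-tuple 'I_N) (i : nat) : nat :=
  nth 0%N (map val t) i.-1.

(* The field of rational functions in an indeterminate q^(1/4). *)
Definition Qq : fieldType := {fraction {poly rat}}.
Definition q4 : Qq := tofrac 'X.
Definition q : Qq := q4 ^+ 4.

Definition J (N : nat) (D : diagram) : Qq := colored_jones q4 N D.

(* Main.v *)
(** The 2p half-twists act on V* (x) V*.  There the vectors E^n (e^0 (x) e^(N-1-n))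
    make a full twist triangular, with q-binomial entries.  Dually, on V (x) V* a
    full twist of antiparallel strands is triangular for the functionals taking T
    to the (k, 0) coordinate of F^k T, which are q-differences of the diagonal of T.
    Powers of the two triangular matrices are the sums over the chains s and t.
    Cutting the closed braid at its outer strand gives an intertwiner of an
    irreducible representation, that is, a scalar, and evaluating it at an extreme
    weight reduces it to a pairing of the two families.  This pairing is diagonal:
    off the diagonal it is a q-difference of order exceeding the degree, and on the
    diagonal the q-Vandermonde sum gives (q^(1+N))_n (q^(1-N))_n. *)

Require Import Defs.
From HB Require Import structures.
From mathcomp Require Import all_boot all_order all_algebra.
From mathcomp Require Import ring zify.

Set Implicit Arguments.
Unset Strict Implicit.
Unset Printing Implicit Defensive.

Import Order.TTheory GRing.Theory Num.Theory.
Local Open Scope ring_scope.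

(** Both triangularities have one cause: in the dual of V, e^0 is killed by F and is not in the
    image of E. So the inverse braiding has a single term on e^0 (x) e^b, and a single coordinate of
    T contributes to the (k, 0) coordinate of its braiding. A full twist then costs one q-series
    instead of two, and this series has a closed form. Since twists commute with E and F, applying
    E^n or F^k carries the result over to whole families. The scalar of the cut tangle is read at
    the index M = N - 1 because E kills e^M. Hence e^x (x) e^M is a multiple of E^x (e^0 (x) e^M),
    and the image of the single vector e^0 (x) e^M gives all entries that are needed; on the other
    side the entry (M, M - d) is a multiple of the corner entry (M, M) after F^d. The two families
    are normalized so that, up to an overall power of q^(1/4), the matrices of the twists do not
    involve N. Apart from the range of summation, N enters only through the pairing and through
    powers of q^(1/4). *)

Section DoubleTwist.

Variables (F : fieldType) (a q : F).
Hypothesis q_def : q = a ^+ 4.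
Hypothesis a_neq0 : a != 0.
Hypothesis a_inf : forall n, (0 < n)%N -> a ^+ n != 1.

Local Notation pq := (qpoch q q).
Local Notation dl := (a ^+ 2 - a ^- 2).

(** * q-series *)

(** Powers of [a] are kept with integer exponents throughout, so that an identity between them is a
    [ring] identity of exponents. An exponent of [a] is four times the exponent of [q]; thus
    [a ^ (2 * i * (i - 1))] is q^(i(i-1)/2). *)
Lemma pwD (m n : int) : a ^ (m + n) = a ^ m * a ^ n.
Proof. exact: expfzDr. Qed.

Lemma pw_neq0 (m : int) : a ^ m != 0.
Proof. exact: expfz_neq0. Qed.

Lemma pwX (m : int) (n : nat) : (a ^ m) ^+ n = a ^ (m * n).
Proof. by rewrite exprnP exprz_exp. Qed.

Lemma pwV (m : int) : (a ^ m)^-1 = a ^ (- m).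
Proof. exact: invr_expz. Qed.

Lemma qE (n : nat) : q ^+ n = a ^ (4 * n%:Z).
Proof. by rewrite q_def -exprM exprnP PoszM. Qed.

Lemma qX_neq1 (n : nat) : (0 < n)%N -> 1 - q ^+ n != 0.
Proof.
by move=> n0; rewrite subr_eq0 eq_sym q_def -exprM a_inf // muln_gt0.
Qed.

Lemma qpoch0 (x : F) : qpoch q x 0 = 1.
Proof. by rewrite /qpoch big_nil. Qed.

Lemma qpochS (x : F) n : qpoch q x n.+1 = qpoch q x n * (1 - x * q ^+ n).
Proof. by rewrite /qpoch big_nat_recr. Qed.

Lemma qpochSl (x : F) n : qpoch q x n.+1 = (1 - x) * qpoch q (x * q) n.
Proof.
rewrite /qpoch big_nat_recl //= expr0 mulr1; congr (_ * _).
by apply: eq_bigr => i _; rewrite exprS mulrA.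
Qed.

Lemma qpochD (x : F) m n : qpoch q x (m + n) = qpoch q x m * qpoch q (x * q ^+ m) n.
Proof.
elim: n => [|n IH]; first by rewrite addn0 qpoch0 mulr1.
by rewrite addnS !qpochS IH -mulrA exprD [x * (_ * _)]mulrA.
Qed.

Lemma pqS n : pq n.+1 = pq n * (1 - q ^+ n.+1).
Proof. by rewrite qpochS -exprS. Qed.

Lemma pqD m n : pq (m + n) = pq m * qpoch q (q ^+ m.+1) n.
Proof. by rewrite qpochD -exprS. Qed.

Lemma pq_neq0 n : pq n != 0.
Proof.
elim: n => [|n IH]; first by rewrite qpoch0 oner_neq0.
by rewrite pqS mulf_neq0 // qX_neq1.
Qed.

Lemma qpoch_pw_eq0 (s n : nat) : (s < n)%N -> qpoch q (a ^ (- (4 * s%:Z))) n = 0.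
Proof.
move=> sn; rewrite /qpoch (big_cat_nat (n := s.+1)) //= big_nat_recr //=.
by rewrite qE -pwD addNr expr0z subrr mulr0 mul0r.
Qed.

(* Unlike [qbinom], whose truncated subtraction gives junk for [n < k], this
   vanishes there. *)
Definition gbin n k : F := if (k <= n)%N then qbinom q n k else 0.

Lemma gbinE n k : (k <= n)%N -> gbin n k = pq n / (pq (n - k) * pq k).
Proof. by rewrite /gbin => ->. Qed.

Lemma gbin_small n k : (n < k)%N -> gbin n k = 0.
Proof. by rewrite ltnNge /gbin => /negbTE ->. Qed.

Lemma gbin0 n : gbin n 0 = 1.
Proof. by rewrite gbinE // subn0 qpoch0 mulr1 divff ?pq_neq0. Qed.

Lemma gbinn n : gbin n n = 1.
Proof. by rewrite gbinE // subnn qpoch0 mul1r divff ?pq_neq0. Qed.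

Lemma gbinS n k : gbin n.+1 k.+1 = gbin n k + q ^+ k.+1 * gbin n k.+1.
Proof.
case: (ltngtP n k) => nk.
- by rewrite !gbin_small ?mulr0 ?addr0 // ltnW.
- have [d ->] : exists d, n = (k + d).+1 by exists (n - k.+1)%N; lia.
  rewrite !gbinE //; try lia.
  have -> : ((k + d).+2 - k.+1 = d.+1)%N by lia.
  have -> : ((k + d).+1 - k = d.+1)%N by lia.
  have -> : ((k + d).+1 - k.+1 = d)%N by lia.
  rewrite (pqS (k + d).+1) (pqS k) (pqS d).
  have -> : q ^+ (k + d).+2 = q ^+ k.+1 * q ^+ d.+1 by rewrite -exprD; congr (_ ^+ _); lia.
  have := pq_neq0 k; have := pq_neq0 d; have := @qX_neq1 k.+1 isT; have := @qX_neq1 d.+1 isT.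
  set x := q ^+ k.+1; set y := q ^+ d.+1 => h1 h2 h3 h4.
  by field; rewrite h1 h2 h3 h4.
- by rewrite nk !gbinn gbin_small // mulr0 addr0.
Qed.

Lemma gbinSr n k : (k <= n)%N -> gbin n.+1 k.+1 = q ^+ (n - k) * gbin n k + gbin n k.+1.
Proof.
rewrite leq_eqVlt => /orP[/eqP <-|nk].
  by rewrite !gbinn gbin_small // subnn expr0 mulr1 addr0.
have [d ->] : exists d, n = (k + d).+1 by exists (n - k.+1)%N; lia.
rewrite !gbinE //; try lia.
have -> : ((k + d).+2 - k.+1 = d.+1)%N by lia.
have -> : ((k + d).+1 - k = d.+1)%N by lia.
have -> : ((k + d).+1 - k.+1 = d)%N by lia.
rewrite (pqS (k + d).+1) (pqS k) (pqS d).
have -> : q ^+ (k + d).+2 = q ^+ k.+1 * q ^+ d.+1 by rewrite -exprD; congr (_ ^+ _); lia.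
have := pq_neq0 k; have := pq_neq0 d; have := @qX_neq1 k.+1 isT; have := @qX_neq1 d.+1 isT.
set x := q ^+ k.+1; set y := q ^+ d.+1 => h1 h2 h3 h4.
by field; rewrite h1 h2 h3 h4.
Qed.

Lemma gbinM b j i : (i <= j <= b)%N -> gbin b j * gbin j i = gbin b i * gbin (b - i) (j - i).
Proof.
move=> /andP[ij jb]; rewrite !gbinE //; try lia.
have -> : (b - i - (j - i) = b - j)%N by lia.
by field; rewrite !pq_neq0.
Qed.

(** The two q-Pascal rules in summed form drive the inductions below: this one serves the q-series
    and the powers of Delta E, and [sum_gbinS] the powers of Delta F. *)
Lemma sum_gbinSr n (G : nat -> F) :
  \sum_(i < n.+2) gbin n.+1 i * G i =
  \sum_(i < n.+1) gbin n i * (G i + q ^+ (n - i) * G i.+1).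
Proof.
rewrite big_ord_recl gbin0 /= mul1r.
under eq_bigr => i _ do rewrite /bump add1n gbinSr ?mulrDl -1?ltnS ?ltn_ord //.
rewrite big_split /= addrCA addrC.
under [RHS]eq_bigr => i _ do rewrite mulrDr.
rewrite [RHS]big_split /=; congr (_ + _); last first.
  by apply: eq_bigr => i _; rewrite -mulrA mulrCA.
rewrite [RHS]big_ord_recl gbin0 mul1r; congr (_ + _).
by rewrite big_ord_recr /= gbin_small // mul0r addr0.
Qed.

Lemma sum_gbinS n (G : nat -> F) :
  \sum_(i < n.+2) gbin n.+1 i * G i =
  \sum_(i < n.+1) gbin n i * (q ^+ i * G i + G i.+1).
Proof.
rewrite big_ord_recl gbin0 /= mul1r.
under eq_bigr => i _ do rewrite /bump add1n gbinS mulrDl.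
rewrite big_split /= addrCA addrC.
under [RHS]eq_bigr => i _ do rewrite mulrDr.
rewrite [RHS]big_split /=; congr (_ + _).
rewrite [RHS]big_ord_recl gbin0 expr0 !mul1r; congr (_ + _).
rewrite big_ord_recr /= gbin_small // mulr0 mul0r addr0.
by apply: eq_bigr => i _; rewrite -mulrA mulrCA.
Qed.

Lemma qbinomial_theorem n (x : F) :
  \sum_(i < n.+1) gbin n i * ((-1) ^+ i * a ^ (2 * i%:Z * (i%:Z - 1)) * x ^+ i) =
  qpoch q x n.
Proof.
elim: n x => [|n IH] x.
  by rewrite big_ord1 gbin0 qpoch0 !expr0 mulr0 mul0r expr0z !mulr1.
rewrite (sum_gbinSr n (fun i => (-1) ^+ i * a ^ (2 * i%:Z * (i%:Z - 1)) * x ^+ i)). cbv beta.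
rewrite qpochS -IH mulr_suml; apply: eq_bigr => i _.
have hi : (i <= n)%N by rewrite -ltnS.
rewrite -[RHS]mulrA; congr (_ * _).
rewrite (exprS (-1)) (exprS x).
have -> : a ^ (2 * i.+1%:Z * (i.+1%:Z - 1)) = a ^ (2 * i%:Z * (i%:Z - 1)) * a ^ (4 * i%:Z).
  by rewrite -pwD; congr (_ ^ _); ring.
have -> : q ^+ n = a ^ (4 * (n - i)%N%:Z) * a ^ (4 * i%:Z).
  by rewrite qE -pwD; congr (_ ^ _); rewrite -subzn //; ring.
rewrite !qE; ring.
Qed.

(** By q-Pascal the sum for n + 1 is x times the sum for n at x, plus 1 - x times the sum for n at x
    q; both sums are 1. *)
Lemma gauss_expansion n (x : F) :
  \sum_(j < n.+1) gbin n j * (x ^+ (n - j) * qpoch q x j) = 1.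
Proof.
elim: n x => [|n IH] x.
  by rewrite big_ord1 gbin0 qpoch0 !expr0 !mulr1.
rewrite (sum_gbinSr n (fun j => x ^+ (n.+1 - j) * qpoch q x j)). cbv beta.
transitivity (x * (\sum_(j < n.+1) gbin n j * (x ^+ (n - j) * qpoch q x j)) +
  (1 - x) * (\sum_(j < n.+1) gbin n j * ((x * q) ^+ (n - j) * qpoch q (x * q) j))); last first.
  by rewrite !IH !mulr1 addrC subrK.
rewrite !mulr_sumr -big_split /=.
apply: eq_bigr => j _; have hj : (j <= n)%N by rewrite -ltnS.
rewrite subSS subSn // (exprS x) qpochSl exprMn.
ring.
Qed.

(** The q-Chu-Vandermonde sum cleared of denominators, so that c = 0 is allowed; there the
    right-hand side is b^n. *)
Lemma q_vandermonde n (b c : F) :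
  \sum_(d < n.+1) gbin n d * ((-1) ^+ d * a ^ (2 * d%:Z * (d%:Z - 1) + 4 * d%:Z - 4 * n%:Z * d%:Z)
      * qpoch q b d * qpoch q (c * q ^+ d) (n - d)) =
  \prod_(0 <= t < n) (b - c * q ^+ t).
Proof.
elim: n c => [|n IH] c.
  by rewrite big_ord1 gbin0 !qpoch0 big_nil expr0 !mulr0 mul0r addr0 subrr expr0z !mulr1.
rewrite (sum_gbinSr n (fun d => (-1) ^+ d * a ^ (2 * d%:Z * (d%:Z - 1) + 4 * d%:Z - 4 * n.+1%:Z *
  d%:Z)
      * qpoch q b d * qpoch q (c * q ^+ d) (n.+1 - d))). cbv beta.
rewrite big_nat_recl // expr0 mulr1.
under [in RHS]eq_bigr => t _ do rewrite (exprS q) mulrA.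
rewrite -IH mulr_sumr; apply: eq_bigr => d _.
have dn : (d <= n)%N by rewrite -ltnS.
rewrite subSS subSn // [RHS]mulrCA; congr (_ * _).
rewrite qpochSl qpochS (exprS (-1)) -[c * q * _]mulrA -(exprS q) -[c * _ * q]mulrA -(exprSr q).
have -> : a ^ (2 * d%:Z * (d%:Z - 1) + 4 * d%:Z - 4 * n.+1%:Z * d%:Z)
  = a ^ (2 * d%:Z * (d%:Z - 1) + 4 * d%:Z - 4 * n%:Z * d%:Z) * a ^ (- (4 * d%:Z)).
  by rewrite -pwD; congr (_ ^ _); ring.
have -> : a ^ (2 * d.+1%:Z * (d.+1%:Z - 1) + 4 * d.+1%:Z - 4 * n.+1%:Z * d.+1%:Z)
  = a ^ (2 * d%:Z * (d%:Z - 1) + 4 * d%:Z - 4 * n%:Z * d%:Z) * a ^ (- (4 * d%:Z)) * a ^ (- (4 *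
    (n - d)%N%:Z)).
  by rewrite -!pwD; congr (_ ^ _); rewrite -subzn //; ring.
rewrite !qE.
have -> : a ^ (- (4 * d%:Z)) = (a ^ (4 * d%:Z))^-1 by rewrite pwV.
have -> : a ^ (- (4 * (n - d)%N%:Z)) = (a ^ (4 * (n - d)%N%:Z))^-1 by rewrite pwV.
have := pw_neq0 (4 * d%:Z); have := pw_neq0 (4 * (n - d)%N%:Z).
move: (a ^ (4 * d%:Z)) (a ^ (4 * (n - d)%N%:Z)) => y z z0 y0.
by field; rewrite y0 z0.
Qed.

(* A k-th q-difference annihilates polynomials of degree less than k in q^x. *)
Lemma qdifference (n k : nat) (g : {poly F}) : (n <= k)%N -> (size g <= n.+1)%N ->
  \sum_(x < k.+1) gbin k x * ((-1) ^+ x * a ^ (2 * x%:Z * (x%:Z - 1) - 4 * n%:Z * x%:Z)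
     * g.[a ^ (4 * x%:Z)]) =
  if k == n then g`_0 * qpoch q (a ^ (- (4 * n%:Z))) n else 0.
Proof.
move=> nk sg.
(* The monomial q^(s x), weighted by q^(-n x), sums to (q^(-(n-s)))_k by the q-binomial theorem.
   This vanishes when n - s < k, so only s = 0 with k = n survives. *)
transitivity (\sum_(s < n.+1) g`_s * qpoch q (a ^ (- (4 * (n - s)%N%:Z))) k).
  under eq_bigr => x _ do rewrite (horner_coef_wide _ sg) !mulr_sumr.
  rewrite exchange_big /=; apply: eq_bigr => s _.
  rewrite -qbinomial_theorem mulr_sumr; apply: eq_bigr => x _.
  have -> : a ^ (2 * x%:Z * (x%:Z - 1) - 4 * n%:Z * x%:Z)
    = a ^ (2 * x%:Z * (x%:Z - 1)) * a ^ (- (4 * n%:Z * x%:Z)) by rewrite pwD.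
  have -> : a ^ (- (4 * n%:Z * x%:Z)) = (a ^ (- (4 * (n - s)%N%:Z))) ^+ x * (a ^ (4 * s%:Z *
    x%:Z))^-1.
    rewrite pwX pwV -pwD; congr (_ ^ _).
    have sn : (s <= n)%N by rewrite -ltnS.
    by rewrite -subzn //; ring.
  rewrite (pwX (4 * x%:Z)) (mulrAC 4 x%:Z).
  have := pw_neq0 (4 * s%:Z * x%:Z); move: (a ^ (4 * s%:Z * x%:Z)) => y y0.
  by move: ((-1) ^+ x) ((a ^ _) ^+ x) (a ^ _) => z1 z2 z3; field.
rewrite big_ord_recl /= big1 ?addr0 ?subn0.
  case: eqP => [->//|kn]; rewrite qpoch_pw_eq0 ?mulr0 //.
  by rewrite ltn_neqAle nk andbT eq_sym; apply/eqP.
by move=> i _; rewrite qpoch_pw_eq0 ?mulr0 // /bump; case: i => /= i; lia.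
Qed.

Lemma qintE n : qint a n = a ^ (- (2 * (n%:Z - 1))) * (1 - q ^+ n) / (1 - q).
Proof.
rewrite /qint.
have q1 : 1 - q != 0 by rewrite (@qX_neq1 1).
have e1 : a ^+ n.*2 = a ^ (2 * n%:Z) by rewrite exprnP -muln2 PoszM mulrC.
have -> : a ^- n.*2 = (a ^ (2 * n%:Z))^-1 by rewrite e1.
have -> : q ^+ n = (a ^ (2 * n%:Z)) ^+ 2 by rewrite qE pwX; congr (_ ^ _); ring.
have -> : a ^ (- (2 * (n%:Z - 1))) = (a ^ (2 * n%:Z))^-1 * a ^+ 2.
  by rewrite pwV exprnP -pwD; congr (_ ^ _); ring.
have a4 : a ^+ 2 - a ^- 2 != 0.
  have -> : a ^+ 2 - a ^- 2 = - (1 - q) / a ^+ 2 by rewrite q_def; field.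
  by rewrite mulf_neq0 ?oppr_eq0 ?invr_eq0 ?expf_neq0.
rewrite e1; have := pw_neq0 (2 * n%:Z); move: (a ^ _) => x x0.
rewrite q_def in q1 *; have a41 : a ^+ 4 - 1 != 0 by rewrite -oppr_eq0 opprB.
by field; rewrite x0 a_neq0 q1 -expr2 -exprM a41.
Qed.

Lemma qfactE n : qfact a n = a ^ (- (n%:Z * (n%:Z - 1))) * pq n / (1 - q) ^+ n.
Proof.
rewrite /qfact; elim: n => [|n IH].
  by rewrite big_geq // qpoch0 expr0 mul0r oppr0 expr0z divr1 mulr1.
rewrite big_nat_recr //= IH qintE pqS (exprSr (1 - q)).
have -> : a ^ (- (n.+1%:Z * (n.+1%:Z - 1))) = a ^ (- (n%:Z * (n%:Z - 1))) * a ^ (- (2 *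
  (n.+1%:Z - 1))).
  by rewrite -pwD; congr (_ ^ _); ring.
have q1 : 1 - q != 0 by rewrite -(expr1 q) qX_neq1.
have qn : (1 - q) ^+ n != 0 by rewrite expf_neq0.
by move: (a ^ _) (a ^ _) ((1 - q) ^+ n) qn => x y z z0; field; rewrite q1 z0.
Qed.

Lemma qfact_neq0 n : qfact a n != 0.
Proof.
have q1 : 1 - q != 0 by rewrite -(expr1 q) qX_neq1.
by rewrite qfactE !mulf_neq0 ?invr_eq0 ?pw_neq0 ?pq_neq0 ?expf_neq0.
Qed.

(** * Falling products and the double sum behind the pairing *)

(** For natural m this is (q)_m / (q)_(m-d), continued by 0 to d > m; so the condition x + d <= M
    need not be carried through the sums. *)
Definition falling (m : int) (d : nat) : F := \prod_(0 <= t < d) (1 - a ^ (4 * (m - t%:Z))).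

Lemma fallingE m d : (d <= m)%N -> falling m d * pq (m - d) = pq m.
Proof.
elim: d => [|d IH] dm; first by rewrite /falling big_nil subn0 mul1r.
rewrite -(IH (ltnW dm)) /falling big_nat_recr //=.
have [r ->] : exists r, m = (d + r).+1 by exists (m - d.+1)%N; lia.
have -> : ((d + r).+1 - d.+1 = r)%N by lia.
have -> : ((d + r).+1 - d = r.+1)%N by lia.
rewrite pqS qE -!mulrA; congr (_ * _); rewrite mulrC; congr (_ * (1 - _ ^ _)); ring.
Qed.

Lemma falling_small (m d : nat) : (m < d)%N -> falling m d = 0.
Proof.
move=> md; rewrite /falling (big_cat_nat (n := m.+1)) //= big_nat_recr //=.
by rewrite subrr mulr0 expr0z subrr mulr0 mul0r.
Qed.

(** Both sides are (q)_(M-x) (q)_(M-d) / (q)_(M-x-d), read as 0 when x + d > M. Thanks to this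
    symmetry the summand of the pairing is, up to simple factors, polynomial in q^d as well as in
    q^x. *)
Lemma falling_sym (M x d : nat) : (x <= M)%N -> (d <= M)%N ->
  falling (M%:Z - x%:Z) d * pq (M - d) = falling (M%:Z - d%:Z) x * pq (M - x).
Proof.
move=> xM dM; rewrite !subzn //; case: (leqP (x + d) M) => xd.
  apply: (mulIf (pq_neq0 (M - x - d))).
  have e : (M - x - d = M - d - x)%N by lia.
  rewrite [LHS]mulrAC fallingE; last by lia.
  rewrite e [RHS]mulrAC fallingE; last by lia.
  by rewrite mulrC.
by rewrite !falling_small ?mul0r //; lia.
Qed.

(** The factors are written [1 * _ + - _] to match the linear polynomials [c t *: 'X + (e t)%:P] of
    [horner_prod_linear]. *)
Lemma falling_poly (M x d : nat) :
  a ^ (4 * x%:Z * d%:Z) * falling (M%:Z - x%:Z) d =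
  \prod_(0 <= t < d) (1 * a ^ (4 * x%:Z) + - a ^ (4 * (M%:Z - t%:Z))).
Proof.
rewrite /falling; elim: d => [|d IH]; first by rewrite !big_nil mulr0 expr0z mulr1.
rewrite !big_nat_recr //= -IH.
have -> : a ^ (4 * x%:Z * d.+1%:Z) = a ^ (4 * x%:Z * d%:Z) * a ^ (4 * x%:Z).
  by rewrite -pwD; congr (_ ^ _); ring.
have -> : a ^ (4 * (M%:Z - d%:Z)) = a ^ (4 * x%:Z) * a ^ (4 * (M%:Z - x%:Z - d%:Z)).
  by rewrite -pwD; congr (_ ^ _); ring.
ring.
Qed.

Lemma size_prod_linear (r : nat) (c e : nat -> F) :
  (size (\prod_(0 <= t < r) (c t *: 'X + (e t)%:P) : {poly F})%R <= r.+1)%N.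
Proof.
elim: r => [|r IH]; first by rewrite big_nil size_poly1.
rewrite big_nat_recr //= (leq_trans (size_polyMleq _ _)) //.
have : (size (c r *: 'X + (e r)%:P)%R <= 2)%N.
  rewrite (leq_trans (size_polyD _ _)) // geq_max size_polyC (leq_trans (size_scale_leq _ _))
    ?size_polyX //.
  by case: (e r == 0).
move=> /(leq_add IH) h.
by rewrite -subn1 leq_subLR add1n; apply: leq_trans h _; rewrite addn2.
Qed.

Lemma size_prod_linear2 (r r' : nat) (c e c' e' : nat -> F) :
  (size ((\prod_(0 <= t < r) (c t *: 'X + (e t)%:P)) *
         \prod_(0 <= t < r') (c' t *: 'X + (e' t)%:P) : {poly F})%R <= (r + r').+1)%N.
Proof.
have := leq_add (size_prod_linear r c e) (size_prod_linear r' c' e') => h.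
apply: leq_trans (size_polyMleq _ _) _.
by rewrite -subn1 leq_subLR add1n; apply: leq_trans h _; rewrite addnS.
Qed.

Lemma horner_prod_linear (r : nat) (c e : nat -> F) x :
  (\prod_(0 <= t < r) (c t *: 'X + (e t)%:P)).[x] = \prod_(0 <= t < r) (c t * x + e t).
Proof. by rewrite horner_prod; apply: eq_bigr => t _; rewrite !hornerE. Qed.

Lemma falling_neg (M d : nat) :
  falling M d = qpoch q (a ^ (- (4 * M%:Z))) d * \prod_(0 <= t < d) (- a ^ (4 * (M%:Z - t%:Z))).
Proof.
rewrite /falling /qpoch -big_split /=; apply: eq_bigr => t _.
rewrite qE mulrBl mul1r -!mulrN opprK -!pwD [X in _ = _ + X](_ : _ = 1); last first.
  by rewrite -(expr0z a); congr (_ ^ _); ring.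
by rewrite addrC.
Qed.

Lemma qpoch_neg_neq0 (M d : nat) : (d <= M)%N -> qpoch q (a ^ (- (4 * M%:Z))) d != 0.
Proof.
move=> dM; apply/eqP => h; have := fallingE dM.
by rewrite falling_neg h !mul0r => /esym/eqP; rewrite (negbTE (pq_neq0 _)).
Qed.

(* For k < n the sum over d, and for k > n the sum over x, is a q-difference
   of order exceeding the degree. *)
Lemma pairing_sum (M k n : nat) : (k <= M)%N -> (n <= M)%N ->
  \sum_(x < k.+1) \sum_(d < n.+1) gbin k x * gbin n d *
    ((-1) ^+ (x + d) *
     a ^ (2 * (x + d)%N%:Z * ((x + d)%N%:Z - 1) + 4 * d%:Z - 4 * n%:Z * (x + d)%N%:Z)) *
    (pq (k + d) * (pq (x + n) / pq (x + d)) * (falling (M%:Z - x%:Z) d * pq (M - d))) =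
  if k == n then
    pq k * pq M * qpoch q (a ^ (- (4 * n%:Z))) n *
    \prod_(0 <= t < n) (q ^+ n.+1 - a ^ (- (4 * M%:Z)) * q ^+ t) /
    qpoch q (a ^ (- (4 * M%:Z))) n
  else 0.
Proof.
move=> kM nM; case: (leqP n k) => nk; last first.
  rewrite ltn_eqF //; apply: big1 => x _.
  have xk : (x <= k)%N by rewrite -ltnS.
  (* A polynomial in q^d: degree k - x from (q)_(k+d) / (q)_(x+d) and degree x from the falling
     product, so k <= n - 1 in all. The weight q^(d - n d) is the one that [qdifference] has for the
     degree bound n - 1. *)
  pose g : {poly F} := (\prod_(0 <= t < k - x) ((- (q ^+ (x.+1 + t))) *: 'X + 1%:P)) *
    \prod_(0 <= t < x) (1 *: 'X + (- a ^ (4 * (M%:Z - t%:Z)))%:P).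
  have sg : (size g <= n.-1.+1)%N.
    by apply: leq_trans (size_prod_linear2 _ _ _ _ _ _) _; lia.
  have n1 : (n.-1 <= n)%N by lia.
  have := qdifference n1 sg.
  rewrite [n == _](_ : _ = false); last by lia.
  move=> /(congr1 ( *%R (gbin k x * (-1) ^+ x * a ^ (2 * x%:Z * (x%:Z - 1) - 4 * n%:Z * x%:Z) *
    pq (x + n) * pq (M - x)))).
  rewrite mulr0 => h; apply: etrans h; rewrite mulr_sumr; apply: eq_bigr => d _.
  have dn : (d <= n)%N by rewrite -ltnS.
  rewrite falling_sym //; [|lia|lia].
  rewrite /g hornerM !horner_prod_linear.
  rewrite -falling_poly.
  have -> : pq (k + d) = pq (x + d) * \prod_(0 <= t < k - x) (- q ^+ (x.+1 + t) * a ^ (4 *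
    d%:Z) + 1).
    have -> : (k + d = x + d + (k - x))%N by lia.
    rewrite pqD; congr (_ * _); apply: eq_bigr => t _.
    rewrite [RHS]addrC mulNr -qE -!exprD; congr (1 - _ ^+ _); lia.
  have -> : a ^ (2 * (x + d)%N%:Z * ((x + d)%N%:Z - 1) + 4 * d%:Z - 4 * n%:Z * (x + d)%N%:Z) =
    a ^ (2 * x%:Z * (x%:Z - 1) - 4 * n%:Z * x%:Z) * a ^ (2 * d%:Z * (d%:Z - 1) - 4 * n.-1%:Z * d%:Z)
    * a ^ (4 * d%:Z * x%:Z).
    have -> : n.-1%:Z = n%:Z - 1 by lia.
    by rewrite -!pwD; congr (_ ^ _); ring.
  rewrite exprD; have := pq_neq0 (x + d); move: (pq (x + d)) => y y0.
  rewrite [RHS]mulrCA -[LHS]mulrA -[LHS]mulrA [RHS]mulrCA.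
  move: ((-1) ^+ x) ((-1) ^+ d) (a ^ _) (a ^ _) (a ^ _) (falling _ _) (\prod_(_ <= _ < _) _) => *.
  by field.
rewrite exchange_big /=.
(* What the sum over x leaves for fixed d: a k-th q-difference of a polynomial of degree n in q^x,
   of which only the constant term survives, and only for k = n. *)
pose S (d : nat) : F := (-1) ^+ d * a ^ (2 * d%:Z * (d%:Z - 1) + 4 * d%:Z - 4 * n%:Z * d%:Z) *
  pq (k + d) * pq (M - d) * (if k == n then
    (\prod_(0 <= t < d) (- a ^ (4 * (M%:Z - t%:Z)))) * qpoch q (a ^ (- (4 * n%:Z))) n else 0).
transitivity (\sum_(d < n.+1) gbin n d * S d).
  apply: eq_bigr => d _; have dn : (d <= n)%N by rewrite -ltnS.
  pose g : {poly F} := (\prod_(0 <= t < n - d) ((- (q ^+ (d.+1 + t))) *: 'X + 1%:P)) *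
    \prod_(0 <= t < d) (1 *: 'X + (- a ^ (4 * (M%:Z - t%:Z)))%:P).
  have sg : (size g <= n.+1)%N.
    by apply: leq_trans (size_prod_linear2 _ _ _ _ _ _) _; lia.
  have g0 : g`_0 = \prod_(0 <= t < d) (- a ^ (4 * (M%:Z - t%:Z))).
    rewrite -horner_coef0 hornerM !horner_prod_linear big1 ?mul1r => [|t _].
      by apply: eq_bigr => t _; rewrite ?mulr0 add0r.
    by rewrite mulr0 add0r.
  rewrite /S -g0 -(qdifference nk sg) mulr_sumr mulr_sumr; apply: eq_bigr => x _.
  have xk : (x <= k)%N by rewrite -ltnS.
  rewrite /g hornerM !horner_prod_linear.
  rewrite -falling_poly.
  have -> : pq (x + n) = pq (x + d) * \prod_(0 <= t < n - d) (- q ^+ (d.+1 + t) * a ^ (4 *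
    x%:Z) + 1).
    have -> : (x + n = x + d + (n - d))%N by lia.
    rewrite pqD; congr (_ * _); apply: eq_bigr => t _.
    rewrite [RHS]addrC mulNr -qE -!exprD; congr (1 - _ ^+ _); lia.
  have -> : a ^ (2 * (x + d)%N%:Z * ((x + d)%N%:Z - 1) + 4 * d%:Z - 4 * n%:Z * (x + d)%N%:Z) =
    a ^ (2 * x%:Z * (x%:Z - 1) - 4 * n%:Z * x%:Z) * a ^ (2 * d%:Z * (d%:Z - 1) + 4 * d%:Z - 4 *
      n%:Z * d%:Z)
    * a ^ (4 * x%:Z * d%:Z).
    by rewrite -!pwD; congr (_ ^ _); ring.
  rewrite exprD; have := pq_neq0 (x + d); move: (pq (x + d)) => y y0.
  move: ((-1) ^+ x) ((-1) ^+ d) (a ^ _) (a ^ _) (a ^ _) (falling _ _) (\prod_(_ <= _ < _) _) => *.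
  by field.
rewrite /S; case: eqP => [->|_]; last by apply: big1 => d _; rewrite !mulr0.
(* Here b = q^(n+1) comes from (q)_(n+d) / (q)_n, and c = q^(-M) from the falling product. *)
rewrite -q_vandermonde mulr_sumr mulr_suml; apply: eq_bigr => d _.
have dn : (d <= n)%N by rewrite -ltnS.
have dM : (d <= M)%N by lia.
have e : qpoch q (a ^ (- (4 * M%:Z))) n =
  qpoch q (a ^ (- (4 * M%:Z))) d * qpoch q (a ^ (- (4 * M%:Z)) * q ^+ d) (n - d).
  by rewrite -qpochD subnKC.
rewrite -(fallingE dM) falling_neg pqD e.
have := qpoch_neg_neq0 dM.
have : qpoch q (a ^ (- (4 * M%:Z)) * q ^+ d) (n - d) != 0.
  have := qpoch_neg_neq0 nM; rewrite e mulf_eq0.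
  by case/norP.
move: (qpoch q (a ^ (- (4 * M%:Z))) d) (qpoch q (a ^ (- (4 * M%:Z)) * q ^+ d) (n - d)) => x y x0 y0.
move: ((-1) ^+ d) (a ^ _) (qpoch q (q ^+ n.+1) d) (\prod_(_ <= _ < _) _) => *.
by field; rewrite x0 y0.
Qed.

(** * Representations *)

Lemma dl_neq0 : dl != 0.
Proof.
have -> : dl = - (1 - q) / a ^+ 2 by rewrite q_def; field.
rewrite mulf_neq0 ?oppr_eq0 ?invr_eq0 ?expf_neq0 //.
by rewrite -(expr1 q) qX_neq1.
Qed.

Lemma qint_pw (n : nat) : qint a n = (a ^ (2 * n%:Z) - a ^ (- (2 * n%:Z))) / dl.
Proof.
have e : a ^+ n.*2 = a ^ (2 * n%:Z) by rewrite exprnP -muln2 PoszM mulrC.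
by rewrite /qint e pwV.
Qed.

(** Stated in an abstract algebra because it is used twice: for the transposes of E and F on the
    second strand, and for F and E, in exchanged roles, on the first. *)
Lemma qcomm (A : algType F) (e f k ki : A) (n : nat) :
  e * f - f * e = dl^-1 *: (ki - k) -> k * f = q *: (f * k) -> f * ki = q *: (ki * f) ->
  e * f ^+ n.+1 - f ^+ n.+1 * e =
  (qint a n.+1 * a ^ (- (2 * n%:Z)) / dl) *: (f ^+ n * ki - k * f ^+ n).
Proof.
move=> ef kf fk.
have q0 : q != 0 by rewrite q_def expf_neq0.
have kfn m : k * f ^+ m = q ^+ m *: (f ^+ m * k).
  elim: m => [|m IH]; first by rewrite !expr0 mulr1 mul1r scale1r.
  by rewrite exprSr mulrA IH -scalerAl -[f ^+ m * k * f]mulrA kf -scalerAr scalerA mulrA (exprSr q).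
elim: n => [|n IH].
  by rewrite !expr1 expr0 mulr1 mul1r ef qint_pw !mulr1 mulfV ?mul1r ?dl_neq0.
have -> : e * f ^+ n.+2 - f ^+ n.+2 * e =
    (e * f ^+ n.+1 - f ^+ n.+1 * e) * f + f ^+ n.+1 * (e * f - f * e).
  rewrite [f ^+ n.+2]exprSr; move: (f ^+ n.+1) => g.
  by rewrite mulrBl mulrBr !mulrA addrA subrK.
rewrite IH ef -scalerAl mulrBl -[f ^+ n * ki * f]mulrA.
have -> : ki * f = q^-1 *: (f * ki) by rewrite fk scalerA mulVf // scale1r.
rewrite -scalerAr -[k * f ^+ n * f]mulrA -exprSr mulrA -exprSr kfn.
rewrite -scalerAr mulrBr.
move: (f ^+ n.+1 * ki) (f ^+ n.+1 * k) => X Y.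
rewrite !scalerBr !scalerA addrACA -scalerDl -opprD -scalerDl.
rewrite !qint_pw.
have -> : q ^+ n.+1 = a ^ (4 * n%:Z) * a ^+ 4.
  by rewrite exprSr qE q_def.
have -> : a ^ (2 * n.+2%:Z) = a ^ (2 * n%:Z) * a ^+ 4.
  by rewrite exprnP -pwD; congr (_ ^ _); ring.
have -> : a ^ (2 * n.+1%:Z) = a ^ (2 * n%:Z) * a ^+ 2.
  by rewrite exprnP -pwD; congr (_ ^ _); ring.
have -> : a ^ (- (2 * n.+2%:Z)) = a ^ (- (2 * n%:Z)) * a ^- 4.
  by rewrite exprnN -pwD; congr (_ ^ _); ring.
have -> : a ^ (- (2 * n.+1%:Z)) = a ^ (- (2 * n%:Z)) * a ^- 2.
  by rewrite exprnN -pwD; congr (_ ^ _); ring.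
have -> : a ^ (- (2 * n%:Z)) = (a ^ (2 * n%:Z))^-1 by rewrite pwV.
have -> : a ^ (4 * n%:Z) = (a ^ (2 * n%:Z)) ^+ 2 by rewrite pwX; congr (_ ^ _); ring.
have := pw_neq0 (2 * n%:Z); move: (a ^ _) => z z0.
have dn : a ^+ 4 - 1 != 0.
  apply/eqP => h; have := dl_neq0; rewrite (_ : dl = (a ^+ 4 - 1) / a ^+ 2); last by field.
  by rewrite h mul0r eqxx.
rewrite q_def; congr (_ *: _ - _ *: _); field; rewrite ?z0 ?a_neq0 -?expr2 -?exprM ?dn //.
Qed.

(* The coefficients of E^n (x) F^n in R and R^-1, up to the powers of q
   coming from H (x) H. *)
Definition thetac (n : nat) : F := a ^+ (n * n.-1) * dl ^+ n / qfact a n.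
Definition thetaVc (n : nat) : F := (-1) ^+ n * a ^- (n * n.-1) * dl ^+ n / qfact a n.

(** The factor is the coefficient in [qcomm]. This recursion lets a commutator with the n.+1-st term
    of the R-matrix cancel against the n-th term. *)
Lemma thetacS n : thetac n.+1 * (qint a n.+1 * a ^ (- (2 * n%:Z)) / dl) = thetac n.
Proof.
rewrite /thetac.
have qf : qfact a n.+1 = qfact a n * qint a n.+1 by rewrite /qfact big_nat_recr.
have := qfact_neq0 n.+1; rewrite qf mulf_eq0 => /norP[f0 i0].
have -> : a ^+ (n.+1 * n.+1.-1) = a ^+ (n * n.-1) * a ^ (2 * n%:Z).
  rewrite !exprnP -pwD; congr (_ ^ _); case: n {qf f0 i0} => //= n; ring.
have -> : a ^ (- (2 * n%:Z)) = (a ^ (2 * n%:Z))^-1 by rewrite pwV.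
have := dl_neq0; set z := dl => z0; rewrite (exprSr z).
have := pw_neq0 (2 * n%:Z).
move: (a ^ _) (a ^+ _) (z ^+ n) (qint _ _) (qfact _ _) f0 i0 => x y w i f f0 i0 x0.
by field; rewrite x0 f0 i0 z0.
Qed.

(** This is the q-binomial theorem at x = 1, where (1)_s = 0. *)
Lemma thetac_inv (s : nat) : (0 < s)%N ->
  \sum_(i < s.+1) thetac i * thetaVc (s - i) = 0.
Proof.
move=> s0.
transitivity (dl ^+ s / qfact a s * (-1) ^+ s * a ^ (- (s%:Z * (s%:Z - 1))) *
  (\sum_(i < s.+1) gbin s i * ((-1) ^+ i * a ^ (2 * i%:Z * (i%:Z - 1)) * 1 ^+ i))).
  rewrite mulr_sumr; apply: eq_bigr => i _.
  have hi : (i <= s)%N by rewrite -ltnS.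
  have ex (m : nat) : a ^+ (m * m.-1) = a ^ (m%:Z * (m%:Z - 1)).
    by rewrite exprnP; congr (_ ^ _); case: m => //= m; ring.
  rewrite /thetac /thetaVc !ex !qfactE (gbinE hi) expr1n mulr1.
  move: (nat_of_ord i) hi => k hk.
  have [j ->] : exists j, s = (k + j)%N by exists (s - k)%N; lia.
  rewrite addKn !exprD -!pwV.
  have -> : a ^ (2 * k%:Z * (k%:Z - 1)) = a ^ (k%:Z * (k%:Z - 1)) * a ^ (k%:Z * (k%:Z - 1)).
    by rewrite -pwD; congr (_ ^ _); ring.
  have := pq_neq0 k; have := pq_neq0 j.
  have := pq_neq0 (k + j); have := expf_neq0 k (qX_neq1 (isT : 0 < 1)%N).
  have := expf_neq0 j (qX_neq1 (isT : 0 < 1)%N); rewrite expr1.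
  have := pw_neq0 (k%:Z * (k%:Z - 1)); have := pw_neq0 (j%:Z * (j%:Z - 1)).
  have := pw_neq0 ((k + j)%N%:Z * ((k + j)%N%:Z - 1)).
  rewrite -(signr_odd _ k); move: (dl ^+ k) (dl ^+ j) ((1 - q) ^+ k) ((1 - q) ^+ j).
  move: (a ^ _) (a ^ _) (a ^ _) (qpoch q q _) (qpoch q q _) (qpoch q q _) ((-1) ^+ j).
  move=> x1 x2 x3 x4 x5 x6 x7 x8 x9 x10 x11 h1 h2 h3 h4 h5 h6 h7 h8.
  case: odd; rewrite ?expr0 ?expr1; field; by rewrite ?h1 ?h2 ?h3 ?h4 ?h5 ?h6 ?h7 ?h8.
rewrite qbinomial_theorem.
by case: s s0 => // s _; rewrite qpochSl subrr mul0r mulr0.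
Qed.

Variable M : nat.

Local Notation N := M.+1.
Local Notation mat := 'M[F]_M.+1.

Definition sE (b : bool) : mat := strandE a N b.
Definition sF (b : bool) : mat := strandF a N b.
Definition wtH (b : bool) (i : 'I_N) : int := strandH b i.
Definition sK (b : bool) : mat := diag_mx (\row_i a ^ (2 * wtH b i)).
Definition sKV (b : bool) : mat := diag_mx (\row_i a ^ (- (2 * wtH b i))).

Lemma sE_true i j : sE true i j = if i.+1 == j :> nat then qint a (M - i) else 0.
Proof. by rewrite mxE; case: eqP => // <-; rewrite subSS. Qed.

Lemma sF_true i j : sF true i j = if i == j.+1 :> nat then qint a i else 0.
Proof. by rewrite mxE. Qed.

Lemma diag_mulr (A : mat) (d : 'rV[F]_N) i j : (A * diag_mx d) i j = A i j * d 0 j.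
Proof. by rewrite -mulmxE mul_mx_diag !mxE. Qed.

Lemma diag_mull (A : mat) (d : 'rV[F]_N) i j : (diag_mx d * A) i j = d 0 i * A i j.
Proof. by rewrite -mulmxE mul_diag_mx !mxE. Qed.

Lemma sE_false i j :
  sE false i j = if j.+1 == i :> nat then - (qint a (M - j) * a ^ (- (2 * weight i))) else 0.
Proof.
rewrite /sE /strandE mxE mxE mulmxE diag_mulr [matE _ _ _ _]sE_true mxE.
by case: eqP => // _; rewrite mul0r oppr0.
Qed.

Lemma sF_false i j :
  sF false i j = if i.+1 == j :> nat then - (a ^ (2 * weight j) * qint a j) else 0.
Proof.
rewrite /sF /strandF mxE mxE mulmxE diag_mull [matF _ _ _ _]sF_true mxE eq_sym.
by case: eqP => // _; rewrite mulr0 oppr0.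
Qed.

(** With f arbitrary, the lemma moves powers of [a] past E and, with the indicator of a weight for
    f, shows that entries vanish. *)
Lemma sE_wt b i j (f : int -> F) : f (wtH b i) * sE b i j = f (wtH b j + 2) * sE b i j.
Proof.
case: b; rewrite ?sE_true ?sE_false; case: eqP => [e|]; rewrite ?mulr0 //.
  congr (f _ * _); rewrite /wtH /= /weight -e; lia.
congr (f _ * _); rewrite /wtH /= /weight -e; lia.
Qed.

Lemma sF_wt b i j (f : int -> F) : f (wtH b i) * sF b i j = f (wtH b j - 2) * sF b i j.
Proof.
case: b; rewrite ?sF_true ?sF_false; case: eqP => [e|]; rewrite ?mulr0 //.
  congr (f _ * _); rewrite /wtH /= /weight e; lia.
congr (f _ * _); rewrite /wtH /= /weight -e; lia.
Qed.

Lemma sEX_wt b n i j (f : int -> F) :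
  f (wtH b i) * (sE b ^+ n) i j = f (wtH b j + (2 * n)%N%:Z) * (sE b ^+ n) i j.
Proof.
elim: n f i j => [|n IH] f i j.
  rewrite expr0 muln0 addr0 mxE; case: eqP => [->//|_]; by rewrite !mulr0.
rewrite exprS -mulmxE mxE !mulr_sumr; apply: eq_bigr => k _.
rewrite !mulrA (sE_wt b i k f) mulrAC (IH (fun h => f (h + 2))) mulrAC.
by congr (f _ * _ * _); lia.
Qed.

Lemma sFX_wt b n i j (f : int -> F) :
  f (wtH b i) * (sF b ^+ n) i j = f (wtH b j - (2 * n)%N%:Z) * (sF b ^+ n) i j.
Proof.
elim: n f i j => [|n IH] f i j.
  rewrite expr0 muln0 subr0 mxE; case: eqP => [->//|_]; by rewrite !mulr0.
rewrite exprS -mulmxE mxE !mulr_sumr; apply: eq_bigr => k _.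
rewrite !mulrA (sF_wt b i k f) mulrAC (IH (fun h => f (h - 2))) mulrAC.
by congr (f _ * _ * _); lia.
Qed.

(** The weights span an interval of length 2 M, while E^N would shift them by 2 N. *)
Lemma sEX_eq0 b : sE b ^+ N = 0.
Proof.
apply/matrixP => i j; rewrite [RHS]mxE.
have := sEX_wt b N i j (fun h => (h == wtH b i)%:R); rewrite eqxx mul1r => ->.
rewrite (_ : _ == _ = false) ?mul0r //; apply/eqP; rewrite /wtH /strandH /weight.
have := ltn_ord i; have := ltn_ord j; case: b; lia.
Qed.

Lemma sFX_eq0 b : sF b ^+ N = 0.
Proof.
apply/matrixP => i j; rewrite [RHS]mxE.
have := sFX_wt b N i j (fun h => (h == wtH b i)%:R); rewrite eqxx mul1r => ->.
rewrite (_ : _ == _ = false) ?mul0r //; apply/eqP; rewrite /wtH /strandH /weight.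
have := ltn_ord i; have := ltn_ord j; case: b; lia.
Qed.

Lemma sKE b : sK b * sE b = q *: (sE b * sK b).
Proof.
apply/matrixP => i j; rewrite diag_mull [RHS]mxE diag_mulr !mxE (sE_wt b i j (fun h =>
  a ^ (2 * h))).
by rewrite mulrDr pwD q_def exprnP; ring.
Qed.

Lemma sKVE b : sE b * sKV b = q *: (sKV b * sE b).
Proof.
apply/matrixP => i j; rewrite diag_mulr [RHS]mxE diag_mull !mxE (sE_wt b i j (fun h =>
  a ^ (- (2 * h)))).
by rewrite [LHS]mulrC mulrA; congr (_ * _); rewrite q_def exprnP -pwD; congr (_ ^ _); ring.
Qed.

Lemma sKF b : sF b * sK b = q *: (sK b * sF b).
Proof.
apply/matrixP => i j; rewrite diag_mulr [RHS]mxE diag_mull !mxE (sF_wt b i j (fun h =>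
  a ^ (2 * h))).
by rewrite [LHS]mulrC mulrA; congr (_ * _); rewrite q_def exprnP -pwD; congr (_ ^ _); ring.
Qed.

Lemma sKVF b : sKV b * sF b = q *: (sF b * sKV b).
Proof.
apply/matrixP => i j; rewrite diag_mull [RHS]mxE diag_mulr !mxE (sF_wt b i j (fun h =>
  a ^ (- (2 * h)))).
by rewrite mulrBr opprB pwD q_def exprnP; ring.
Qed.

Lemma sum_pick (n m : nat) (G : nat -> F) :
  \sum_(k < n) (if m == k :> nat then G k else 0) = if (m < n)%N then G m else 0.
Proof.
rewrite -big_mkcond /=; case: ltnP => mn; last first.
  by apply: big1 => k /eqP e; have := ltn_ord k; rewrite -e ltnNge mn.
by rewrite (big_pred1 (Ordinal mn)) // => k /=; rewrite -val_eqE eq_sym.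
Qed.

(** Entries indexed by natural numbers, 0 outside the matrix, so that E and F shift indices without
    arithmetic on ordinals. *)
Definition ent (T : mat) (i j : nat) : F :=
  if (i < N)%N && (j < N)%N then T (inord i) (inord j) else 0.

Lemma entE T (i j : 'I_N) : ent T i j = T i j.
Proof. by rewrite /ent !ltn_ord !inord_val. Qed.

Lemma ent_out T i j : (M < i)%N || (M < j)%N -> ent T i j = 0.
Proof.
move=> h; rewrite /ent (_ : _ && _ = false) //.
by case/orP: h => h; rewrite !ltnS [X in X && _]leqNgt [X in _ && X]leqNgt h ?andbF.
Qed.

Lemma entP A B : (forall i j, (i <= M)%N -> (j <= M)%N -> ent A i j = ent B i j) -> A = B.
Proof. by move=> h; apply/matrixP => i j; rewrite -!entE h // -ltnS. Qed.

Lemma ent_tr T i j : ent T^T i j = ent T j i.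
Proof. by rewrite /ent andbC; case: ifP => // _; rewrite mxE. Qed.

Lemma entZ c T i j : ent (c *: T) i j = c * ent T i j.
Proof. by rewrite /ent; case: ifP => _; rewrite ?mulr0 // mxE. Qed.

Lemma entD A B i j : ent (A + B) i j = ent A i j + ent B i j.
Proof. by rewrite /ent; case: ifP => _; rewrite ?addr0 // mxE. Qed.

Lemma entN A i j : ent (- A) i j = - ent A i j.
Proof. by rewrite /ent; case: ifP => _; rewrite ?oppr0 // mxE. Qed.

Lemma ent0 i j : ent 0 i j = 0.
Proof. by rewrite /ent; case: ifP => _; rewrite ?mxE. Qed.

Lemma ent_sum (I : Type) (r : seq I) (P : pred I) (G : I -> mat) i j :
  ent (\sum_(k <- r | P k) G k) i j = \sum_(k <- r | P k) ent (G k) i j.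
Proof.
exact: (big_morph (fun T => ent T i j) (fun A B => entD A B i j) (ent0 i j)).
Qed.

(* On the dual of V, E e^j = cEf j e^(j+1) and F e^j = cFf j e^(j-1). *)
Definition cEf (j : nat) : F := - (qint a (M - j) * a ^ (- (2 * (M%:Z - (2 * j.+1)%N%:Z)))).
Definition cFf (j : nat) : F := - (a ^ (2 * (M%:Z - (2 * j)%N%:Z)) * qint a j).

Lemma qint0 : qint a 0 = 0.
Proof. by rewrite /qint expr0 invr1 subrr mul0r. Qed.

Lemma weightE (i : 'I_N) : weight i = M%:Z - (2 * i)%N%:Z.
Proof. rewrite /weight; lia. Qed.

Lemma ent_mulsum A T i j : (i <= M)%N -> (j <= M)%N ->
  ent (A * T) i j = \sum_(k < N) ent A i k * ent T k j.
Proof.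
move=> iM jM; rewrite {1}/ent !ltnS iM jM /= -mulmxE mxE; apply: eq_bigr => k _.
by rewrite /ent !ltnS iM jM -ltnS ltn_ord /= inord_val.
Qed.

Lemma ent_sEt (T : mat) i j : ent (sE true * T) i j = qint a (M - i) * ent T i.+1 j.
Proof.
case: (leqP i M) => iM; last by rewrite !ent_out ?mulr0 ?iM // ltnW.
case: (leqP j M) => jM; last by rewrite !ent_out ?mulr0 ?jM ?orbT.
transitivity (if (i.+1 < N)%N then qint a (M - i) * ent T i.+1 j else 0); last first.
  by case: ltnP => // Mi; rewrite ent_out ?mulr0 // Mi.
rewrite ent_mulsum // -(@sum_pick M.+1 i.+1 (fun k => qint a (M - i) * ent T k j));
  apply: eq_bigr => k _.
rewrite /ent !ltnS iM -ltnS ltn_ord /= sE_true inordK // inord_val.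
by case: eqP => _; rewrite ?mul0r.
Qed.

(** At i = 0 the spurious entry with [i.-1 = 0] is multiplied by [0] = 0. *)
Lemma ent_sFt (T : mat) i j : (i <= M)%N -> ent (sF true * T) i j = qint a i * ent T i.-1 j.
Proof.
move=> iM; case: (leqP j M) => jM; last by rewrite !ent_out ?mulr0 ?jM ?orbT.
case: i iM => [|i] iM /=.
  rewrite qint0 mul0r ent_mulsum //; apply: big1 => k _.
  by rewrite /ent /= ltn_ord sF_true inordK // mul0r.
transitivity (if (i < N)%N then qint a i.+1 * ent T i j else 0); last by rewrite ltnW.
rewrite ent_mulsum // -(@sum_pick M.+1 i (fun k => qint a i.+1 * ent T k j)); apply: eq_bigr => k _.
rewrite /ent !ltnS iM -ltnS ltn_ord /= sF_true !inordK // eqSS.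
by case: eqP => _; rewrite ?mul0r // inord_val.
Qed.

Lemma ent_sEf (T : mat) i j : ent (sE false * T) i.+1 j =
  if (i < M)%N then cEf i * ent T i j else 0.
Proof.
case: ltnP => iM; last by rewrite ent_out // ltnS iM.
case: (leqP j M) => jM; last by rewrite !ent_out ?mulr0 ?jM ?orbT.
transitivity (if (i < N)%N then cEf i * ent T i j else 0); last by rewrite ltnS ltnW.
rewrite ent_mulsum // -(@sum_pick M.+1 i (fun k => cEf i * ent T k j)); apply: eq_bigr => k _.
rewrite /ent !ltnS iM -ltnS ltn_ord /= sE_false !inordK // eqSS inord_val eq_sym.
by case: eqP => [e|_]; rewrite ?mul0r // weightE inordK ?e ?ltnS -?e.
Qed.

Lemma ent_sEf0 (T : mat) j : ent (sE false * T) 0 j = 0.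
Proof.
case: (leqP j M) => jM; last by rewrite !ent_out ?mulr0 ?jM ?orbT.
rewrite ent_mulsum //; apply: big1 => k _.
by rewrite /ent /= ltn_ord sE_false inord_val inordK //= mul0r.
Qed.

Lemma ent_sFf (T : mat) i j : ent (sF false * T) i j = cFf i.+1 * ent T i.+1 j.
Proof.
case: (leqP i M) => iM; last by rewrite !ent_out ?mulr0 ?iM // ltnW.
case: (leqP j M) => jM; last by rewrite !ent_out ?mulr0 ?jM ?orbT.
transitivity (if (i.+1 < N)%N then cFf i.+1 * ent T i.+1 j else 0); last first.
  by case: ltnP => // Mi; rewrite ent_out ?mulr0 // Mi.
rewrite ent_mulsum // -(@sum_pick M.+1 i.+1 (fun k => cFf i.+1 * ent T k j)); apply: eq_bigr => k _.
rewrite /ent !ltnS iM -ltnS ltn_ord /= sF_false !inordK // inord_val.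
by case: eqP => [->|_]; rewrite ?mul0r // weightE.
Qed.

Lemma ent_diag d i j : (i <= M)%N -> (j <= M)%N ->
  ent (diag_mx d) i j = if i == j then d 0 (inord i) else 0.
Proof.
move=> iM jM; rewrite /ent !ltnS iM jM /= mxE -val_eqE /= !inordK // mulrb.
by case: eqP.
Qed.

Lemma ent_id i j : (i <= M)%N -> (j <= M)%N -> ent 1 i j = (i == j)%:R.
Proof. by move=> iM jM; rewrite /ent !ltnS iM jM /= mxE -val_eqE /= !inordK. Qed.

Lemma qint_comm (i : nat) : (i <= M)%N ->
  qint a (M - i) * qint a i.+1 - qint a i * qint a (M - i).+1 =
  dl^-1 * (a ^ (2 * (M%:Z - (2 * i)%N%:Z)) - a ^ (- (2 * (M%:Z - (2 * i)%N%:Z)))).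
Proof.
move=> iM; rewrite !qint_pw // -!pwV.
have [j ->] : exists j, M = (i + j)%N by exists (M - i)%N; lia.
rewrite addKn.
have -> : a ^ (2 * i.+1%:Z) = a ^ (2 * i%:Z) * a ^+ 2 by rewrite exprnP -pwD; congr (_ ^ _); ring.
have -> : a ^ (2 * j.+1%:Z) = a ^ (2 * j%:Z) * a ^+ 2 by rewrite exprnP -pwD; congr (_ ^ _); ring.
have -> : a ^ (2 * ((i + j)%N%:Z - (2 * i)%N%:Z)) = a ^ (2 * j%:Z) / a ^ (2 * i%:Z).
  by rewrite pwV -pwD; congr (_ ^ _); ring.
have := pw_neq0 (2 * i%:Z); have := pw_neq0 (2 * j%:Z).
have dn : a ^+ 4 - 1 != 0.
  apply/eqP => h; have := dl_neq0; rewrite (_ : dl = (a ^+ 4 - 1) / a ^+ 2); last by field.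
  by rewrite h mul0r eqxx.
move: (a ^ _) (a ^ _) => x y x0 y0; field.
by rewrite x0 y0 a_neq0 -?expr2 -?exprM dn.
Qed.

Lemma comm_EF b : sE b * sF b - sF b * sE b = dl^-1 *: (sK b - sKV b).
Proof.
apply: entP => i j iM jM; rewrite entD entN entZ entD entN !ent_diag // !mxE.
rewrite -[sE b * sF b]mulr1 -[sF b * sE b]mulr1 -!mulrA.
have wi : weight (inord i : 'I_N) = M%:Z - (2 * i)%N%:Z by rewrite weightE inordK.
case: b; rewrite /wtH /strandH wi.
  transitivity ((qint a (M - i) * qint a i.+1 - qint a i * qint a (M - i).+1) * ent 1 i j).
    rewrite ent_sEt (ent_sFt (sE true * 1)) // ent_sEt mulrBl; congr (_ - _).
      move: iM; rewrite leq_eqVlt => /orP[/eqP ->|iM]; first by rewrite subnn qint0 !mul0r.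
      by rewrite ent_sFt // mulrA.
    case: i iM {wi} => [|i] iM; first by rewrite qint0 !mul0r.
    by rewrite /= mulrA subnSK.
  by rewrite qint_comm // ent_id //; case: eqP => _; rewrite ?mulr1 // subr0 !mulr0.
transitivity ((qint a i * qint a (M - i).+1 - qint a (M - i) * qint a i.+1) * ent 1 i j);
  last first.
  rewrite -opprB qint_comm // ent_id //; case: eqP => _; rewrite ?subr0 ?mulr0 // mulr1.
  by rewrite -mulrN opprB !mulrN opprK.
have ef k : cEf k * cFf k.+1 = qint a (M - k) * qint a k.+1.
  rewrite /cEf /cFf mulrNN -pwV.
  have := pw_neq0 (2 * (M%:Z - (2 * k.+1)%N%:Z)); move: (a ^ _) => x x0.
  by field.
rewrite mulrBl; congr (_ - _).
  case: i iM {wi} => [|i] iM; first by rewrite ent_sEf0 qint0 !mul0r.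
  by rewrite ent_sEf iM ent_sFf mulrA ef subnSK // [qint _ _ * _]mulrC.
rewrite ent_sFf ent_sEf; case: ltnP => Mi; first by rewrite mulrA (mulrC (cFf _)) ef.
have -> : (M - i = 0)%N by lia.
by rewrite mulr0 qint0 !mul0r.
Qed.

(** * Braiding *)

(* A tensor on two strands is the matrix T of its coordinates, so that X (x) Y
   maps T to X T Y^T.  dE, dF and dK are the actions of Delta E, Delta F and
   Delta K; sig and sigV are the braiding and the inverse braiding. *)
Definition dE (b c : bool) (T : mat) : mat := T * (sE c)^T + sE b * T * sK c.
Definition dF (b c : bool) (T : mat) : mat := sKV b * T * (sF c)^T + sF b * T.
Definition dK (b c : bool) (T : mat) : mat := sK b * T * sK c.

Definition theta (b c : bool) (T : mat) : mat :=
  \sum_(n < N) thetac n *: (sE b ^+ n * T * (sF c)^T ^+ n).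
Definition thetaV (b c : bool) (T : mat) : mat :=
  \sum_(n < N) thetaVc n *: (sE b ^+ n * T * (sF c)^T ^+ n).
Definition Dm (s : int) (b c : bool) (T : mat) : mat :=
  \matrix_(u, v) (a ^ (s * (wtH b u * wtH c v)) * T u v).

Definition sig (b c : bool) (T : mat) : mat := (Dm 1 b c (theta b c T))^T.
Definition sigV (b c : bool) (T : mat) : mat := thetaV c b (Dm (-1) c b T^T).

Fact sig_linear b c : linear (sig b c).
Proof.
move=> k A B; rewrite /sig; apply/matrixP => u v; rewrite !mxE.
rewrite (_ : theta b c (k *: A + B) = k *: theta b c A + theta b c B); first by rewrite !mxE; ring.
rewrite /theta scaler_sumr -big_split /=; apply: eq_bigr => n _.
by rewrite mulrDr mulrDl -scalerAr -scalerAl scalerDr !scalerA mulrC.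
Qed.

Fact sigV_linear b c : linear (sigV b c).
Proof.
move=> k A B; rewrite /sigV.
rewrite (_ : Dm (-1) c b (k *: A + B)^T = k *: Dm (-1) c b A^T + Dm (-1) c b B^T); last first.
  by apply/matrixP => u v; rewrite !mxE; ring.
rewrite /thetaV scaler_sumr -big_split /=; apply: eq_bigr => n _.
by rewrite mulrDr mulrDl -scalerAr -scalerAl scalerDr !scalerA mulrC.
Qed.

HB.instance Definition _ b c := GRing.isLinear.Build F mat mat _ (sig b c) (sig_linear b c).
HB.instance Definition _ b c := GRing.isLinear.Build F mat mat _ (sigV b c) (sigV_linear b c).

Lemma trM (A B : mat) : (A * B)^T = B^T * A^T.
Proof. by rewrite -!mulmxE trmx_mul. Qed.

Lemma trmxX (A : mat) n : (A ^+ n)^T = A^T ^+ n.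
Proof.
elim: n => [|n IH]; first by rewrite !expr0 trmx1.
by rewrite exprS exprSr -IH trM.
Qed.

(** The bridge from the coordinate formulas for a crossing to matrices; b and c are the orientations
    of the incoming strands. *)
Lemma cross_coefE (s b c : bool) (T : mat) x y :
  \sum_x' \sum_y' cross_coef a s b c x y x' y' * T x' y' =
  (if s then sig b c T else sigV b c T) x y.
Proof.
have ex (A B : mat) u v : (A * T * B^T) u v = \sum_x' \sum_y' A u x' * B v y' * T x' y'.
  rewrite -mulmxE mxE exchange_big /=; apply: eq_bigr => y' _.
  rewrite mxE mulr_suml; apply: eq_bigr => x' _; rewrite mxE; ring.
have ex' (A B : mat) u v : (A * Dm (-1) c b T^T * B^T) u v =
    \sum_x' \sum_y' A u y' * B v x' * (a ^ (- (wtH c y' * wtH b x')) * T x' y').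
  rewrite -mulmxE mxE; apply: eq_bigr => x' _.
  rewrite mxE mulr_suml; apply: eq_bigr => y' _; rewrite !mxE mulN1r; ring.
case: s; rewrite /cross_coef.
  rewrite !mxE mul1r summxE mulr_sumr.
  under [RHS]eq_bigr => n _ do rewrite mxE -trmxX ex mulr_sumr mulr_sumr.
  rewrite [RHS]exchange_big /=; apply: eq_bigr => x' _.
  under [RHS]eq_bigr => n _ do rewrite mulr_sumr mulr_sumr.
  rewrite [RHS]exchange_big /=; apply: eq_bigr => y' _.
  rewrite /Rcoef mulr_sumr mulr_suml; apply: eq_bigr => n _.
  rewrite /thetac /wtH /sE /sF.
  move: (a ^ _) (a ^+ _) (_ ^+ n) (qfact _ _) => *; ring.
rewrite summxE.
under [RHS]eq_bigr => n _ do rewrite mxE -trmxX ex' mulr_sumr.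
rewrite [RHS]exchange_big /=; apply: eq_bigr => x' _.
under [RHS]eq_bigr => n _ do rewrite mulr_sumr.
rewrite [RHS]exchange_big /=; apply: eq_bigr => y' _.
rewrite /RVcoef mulr_sumr mulr_suml; apply: eq_bigr => n _.
rewrite /thetaVc /wtH /sE /sF.
move: (a ^ _) (a ^- _) (_ ^+ n) (_ ^+ n) (qfact _ _) => *; ring.
Qed.

Lemma sK_tr c : (sK c)^T = sK c.
Proof. exact: tr_diag_mx. Qed.

Lemma sKV_tr c : (sKV c)^T = sKV c.
Proof. exact: tr_diag_mx. Qed.

(** In operators, Theta (1 (x) E + E (x) K) = (E (x) K^-1 + 1 (x) E) Theta. Moving E past F^n gives
    commutators; their K part cancels the terms from E (x) K and their K^-1 part becomes E (x)
    K^-1. *)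
Lemma theta_dE b c T :
  theta b c (dE b c T) = sE b * theta b c T * sKV c + theta b c T * (sE c)^T.
Proof.
have qc n := @qcomm _ (sE c)^T (sF c)^T (sK c) (sKV c) n.
have r1 : (sE c)^T * (sF c)^T - (sF c)^T * (sE c)^T = dl^-1 *: (sKV c - sK c).
  by rewrite -!trM -[LHS]opprB -linearB /= comm_EF linearZ linearB /= sK_tr sKV_tr -scalerN opprB.
have r2 : sK c * (sF c)^T = q *: ((sF c)^T * sK c).
  by rewrite -{1}sK_tr -trM sKF linearZ /= trM sK_tr.
have r3 : (sF c)^T * sKV c = q *: (sKV c * (sF c)^T).
  by rewrite -{1}sKV_tr -trM sKVF linearZ /= trM sKV_tr.
have {r1 r2 r3} qc n := qc n r1 r2 r3.
set e := (sE c)^T; set f := (sF c)^T; set k := sK c; set ki := sKV c.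
pose G n : mat := thetac n *: (sE b ^+ n * T * f ^+ n).
(* The index is shifted by one: the commutator vanishes at n = 0, and E^N = 0 removes the top term
   on the right. *)
have key : \sum_(n < N) thetac n *: (sE b ^+ n * T * (e * f ^+ n - f ^+ n * e)) =
    \sum_(n < N) thetac n *: (sE b ^+ n.+1 * T * (f ^+ n * ki - k * f ^+ n)).
  rewrite big_ord_recl /= !expr0 !mul1r !mulr1 subrr mulr0 scaler0 add0r.
  rewrite [RHS]big_ord_recr /= sEX_eq0 !mul0r scaler0 addr0.
  apply: eq_bigr => n _; rewrite /bump add1n qc -scalerAr scalerA.
  by rewrite thetacS.
rewrite /theta mulr_sumr !mulr_suml.
transitivity (\sum_(n < N) G n * e + (\sum_(n < N) thetac n *: (sE b ^+ n * T * (e *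
  f ^+ n - f ^+ n * e))
   + \sum_(n < N) thetac n *: (sE b ^+ n.+1 * T * k * f ^+ n))).
  rewrite -!big_split /=; apply: eq_bigr => n _.
  rewrite /G /dE -scalerAl -!scalerDr; congr (_ *: _).
  rewrite mulrDr mulrDl -/e -/k mulrBr !mulrA addrA addrC [_ + (_ - _)]addrC subrK addrC.
  by rewrite -exprSr.
rewrite key -big_split /= addrC; congr (_ + _).
  apply: eq_bigr => n _; rewrite -scalerDr -scalerAr -scalerAl; congr (_ *: _).
  by rewrite mulrBr !mulrA subrK -exprS.
Qed.

Lemma theta_dF b c T :
  theta b c (dF b c T) = sF b * theta b c T + sK b * theta b c T * (sF c)^T.
Proof.
have qc n := @qcomm _ (sF b) (sE b) (sK b) (sKV b) n.
have r1 : sF b * sE b - sE b * sF b = dl^-1 *: (sKV b - sK b).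
  by rewrite -opprB comm_EF -scalerN opprB.
have {r1} qc n := qc n r1 (sKE b) (sKVE b).
set f := (sF c)^T; set k := sK b; set ki := sKV b.
pose G n : mat := thetac n *: (sE b ^+ n * T * f ^+ n).
have key : \sum_(n < N) thetac n *: ((sF b * sE b ^+ n - sE b ^+ n * sF b) * T * f ^+ n) =
    \sum_(n < N) thetac n *: ((sE b ^+ n * ki - k * sE b ^+ n) * T * f ^+ n.+1).
  rewrite big_ord_recl /= !expr0 !mul1r !mulr1 subrr !mul0r scaler0 add0r.
  rewrite [RHS]big_ord_recr /= -[f ^+ N]trmxX sFX_eq0 trmx0 mulr0 scaler0 addr0.
  apply: eq_bigr => n _; rewrite /bump add1n qc -!scalerAl scalerA.
  by rewrite thetacS.
rewrite /theta !mulr_sumr !mulr_suml.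
apply/eqP; rewrite -subr_eq0; apply/eqP.
transitivity (\sum_(n < N) thetac n *: ((sE b ^+ n * ki - k * sE b ^+ n) * T * f ^+ n.+1) -
   \sum_(n < N) thetac n *: ((sF b * sE b ^+ n - sE b ^+ n * sF b) * T * f ^+ n)); last first.
  by rewrite key subrr.
rewrite -big_split /= -!sumrB; apply: eq_bigr => n _.
rewrite -!scalerAr -!scalerAl -!scalerBr -scalerDr -scalerBr; congr (_ *: _).
rewrite /dF mulrDr mulrDl !mulrBl exprS !mulrA.
have cm X : X * f ^+ n * f = X * f * f ^+ n by rewrite -!mulrA -exprSr exprS.
rewrite cm opprB opprD [X in _ + X = _]addrC addrACA; congr (_ + _).
Qed.

Lemma dE_tr b c X : dE c b X^T = (sE b * X + sK b * (X * (sE c)^T))^T.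
Proof. by rewrite linearD /= !trM trmxK sK_tr. Qed.

Lemma dF_tr b c X : dF c b X^T = (sF b * X * sKV c + X * (sF c)^T)^T.
Proof. by rewrite linearD /= !trM trmxK sKV_tr mulrA. Qed.

Lemma Dm_add s b c A B : Dm s b c (A + B) = Dm s b c A + Dm s b c B.
Proof. by apply/matrixP => x y; rewrite !mxE mulrDr. Qed.

(** The factor q^(H (x) H / 4) turns E (x) K^-1 into E (x) 1 and 1 (x) E into K (x) E; after the
    flip their sum is Delta E. *)
Lemma sig_dE b c T : sig b c (dE b c T) = dE c b (sig b c T).
Proof.
rewrite /sig theta_dE dE_tr; move: (theta b c T) => X; congr (_^T); rewrite Dm_add; congr (_ + _).
  apply/matrixP => x y; rewrite mxE diag_mulr -!mulmxE !mxE mulr_suml mulr_sumr.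
  apply: eq_bigr => k _; rewrite mxE !mul1r.
  have h := sE_wt b x k (fun h => a ^ (h * wtH c y)).
  transitivity (a ^ (wtH b x * wtH c y) * sE b x k * X k y * a ^ (- (2 * wtH c y))).
    by move: (a ^ _) (a ^ _) => *; ring.
  rewrite h mulrDl pwD -pwV; have := pw_neq0 (2 * wtH c y).
  by move: (a ^ _) (a ^ _) => *; field.
apply/matrixP => x y; rewrite mxE diag_mull -!mulmxE !mxE !mulr_sumr.
apply: eq_bigr => k _; rewrite !mxE !mul1r.
have h := sE_wt c y k (fun h => a ^ (wtH b x * h)).
transitivity (a ^ (wtH b x * wtH c y) * sE c y k * X x k).
  by move: (a ^ _) => *; ring.
rewrite h mulrDr pwD (mulrC _ 2).
by move: (a ^ _) (a ^ _) => *; ring.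
Qed.

Lemma sig_dF b c T : sig b c (dF b c T) = dF c b (sig b c T).
Proof.
rewrite /sig theta_dF dF_tr; move: (theta b c T) => X; congr (_^T); rewrite Dm_add; congr (_ + _).
  apply/matrixP => x y; rewrite mxE diag_mulr -!mulmxE !mxE mulr_suml mulr_sumr.
  apply: eq_bigr => k _; rewrite mxE !mul1r.
  have h := sF_wt b x k (fun h => a ^ (h * wtH c y)).
  transitivity (a ^ (wtH b x * wtH c y) * sF b x k * X k y).
    by move: (a ^ _) => *; ring.
  rewrite h mulrBl pwD.
  by move: (a ^ _) (a ^ _) => *; ring.
apply/matrixP => x y; rewrite mxE -mulrA diag_mull -!mulmxE !mxE !mulr_sumr.
apply: eq_bigr => k _; rewrite !mxE !mul1r.
have h := sF_wt c y k (fun h => a ^ (wtH b x * h)).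
transitivity (a ^ (wtH b x * wtH c y) * sF c y k * X x k * a ^ (2 * wtH b x)).
  by move: (a ^ _) (a ^ _) => *; ring.
rewrite h mulrBr pwD -pwV (mulrC _ 2); have := pw_neq0 (2 * wtH b x).
by move: (a ^ _) (a ^ _) => *; field.
Qed.

Lemma theta_dK b c T : theta b c (dK b c T) = dK b c (theta b c T).
Proof.
rewrite /theta /dK mulr_sumr mulr_suml; apply: eq_bigr => n _.
rewrite -scalerAr -scalerAl; congr (_ *: _).
have q0 : q != 0 by rewrite q_def expf_neq0.
have h1 : sE b ^+ n * sK b = q ^- n *: (sK b * sE b ^+ n).
  elim: (nat_of_ord n) => [|m IH]; first by rewrite !expr0 mulr1 mul1r invr1 scale1r.
  rewrite exprSr -mulrA; have -> : sE b * sK b = q^-1 *: (sK b * sE b).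
    by rewrite sKE scalerA mulVf // scale1r.
  by rewrite -scalerAr [sE b ^+ m * (_ * _)]mulrA IH -scalerAl scalerA -mulrA (exprS q) invfM.
have h2 : sK c * (sF c)^T ^+ n = q ^+ n *: ((sF c)^T ^+ n * sK c).
  have r2 : sK c * (sF c)^T = q *: ((sF c)^T * sK c).
    by rewrite -{1}sK_tr -trM sKF linearZ /= trM sK_tr.
  elim: (nat_of_ord n) => [|m IH]; first by rewrite !expr0 mulr1 mul1r scale1r.
  by rewrite exprSr mulrA IH -scalerAl -[_ * sK c * _]mulrA r2 -scalerAr scalerA !mulrA (exprSr q).
rewrite !mulrA h1 -!mulrA h2 -!scalerAl -!scalerAr scalerA mulVf ?scale1r ?mulrA //.
by rewrite expf_neq0.
Qed.

Lemma sig_dK b c T : sig b c (dK b c T) = dK c b (sig b c T).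
Proof.
rewrite /sig theta_dK; move: (theta b c T) => X; apply/matrixP => x y.
rewrite mxE mxE /dK !(diag_mulr, diag_mull) !mxE.
by move: (a ^ _) (a ^ _) (a ^ _) => *; ring.
Qed.

(** * The two braidings are inverse to each other *)

(** A Cauchy product of series in E (x) F, whose terms of degree at least N vanish. The coefficients
    are arbitrary so that the lemma covers both orders of [theta] and [thetaV]. *)
Lemma theta_mul (u w : nat -> F) b c T : (forall s, (0 < s)%N -> \sum_(i < s.+1) u i *
  w (s - i)%N = 0) ->
  u 0%N * w 0%N = 1 ->
  \sum_(n < N) u n *: (sE b ^+ n * (\sum_(m < N) w m *: (sE b ^+ m * T * (sF c)^T ^+ m)) *
    (sF c)^T ^+ n) = T.
Proof.
move=> uw uw0.
pose G s : mat := sE b ^+ s * T * (sF c)^T ^+ s.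
have G0 s : (N <= s)%N -> G s = 0.
  by move=> Ns; rewrite /G -(subnKC Ns) exprD sEX_eq0 !mul0r.
transitivity (\sum_(n < N) \sum_(m < N) (u n * w m) *: G (n + m)%N).
  apply: eq_bigr => n _; rewrite mulr_sumr mulr_suml scaler_sumr; apply: eq_bigr => m _.
  rewrite -scalerAr -scalerAl scalerA; congr (_ *: _).
  by rewrite /G !mulrA -exprD -[_ * _ * _ ^+ n]mulrA -exprD (addnC m).
transitivity (\sum_(n < N) \sum_(s < N) (if (n <= s)%N then (u n * w (s - n)%N) *: G s else 0)).
  apply: eq_bigr => n _.
  rewrite -(big_mkord xpredT (fun m => (u n * w m) *: G (n + m)%N)).
  rewrite -(big_mkord xpredT (fun s => if (n <= s)%N then (u n * w (s - n)%N) *: G s else 0)).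
  have nN : (n <= N)%N by rewrite ltnW.
  rewrite [RHS](big_cat_nat (n := n)) //= [X in _ = X + _]big1_seq ?add0r; last first.
    by move=> s /andP[_]; rewrite mem_index_iota => /andP[_ sn]; rewrite leqNgt sn.
  rewrite -[RHS]/(\sum_(0 + n <= i < N) (if (n <= i)%N then (u n *
    w (i - n)%N) *: G i else 0)) big_addn.
  rewrite (big_cat_nat (n := N - n)) ?leq_subr //= [X in _ + X]big1_seq ?addr0; last first.
    by move=> m /andP[_]; rewrite mem_index_iota => /andP[h _]; rewrite G0 ?scaler0 // -leq_subLR.
  by apply: eq_bigr => m _; rewrite leq_addl addnK addnC.
rewrite exchange_big /= big_ord_recl [X in _ + X]big1 ?addr0 => [|s _].
  rewrite big_ord_recl /= big1 ?addr0 => [|n _]; last by [].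
  by rewrite uw0 scale1r /G !expr0 mulr1 mul1r.
transitivity ((\sum_(i < s.+2) u i * w (s.+1 - i)%N) *: G s.+1); last by rewrite uw // scale0r.
rewrite scaler_suml -(big_mkord xpredT (fun n => if (n <= s.+1)%N then (u n *
  w (s.+1 - n)%N) *: G s.+1 else 0)).
rewrite -(big_mkord xpredT (fun i => (u i * w (s.+1 - i)%N) *: G s.+1)).
have sN : (s.+2 <= N)%N by rewrite ltnS.
rewrite (big_cat_nat (n := s.+2)) //= [X in _ + X]big1_seq ?addr0; last first.
  by move=> m /andP[_]; rewrite mem_index_iota => /andP[h _]; rewrite leqNgt h.
by apply: eq_big_nat => i /andP[_ h]; rewrite -ltnS h.
Qed.

Lemma DmK b c T : Dm (-1) b c (Dm 1 b c T) = T.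
Proof. by apply/matrixP => x y; rewrite !mxE mulrA -pwD mulN1r mul1r addNr expr0z mul1r. Qed.

Lemma DmVK b c T : Dm 1 b c (Dm (-1) b c T) = T.
Proof. by apply/matrixP => x y; rewrite !mxE mulrA -pwD mulN1r mul1r addrN expr0z mul1r. Qed.

Lemma thetac00 : thetac 0 * thetaVc 0 = 1 /\ thetaVc 0 * thetac 0 = 1.
Proof.
have f0 : qfact a 0 = 1 by rewrite /qfact big_geq.
by rewrite /thetac /thetaVc f0 !mul0n !expr0 !invr1 !mulr1.
Qed.

Lemma sigK b c : cancel (sig b c) (sigV c b).
Proof.
move=> T; rewrite /sigV /sig trmxK DmK; apply: theta_mul; last by case: thetac00.
move=> s s0; apply: etrans (thetac_inv s0).
rewrite (reindex_inj rev_ord_inj) /=; apply: eq_bigr => i _.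
have hi : (i <= s)%N by rewrite -ltnS.
by rewrite subSS (subKn hi) mulrC.
Qed.

Lemma sigVK b c : cancel (sigV b c) (sig c b).
Proof.
move=> T; rewrite /sigV /sig -[RHS]trmxK; congr (_^T).
rewrite -[RHS](DmVK c b); congr (Dm _ _ _ _); apply: theta_mul; last by case: thetac00.
by move=> s s0; apply: (thetac_inv s0).
Qed.

(** * Sums of products of q-binomials, and products of matrix coefficients *)

Lemma qm1_neq0 n : (1 - q) ^+ n != 0.
Proof. by rewrite expf_neq0 // -(expr1 q) (qX_neq1). Qed.

(** Trinomial revision pulls [gbin l k] out of the sum. Products of triangular arrays of q-binomials
    are reduced to single q-series in this way. *)
Lemma sum_triangle (l k m : nat) (G : nat -> F) : (l < m)%N ->
  \sum_(n < m) gbin l n * gbin n k * G n =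
  gbin l k * \sum_(i < (l - k).+1) gbin (l - k) i * G (k + i)%N.
Proof.
move=> lm; case: (leqP k l) => kl; last first.
  rewrite (gbin_small kl) mul0r; apply: big1 => n _.
  case: (ltnP n k) => nk; first by rewrite (gbin_small nk) mulr0 mul0r.
  by rewrite (gbin_small (leq_trans kl nk)) !mul0r.
rewrite -(big_mkord xpredT (fun n => gbin l n * gbin n k * G n)).
have km : (k <= m)%N by lia.
have kl1 : (k <= l.+1)%N by lia.
rewrite (big_cat_nat (n := k)) //= [X in X + _]big1_seq ?add0r; last first.
  by move=> n /andP[_]; rewrite mem_index_iota => /andP[_ nk]; rewrite (gbin_small nk) mulr0 mul0r.
rewrite (big_cat_nat (n := l.+1)) //= [X in _ + X]big1_seq ?addr0; last first.
  by move=> n /andP[_]; rewrite mem_index_iota => /andP[ln _]; rewrite (gbin_small ln) !mul0r.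
rewrite -[LHS]/(\sum_(0 + k <= n < l.+1) gbin l n * gbin n k * G n) big_addn subSn //.
rewrite big_mkord mulr_sumr; apply: eq_bigr => i _.
have hi : (i <= l - k)%N by rewrite -ltnS.
rewrite gbinM; last by lia.
by rewrite addnK addnC mulrA.
Qed.

Lemma qpoch_negE (m d : nat) : (d <= m)%N ->
  qpoch q (a ^ (- (4 * m%:Z))) d =
  (-1) ^+ d * a ^ (2 * d%:Z * (d%:Z - 1) - 4 * m%:Z * d%:Z) * pq m / pq (m - d).
Proof.
elim: d => [|d IH] dm.
  by rewrite qpoch0 subn0 expr0 !mulr0 mul0r subr0 expr0z !mul1r divff ?pq_neq0.
rewrite qpochS (IH (ltnW dm)).
have -> : (m - d = (m - d.+1).+1)%N by lia.
rewrite pqS !qE exprS.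
have -> : a ^ (2 * d.+1%:Z * (d.+1%:Z - 1) - 4 * m%:Z * d.+1%:Z) =
  a ^ (2 * d%:Z * (d%:Z - 1) - 4 * m%:Z * d%:Z) * (a ^ (- (4 * m%:Z)) * a ^ (4 * d%:Z)).
  by rewrite -!pwD; congr (_ ^ _); ring.
have -> : a ^ (4 * (m - d.+1).+1%:Z) = (a ^ (- (4 * m%:Z)) * a ^ (4 * d%:Z))^-1.
  by rewrite -pwD pwV; congr (_ ^ _); lia.
have : 1 - (a ^ (- (4 * m%:Z)) * a ^ (4 * d%:Z))^-1 != 0.
  rewrite -pwD pwV [X in a ^ X](_ : _ = 4 * (m - d)%N%:Z); last by lia.
  by rewrite -qE (qX_neq1) // subn_gt0.
have := pq_neq0 (m - d.+1); have := pw_neq0 (- (4 * m%:Z) + 4 * d%:Z); rewrite pwD.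
move: (a ^ _) ((a ^ _) * _) (pq _) (pq _) ((-1) ^+ d) => x y z w e y0 w0 h.
have y1 : y - 1 != 0 by apply: contraNneq h => /eqP; rewrite subr_eq0 => /eqP ->;
  rewrite invr1 subrr.
by field; rewrite y0 w0 y1.
Qed.

Lemma prod_cEf c s : (c + s <= M)%N ->
  \prod_(0 <= t < s) cEf (c + t) =
  (-1) ^+ s * a ^ (s%:Z * (- (4 * M%:Z) + 6 * c%:Z + 6) + 3 * s%:Z * (s%:Z - 1)) *
  (pq (M - c) / pq (M - c - s)) / (1 - q) ^+ s.
Proof.
elim: s => [|s IH] h.
  by rewrite big_nil subn0 divff ?pq_neq0 // !expr0 !(mul0r, mulr0, add0r, addr0) expr0z invr1
    !mulr1.
rewrite big_nat_recr //= IH; last by lia.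
rewrite /cEf qintE.
have -> : (M - c - s = (M - c - s.+1).+1)%N by lia.
have -> : (M - (c + s) = (M - c - s.+1).+1)%N by lia.
have -> : a ^ (s.+1%:Z * (- (4 * M%:Z) + 6 * c%:Z + 6) + 3 * s.+1%:Z * (s.+1%:Z - 1)) =
  a ^ (s%:Z * (- (4 * M%:Z) + 6 * c%:Z + 6) + 3 * s%:Z * (s%:Z - 1)) *
  (a ^ (- (2 * ((M - c - s.+1).+1%:Z - 1))) * a ^ (- (2 * (M%:Z - (2 * (c + s).+1)%N%:Z)))).
  rewrite -!pwD; congr (_ ^ _).
  have -> : (M - c - s.+1)%N.+1%:Z = M%:Z - c%:Z - s%:Z by lia.
  rewrite PoszM -[(c + s).+1]addn1 !PoszD -[s.+1]addn1 PoszD; ring.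
rewrite pqS (exprS (-1)) (exprS (1 - q)).
have := pq_neq0 (M - c - s.+1); have := qX_neq1 (ltn0Sn (M - c - s.+1)).
have := qm1_neq0 s; have := qm1_neq0 1; rewrite expr1.
move: (a ^ _) (a ^ _) (a ^ _) (pq _) (pq _) ((-1) ^+ s) (q ^+ _) ((1 - q) ^+ s).
by move=> x y z w v e Q P h1 h2 h3 h4; field; rewrite ?h1 ?h2 ?h3 ?h4.
Qed.

Lemma prod_cFf b n : (n <= b)%N ->
  \prod_(0 <= t < n) cFf (b - t) =
  (-1) ^+ n * a ^ (n%:Z * (2 * M%:Z - 6 * b%:Z + 2) + 3 * n%:Z * (n%:Z - 1)) *
  (pq b / pq (b - n)) / (1 - q) ^+ n.
Proof.
elim: n => [|s IH] h.
  by rewrite big_nil subn0 divff ?pq_neq0 // !expr0 !(mul0r, mulr0, add0r, addr0) expr0z invr1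
    !mulr1.
rewrite big_nat_recr //= IH; last by lia.
rewrite /cFf qintE.
have -> : (b - s = (b - s.+1).+1)%N by lia.
have -> : a ^ (s.+1%:Z * (2 * M%:Z - 6 * b%:Z + 2) + 3 * s.+1%:Z * (s.+1%:Z - 1)) =
  a ^ (s%:Z * (2 * M%:Z - 6 * b%:Z + 2) + 3 * s%:Z * (s%:Z - 1)) *
  (a ^ (2 * (M%:Z - (2 * (b - s.+1).+1)%N%:Z)) * a ^ (- (2 * ((b - s.+1).+1%:Z - 1)))).
  rewrite -!pwD; congr (_ ^ _); rewrite PoszM.
  have -> : (b - s.+1).+1%:Z = b%:Z - s%:Z by lia.
  by rewrite -[s.+1]addn1 PoszD; ring.
rewrite pqS (exprS (-1)) (exprS (1 - q)).
have := pq_neq0 (b - s.+1); have := qX_neq1 (ltn0Sn (b - s.+1)).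
have := qm1_neq0 s; have := qm1_neq0 1; rewrite expr1.
move: (a ^ _) (a ^ _) (a ^ _) (pq _) (pq _) ((-1) ^+ s) (q ^+ _) ((1 - q) ^+ s).
by move=> x y z w v e Q P h1 h2 h3 h4; field; rewrite ?h1 ?h2 ?h3 ?h4.
Qed.

(** * Twisting parallel strands *)

(* The tensor e^i (x) e^j, which is 0 if i or j exceeds M. *)
Definition bs (i j : nat) : mat := \matrix_(x, y) ((x == i :> nat) && (y == j :> nat))%:R.

Lemma ent_bs i j x y : (x <= M)%N -> (y <= M)%N -> ent (bs i j) x y = ((x == i) && (y == j))%:R.
Proof. by move=> xM yM; rewrite /ent !ltnS xM yM /= mxE !inordK. Qed.

Lemma bs_tr i j : (bs i j)^T = bs j i.
Proof. by apply/matrixP => x y; rewrite !mxE andbC. Qed.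

Lemma bs_out i j : (M < i)%N || (M < j)%N -> bs i j = 0.
Proof.
move=> h; apply/matrixP => x y; rewrite !mxE (_ : _ && _ = false) //.
apply/negP => /andP[/eqP ei /eqP ej]; have := ltn_ord x; have := ltn_ord y; lia.
Qed.

Lemma sE_bs i j : sE false * bs i j = cEf i *: bs i.+1 j.
Proof.
apply: entP => x y xM yM; rewrite entZ ent_bs //.
case: x xM => [|x] xM; first by rewrite ent_sEf0 mulr0.
rewrite ent_sEf xM ent_bs ?(ltnW xM) // eqSS.
by case: eqP => [->|_]; rewrite ?mulr0.
Qed.

Lemma bs_sE i j : bs i j * (sE false)^T = cEf j *: bs i j.+1.
Proof. by rewrite -bs_tr -trM sE_bs linearZ /= bs_tr. Qed.

Lemma sF_bs i j : (i <= M)%N -> sF false * bs i j = cFf i *: bs i.-1 j.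
Proof.
move=> iM; apply: entP => x y xM yM; rewrite entZ ent_bs // ent_sFf.
case: i iM => [|i] iM.
  have -> : cFf 0 = 0 by rewrite /cFf qint0 mulr0 oppr0.
  rewrite mul0r.
  case: (ltnP x M) => xM'; last by rewrite ent_out ?mulr0 // ltnS xM'.
  by rewrite ent_bs // mulr0.
case: (ltnP x M) => xM'; last first.
  rewrite ent_out ?ltnS ?xM' // mulr0; case: eqP => // e; last by rewrite mulr0.
  by have := leq_trans iM xM'; rewrite e /= ltnn.
rewrite ent_bs // eqSS /=.
by case: eqP => [->|_]; rewrite ?mulr0.
Qed.

Lemma bs_sF i j : (j <= M)%N -> bs i j * (sF false)^T = cFf j *: bs i j.-1.
Proof. by move=> jM; rewrite -bs_tr -trM sF_bs // linearZ /= bs_tr. Qed.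

Lemma bs_sK i j : bs i j * sK false = a ^ (2 * (2 * j%:Z - M%:Z)) *: bs i j.
Proof.
apply/matrixP => x y; rewrite diag_mulr !mxE.
case: andP => [[_ /eqP e]|_]; last by rewrite mulr0 mul0r.
by rewrite mulr1 mul1r /wtH /= weightE e; congr (_ ^ _); lia.
Qed.

Lemma sEX_bs n i j : sE false ^+ n * bs i j = (\prod_(0 <= t < n) cEf (i + t)) *: bs (i + n) j.
Proof.
elim: n => [|n IH]; first by rewrite expr0 big_nil mul1r scale1r addn0.
by rewrite exprS -mulrA IH -scalerAr sE_bs scalerA big_nat_recr //= addnS.
Qed.

Lemma bs_sFX n i j : (j <= M)%N ->
  bs i j * (sF false)^T ^+ n = (\prod_(0 <= t < n) cFf (j - t)) *: bs i (j - n).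
Proof.
move=> jM; elim: n => [|n IH]; first by rewrite expr0 big_nil mulr1 scale1r subn0.
rewrite exprSr mulrA IH -scalerAl bs_sF ?scalerA ?big_nat_recr //= ?subnS //.
by rewrite (leq_trans (leq_subr _ _)).
Qed.

Fact dE_linear b c : linear (dE b c).
Proof.
by move=> k A B; rewrite /dE !mulrDr !mulrDl -!scalerAr -!scalerAl scalerDr addrACA.
Qed.

Lemma iter_linear (f : mat -> mat) n : linear f -> linear (iter n f).
Proof.
move=> fl; elim: n => [//|n IH] k A B; rewrite !iterS.
by have -> := IH k A B; exact: fl.
Qed.

Lemma linear_comb (f : mat -> mat) (I : Type) (r : seq I) (P : pred I) (c : I -> F) (T : I -> mat) :
  linear f -> f (\sum_(i <- r | P i) c i *: T i) = \sum_(i <- r | P i) c i *: f (T i).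
Proof.
move=> fl; have f0 : f 0 = 0.
  have := fl 1 0 0; rewrite !scale1r addr0 => h.
  by apply: (@addrI _ (f 0)); rewrite addr0 -h.
have fD A B : f (A + B) = f A + f B by have := fl 1 A B; rewrite !scale1r.
have fZ k A : f (k *: A) = k *: f A by have := fl k A 0; rewrite f0 !addr0.
by rewrite (big_morph f fD f0); apply: eq_bigr => i _; rewrite fZ.
Qed.

Lemma dE_bs i j : dE false false (bs i j) =
  cEf j *: bs i j.+1 + (cEf i * a ^ (2 * (2 * j%:Z - M%:Z))) *: bs i.+1 j.
Proof. by rewrite /dE bs_sE -mulrA bs_sK -scalerAr sE_bs scalerA mulrC. Qed.

(** The weight of the terms of (Delta E)^j (e^0 (x) e^c) in which E acts i times on the first
    factor; the power of [a] is K^i acting on e^c. *)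
Definition dEcoef (c j i : nat) : F :=
  (\prod_(0 <= t < i) cEf t) * a ^ (2 * (2 * c%:Z - M%:Z) * i%:Z) *
    \prod_(0 <= t < j - i) cEf (c + t).

(** The summands 1 (x) E and E (x) K of Delta E q-commute, so the powers of their sum expand with
    q-binomials. *)
Lemma iter_dE_bs c j : iter j (dE false false) (bs 0 c) =
  \sum_(i < j.+1) (gbin j i * dEcoef c j i) *: bs i (c + (j - i)).
Proof.
elim: j => [|j IH].
  rewrite /= big_ord1 gbin0 /dEcoef !big_nil mulr0 expr0z !mulr1 scale1r.
  by rewrite subnn addn0.
rewrite iterS IH linear_comb; last exact: dE_linear.
pose G i : mat := dEcoef c j.+1 i *: bs i (c + (j.+1 - i)).
transitivity (\sum_(i < j.+1) gbin j i *: (G i + q ^+ (j - i) *: G i.+1)).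
  apply: eq_bigr => i _; have ij : (i <= j)%N by rewrite -ltnS.
  rewrite dE_bs -scalerA; congr (_ *: _).
  rewrite scalerDr /G !scalerA subSS subSn // addnS; congr (_ *: _ + _ *: _).
    by rewrite /dEcoef subSn // big_nat_recr //= mulrA.
  rewrite /dEcoef subSS big_nat_recr //= qE.
  have -> : a ^ (2 * (2 * c%:Z - M%:Z) * i.+1%:Z) = a ^ (2 * (2 * c%:Z - M%:Z) * i%:Z)
    * a ^ (2 * (2 * c%:Z - M%:Z)) by rewrite -pwD; congr (_ ^ _); rewrite -[i.+1]addn1 PoszD; ring.
  have -> : a ^ (2 * (2 * (c + (j - i))%N%:Z - M%:Z)) =
    a ^ (2 * (2 * c%:Z - M%:Z)) * a ^ (4 * (j - i)%N%:Z).
    by rewrite -pwD; congr (_ ^ _); rewrite PoszD; ring.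
  by move: (a ^ _) (a ^ _) (a ^ _) (\prod_(_ <= _ < _) _) (\prod_(_ <= _ < _) _) => *; ring.
apply: entP => x y xM yM; rewrite !ent_sum.
have := sum_gbinSr j (fun i => ent (G i) x y).
have -> : \sum_(i < j.+2) gbin j.+1 i * ent (G i) x y =
  \sum_(i < j.+2) ent ((gbin j.+1 i * dEcoef c j.+1 i) *: bs i (c + (j.+1 - i))) x y.
  by apply: eq_bigr => i _; rewrite /G -entZ scalerA.
by move=> ->; apply: eq_bigr => i _; rewrite entZ entD entZ.
Qed.

Definition gradedV (b n : nat) : F :=
  thetaVc n * (\prod_(0 <= t < n) cEf t) * (\prod_(0 <= t < n) cFf (b - t)).

Lemma prod_cFf0 b n : (b < n)%N -> \prod_(0 <= t < n) cFf (b - t) = 0.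
Proof.
move=> bn; rewrite (big_cat_nat (n := b.+1)) //= big_nat_recr //= subnn.
by rewrite [cFf 0]/cFf qint0 mulr0 oppr0 mulr0 mul0r.
Qed.

Lemma sigV_bs i j : (i <= M)%N -> (j <= M)%N -> sigV false false (bs i j) =
  a ^ (- ((M%:Z - 2 * i%:Z) * (M%:Z - 2 * j%:Z))) *:
  \sum_(n < N) (thetaVc n * (\prod_(0 <= t < n) cEf (j + t)) * (\prod_(0 <= t < n) cFf (i - t)))
     *: bs (j + n) (i - n).
Proof.
move=> iM jM; rewrite /sigV.
have -> : Dm (-1) false false (bs i j)^T =
    a ^ (- ((M%:Z - 2 * i%:Z) * (M%:Z - 2 * j%:Z))) *: bs j i.
  rewrite bs_tr; apply/matrixP => x y; rewrite !mxE.
  case: andP => [[/eqP xj /eqP yi]|_]; last by rewrite !mulr0.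
  by rewrite !mulr1 mulN1r /wtH /= !weightE xj yi mulrNN mulrC; congr (_ ^ (- (_ * _))); lia.
rewrite /thetaV scaler_sumr; apply: eq_bigr => n _.
rewrite -scalerAr -scalerAl sEX_bs -scalerAl bs_sFX // !scalerA; congr (_ *: _).
by move: (a ^ _) (\prod_(_ <= _ < _) _) (\prod_(_ <= _ < _) _) => *; ring.
Qed.

Lemma sigV_bs0 b : (b <= M)%N -> sigV false false (bs 0 b) =
  a ^ (- (M%:Z * (M%:Z - 2 * b%:Z))) *: bs b 0.
Proof.
move=> bM; rewrite sigV_bs // mulr0 subr0; congr (_ *: _).
rewrite big_ord_recl /= [X in _ + X]big1 => [|n _].
  rewrite !big_nil addr0 addn0 !mulr1 /thetaVc.
  by rewrite mul0n !expr0 invr1 !mulr1 /qfact big_geq // invr1 !mulr1 scale1r.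
by rewrite prod_cFf0 // mulr0 scale0r.
Qed.

Lemma sigV_bsb b : (b <= M)%N -> sigV false false (bs b 0) =
  a ^ (- (M%:Z * (M%:Z - 2 * b%:Z))) *: \sum_(n < b.+1) gradedV b n *: bs n (b - n).
Proof.
move=> bM; rewrite sigV_bs // mulr0 subr0 [X in a ^ (- X)]mulrC; congr (_ *: _).
rewrite -(big_mkord xpredT (fun n => (thetaVc n * (\prod_(0 <= t < n) cEf (0 + t)) *
  (\prod_(0 <= t < n) cFf (b - t))) *: bs (0 + n) (b - n))).
rewrite -(big_mkord xpredT (fun n => gradedV b n *: bs n (b - n))).
rewrite (big_cat_nat (n := b.+1)) //= [X in _ + X]big1_seq ?addr0 //.
by move=> n /andP[_]; rewrite mem_index_iota => /andP[bn _]; rewrite prod_cFf0 // mulr0 scale0r.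
Qed.

(** Times [gbin b j], this is the coefficient of E^j (e^0 (x) e^(b-j)) in the left-handed full twist
    of e^0 (x) e^b. *)
Definition sigV2_coef (b j : nat) : F := (-1) ^+ j * (1 - q) ^+ j *
  a ^ (3 * j%:Z * j%:Z - 7 * j%:Z - 2 * b%:Z * j%:Z + 2 * M%:Z * (M%:Z + 2)
       - 4 * (M%:Z - b%:Z) * (M%:Z - b%:Z + 1)).

Lemma dl_exp i : dl ^+ i = (-1) ^+ i * a ^ (- (2 * i%:Z)) * (1 - q) ^+ i.
Proof.
have -> : dl = (-1) * a ^ (- 2%:Z) * (1 - q).
  by rewrite -pwV -exprnP q_def; field.
by rewrite !exprMn pwX mulNr.
Qed.

(** Both sides are the coefficient of e^i (x) e^(b-i) in the full twist. After [sum_triangle] the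
    left one is [gauss_expansion] at x = q^(M-b+i+1). *)
Lemma sum_sigV2_coef b i : (i <= b <= M)%N ->
  \sum_(j < b.+1) gbin b j * gbin j i * (sigV2_coef b j * dEcoef (b - j) j i) =
  a ^ (- (2 * M%:Z * (M%:Z - 2 * b%:Z))) * gradedV b i.
Proof.
move=> /andP[ib bM]; rewrite (@sum_triangle b i b.+1 (fun j =>
  sigV2_coef b j * dEcoef (b - j) j i) (ltnSn b)).
have [B hB] : exists B, b = (i + B)%N by exists (b - i)%N; lia.
have [n hn] : exists n, M = (n + b)%N by exists (M - b)%N; lia.
have -> : (b - i = B)%N by lia.
pose C := (-1) ^+ i * (1 - q) ^+ i * a ^ (3 * i%:Z * i%:Z - 7 * i%:Z - 2 * b%:Z * i%:Z + 2 *
  M%:Z * (M%:Z + 2)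
       - 4 * (M%:Z - b%:Z) * (M%:Z - b%:Z + 1) + 2 * (2 * B%:Z - M%:Z) * i%:Z
       - 4 * (n%:Z + i%:Z + 1) * B%:Z) * \prod_(0 <= t < i) cEf t.
transitivity (gbin b i * (C * \sum_(s < B.+1) gbin B s * ((q ^+ (n + i).+1) ^+ (B - s) *
  qpoch q (q ^+ (n + i).+1) s))).
  congr (_ * _); rewrite mulr_sumr; apply: eq_bigr => s _.
  have sB : (s <= B)%N by rewrite -ltnS.
  move: {s}(nat_of_ord s) sB => s sB.
  have [r hr] : exists r, B = (s + r)%N by exists (B - s)%N; lia.
  rewrite /sigV2_coef /dEcoef /C addKn (_ : b - (i + s) = r)%N; last by lia.
  rewrite prod_cEf; last by rewrite hn hB; lia.
  have -> : (M - r - s = n + i)%N by lia.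
  have -> : (M - r = n + i + s)%N by lia.
  rewrite pqD (mulrAC (pq (n + i))) divff ?pq_neq0 ?mul1r //.
  have -> : (B - s = r)%N by lia.
  rewrite qE pwX !exprD.
  have := qm1_neq0 s; move: (\prod_(_ <= _ < _) _) (qpoch q _ _) ((1 - q) ^+ i) ((1 - q) ^+ s)
    ((-1) ^+ i) => P Q u w e w0.
  rewrite -(signr_odd _ s).
  set A1 := a ^ _; set A2 := a ^ _; set A3 := a ^ _; set A4 := a ^ _; set A5 := a ^ _.
  have hA : A1 * A2 * A3 = A4 * A5.
    rewrite /A1 /A2 /A3 /A4 /A5 -!pwD; congr (_ ^ _); rewrite hn hB hr; ring.
  transitivity (e * u * P * Q * gbin B s * (A1 * A2 * A3)); last first.
    by rewrite hA; move: (gbin _ _) A4 A5 {hA} => *; ring.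
  by move: (gbin _ _) A1 A2 A3 {hA} => *; case: odd; rewrite ?expr0 ?expr1; field.
rewrite gauss_expansion mulr1 /C /gradedV /thetaVc prod_cFf // qfactE dl_exp gbinE //.
have -> : a ^- (i * i.-1) = a ^ (- (i%:Z * (i%:Z - 1))).
  by rewrite exprnN; congr (_ ^ _); case: (i) => // m; rewrite PoszM; ring.
have -> : (b - i = B)%N by lia.
have := qm1_neq0 i; have := pq_neq0 i; have := pq_neq0 B.
rewrite -(signr_odd _ i) -!pwV.
move: (\prod_(_ <= _ < _) _) (pq _) (pq _) (pq _) ((1 - q) ^+ i) => P Q1 Q2 Q3 u h1 h2 h3.
set A1 := a ^ _; set A2 := a ^ _; set A3 := a ^ _; set A4 := a ^ _.
set A5 := a ^ _.
have -> : A1 = A5 / (A2 * A4).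
  by rewrite /A1 /A2 /A4 /A5 -pwD pwV -pwD; congr (_ ^ _); rewrite hn hB; ring.
have a2 : A2 != 0 by apply: pw_neq0.
have a3 : A3 != 0 by apply: pw_neq0.
have a4 : A4 != 0 by apply: pw_neq0.
move: A2 A3 A4 A5 a2 a3 a4 => {A1} A2 A3 A4 A5 a2 a3 a4.
by case: odd; rewrite ?expr0 ?expr1; field; rewrite ?h1 ?h2 ?h3 ?a2 ?a3 ?a4.
Qed.

Lemma sigV2_bs0 b : (b <= M)%N ->
  sigV false false (sigV false false (bs 0 b)) =
  \sum_(j < b.+1) (gbin b j * sigV2_coef b j) *: iter j (dE false false) (bs 0 (b - j)).
Proof.
move=> bM; rewrite sigV_bs0 //.
have -> : sigV false false (a ^ (- (M%:Z * (M%:Z - 2 * b%:Z))) *: bs b 0) =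
    a ^ (- (M%:Z * (M%:Z - 2 * b%:Z))) *: sigV false false (bs b 0).
  exact: linearZ.
rewrite sigV_bsb // scalerA -pwD scaler_sumr.
under [RHS]eq_bigr => j _ do rewrite iter_dE_bs.
pose G (j i : nat) : mat := (gbin b j * sigV2_coef b j * (gbin j i *
  dEcoef (b - j) j i)) *: bs i (b - i).
transitivity (\sum_(j < b.+1) \sum_(i < b.+1) G j i); last first.
  apply: eq_bigr => j _; have jb : (j <= b)%N by rewrite -ltnS.
  rewrite scaler_sumr -(big_mkord xpredT (fun i => G j i)) (big_cat_nat (n := j.+1)) //=.
  rewrite [X in _ + X]big1_seq ?addr0; last first.
    move=> i /andP[_]; rewrite mem_index_iota => /andP[ji _].
    by rewrite /G (gbin_small ji) mul0r mulr0 scale0r.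
  rewrite big_mkord; apply: eq_bigr => i _; have ij : (i <= j)%N by rewrite -ltnS.
  by rewrite scalerA /G; congr (_ *: bs _ _); lia.
rewrite exchange_big /=; apply: eq_bigr => i _; have ib : (i <= b)%N by rewrite -ltnS.
rewrite /G -scaler_suml scalerA; congr (_ *: _).
transitivity (a ^ (- (2 * M%:Z * (M%:Z - 2 * b%:Z))) * gradedV b i).
  by congr (_ ^ _ * _); ring.
rewrite -sum_sigV2_coef ?ib //; apply: eq_bigr => j _.
by move: (gbin _ _) (gbin _ _) (sigV2_coef _ _) (dEcoef _ _ _) => *; ring.
Qed.

(** All these vectors have total index M, so they lie in the zero weight space of e^0 (x) e^M, to
    which the twists are applied. *)
Definition Evec (n : nat) : mat := iter n (dE false false) (bs 0 (M - n)).
(* The normalization for which a full twist has the matrices twistN and twistP. *)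
Definition Evec_norm (n : nat) : F :=
  a ^ (5 * n%:Z * n%:Z - 5 * n%:Z - 2 * M%:Z * n%:Z) * (1 - q) ^+ n * gbin M n.
Definition Evec' (n : nat) : mat := Evec_norm n *: Evec n.
(* The matrices of a left-handed and a right-handed full twist, up to a power of a. *)
Definition twistN (k l : nat) : F :=
  (-1) ^+ (k + l) * a ^ (- (2 * l%:Z * (l%:Z + 1)) + 2 * k%:Z * (k%:Z + 1) - 4 * k%:Z - 4 *
    k%:Z * l%:Z) * gbin l k.
Definition twistP (k l : nat) : F := a ^ (4 * (l%:Z + k%:Z * k%:Z)) * gbin l k.

Lemma iter_sigV n T : sigV false false (iter n (dE false false) T) =
  iter n (dE false false) (sigV false false T).
Proof.
elim: n => //= n IH; rewrite -IH; apply: (can_inj (sigK false false)).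
by rewrite sig_dE !sigVK.
Qed.

(** The twist commutes with E^k, so [sigV2_bs0] applies with b = M - k; its j-th term becomes
    [Evec (k + j)], whence triangularity. Trinomial revision turns the quotient of the norms into
    [gbin l k]. *)
Lemma sigV2_Evec k : (k <= M)%N ->
  sigV false false (sigV false false (Evec' k)) =
  a ^ (2 * M%:Z * (M%:Z + 2)) *: \sum_(l < N) twistN k l *: Evec' l.
Proof.
move=> kM.
have -> : sigV false false (Evec' k) = Evec_norm k *: sigV false false (Evec k) by exact: linearZ.
have -> : sigV false false (Evec_norm k *: sigV false false (Evec k)) =
  Evec_norm k *: sigV false false (sigV false false (Evec k)).
  exact: linearZ.
rewrite /Evec !iter_sigV sigV2_bs0 ?leq_subr // linear_comb; last exact/iter_linear/dE_linear.
rewrite -(big_mkord xpredT (fun l => twistN k l *: Evec' l)) (big_cat_nat (n := k)) ?leqW //=.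
rewrite [X in _ *: (X + _)]big1_seq ?add0r; last first.
  by move=> l /andP[_]; rewrite mem_index_iota => /andP[_ lk];
    rewrite /twistN (gbin_small lk) mulr0 scale0r.
rewrite -[X in _ = _ *: X]/(\sum_(0 + k <= l < N) twistN k l *: Evec' l) big_addn subSn //
  big_mkord !scaler_sumr.
apply: eq_bigr => j _; have jM : (j <= M - k)%N by rewrite -ltnS.
move: {j}(nat_of_ord j) jM => j jM.
rewrite -iterD /Evec' /Evec addnC (_ : M - k - j = M - (j + k))%N; last by lia.
rewrite !scalerA; congr (_ *: _).
have [r hr] : exists r, M = (j + k + r)%N by exists (M - (j + k))%N; lia.
have gg : gbin M k * gbin (M - k) j = gbin M (j + k) * gbin (j + k) k.
  by rewrite gbinM ?addnK //; lia.
rewrite /Evec_norm /twistN /sigV2_coef -(subzn kM) !exprD.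
transitivity ((gbin M k * gbin (M - k) j) * ((-1) ^+ j * ((1 - q) ^+ j * (1 - q) ^+ k)) *
  a ^ (5 * (j + k)%N%:Z * (j + k)%N%:Z - 5 * (j + k)%N%:Z - 2 * M%:Z * (j + k)%N%:Z
   + 2 * M%:Z * (M%:Z + 2) + (- (2 * (j + k)%N%:Z * ((j + k)%N%:Z + 1)) + 2 * k%:Z * (k%:Z +
     1) - 4 * k%:Z - 4 * k%:Z * (j + k)%N%:Z))).
  set A1 := a ^ _; set A2 := a ^ _; set A3 := a ^ _.
  have <- : A1 * A2 = A3.
    rewrite /A1 /A2 /A3 -pwD; congr (_ ^ _); ring.
  move: (gbin _ _) (gbin _ _) ((-1) ^+ j) ((1 - q) ^+ j) ((1 - q) ^+ k) => *; ring.
rewrite gg 2!pwD -(signr_odd _ k).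
move: (gbin _ _) (gbin _ _) ((-1) ^+ j) ((1 - q) ^+ j) ((1 - q) ^+ k) (a ^ _) (a ^ _) (a ^ _) => *.
by case: odd; rewrite ?expr0 ?expr1; ring.
Qed.

(** For k < l the q-binomial theorem sums the product to a multiple of (q^(-(l-k-1)))_(l-k) = 0. *)
Lemma twist_inv k l : (l <= M)%N -> \sum_(n < N) twistP k n * twistN n l = (k == l)%:R.
Proof.
move=> lM.
transitivity (\sum_(n < N) gbin l n * gbin n k *
   ((-1) ^+ (n + l) * a ^ (4 * (n%:Z + k%:Z * k%:Z) + (- (2 * l%:Z * (l%:Z + 1)) + 2 * n%:Z *
     (n%:Z + 1) - 4 * n%:Z - 4 * n%:Z * l%:Z)))).
  apply: eq_bigr => n _; rewrite /twistP /twistN [in RHS]pwD.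
  by move: (gbin _ _) (gbin _ _) (a ^ _) (a ^ _) (_ ^+ _) => *; ring.
rewrite (@sum_triangle l k N (fun n => (-1) ^+ (n + l) * a ^ (4 * (n%:Z + k%:Z * k%:Z) + (- (2 *
  l%:Z * (l%:Z + 1)) + 2 * n%:Z * (n%:Z + 1) - 4 * n%:Z - 4 * n%:Z * l%:Z)))) ?ltnS //.
case: (ltngtP k l) => kl.
- transitivity (gbin l k * ((-1) ^+ (k + l) * a ^ (4 * (k%:Z + k%:Z * k%:Z) + (- (2 * l%:Z *
  (l%:Z + 1)) + 2 * k%:Z * (k%:Z + 1) - 4 * k%:Z - 4 * k%:Z * l%:Z))
    * \sum_(i < (l - k).+1) gbin (l - k) i * ((-1) ^+ i * a ^ (2 * i%:Z * (i%:Z - 1)) *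
      (a ^ (- (4 * (l - k).-1%:Z))) ^+ i))).
    congr (_ * _); rewrite mulr_sumr; apply: eq_bigr => i _.
    rewrite pwX !exprD.
    set A1 := a ^ _; set A2 := a ^ _; set A3 := a ^ _; set A4 := a ^ _.
    have -> : A1 = A2 * A3 * A4.
      rewrite /A1 /A2 /A3 /A4 -!pwD; congr (_ ^ _).
      have -> : (l - k).-1%:Z = l%:Z - k%:Z - 1 by lia.
      ring.
    move: (gbin _ _) A2 A3 A4 (_ ^+ k) (_ ^+ l) (_ ^+ i) => *; ring.
  rewrite qbinomial_theorem qpoch_pw_eq0 ?mulr0 //; lia.
- by rewrite (gbin_small kl) mul0r.
rewrite kl subnn big_ord1 !gbinn !mul1r addn0 addnn -signr_odd odd_double expr0 mul1r.
by rewrite -(expr0z a); congr (_ ^ _); ring.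
Qed.

(** No second q-series is needed: the right-handed twist is applied to [sigV2_Evec], and the
    resulting triangular system is solved by [twist_inv]. *)
Lemma sig2_Evec k : (k <= M)%N ->
  sig false false (sig false false (Evec' k)) =
  a ^ (- (2 * M%:Z * (M%:Z + 2))) *: \sum_(l < N) twistP k l *: Evec' l.
Proof.
move=> kM; pose f T := sig false false (sig false false T).
have fl : linear f.
  by move=> c A B; rewrite /f; have -> := @sig_linear false false c A B; apply: sig_linear.
have fK n : (n <= M)%N -> Evec' n = a ^ (2 * M%:Z * (M%:Z +
  2)) *: \sum_(l < N) twistN n l *: f (Evec' l).
  move=> nM; have -> : Evec' n = f (sigV false false (sigV false false (Evec' n))) by rewrite /f
    !sigVK.
  rewrite sigV2_Evec // -[X in f X]addr0 fl -(linear_comb _ _ _ _ fl) -[RHS]addr0; congr (_ + _).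
  by have := fl (-1) 0 0; rewrite scaler0 addr0 scaleN1r addNr.
have -> : \sum_(n < N) twistP k n *: Evec' n = a ^ (2 * M%:Z * (M%:Z + 2)) *:
    \sum_(n < N) twistP k n *: \sum_(l < N) twistN n l *: f (Evec' l).
  rewrite scaler_sumr; apply: eq_bigr => n _; have nM : (n <= M)%N by rewrite -ltnS.
  rewrite {1}(fK _ nM).
  by rewrite !scalerA mulrC.
rewrite scalerA -pwD addNr expr0z scale1r.
under [RHS]eq_bigr => n _ do rewrite scaler_sumr.
rewrite exchange_big /= (bigD1 (Ordinal (kM : k < N)%N)) //= [X in _ + X]big1 ?addr0 => [|l lk].
  under eq_bigr => n _ do rewrite scalerA.
  by rewrite -scaler_suml twist_inv // eqxx scale1r.
under eq_bigr => n _ do rewrite scalerA.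
have lM : (l <= M)%N by rewrite -ltnS.
rewrite -scaler_suml (twist_inv _ lM) (_ : k == l = false) ?scale0r //.
by apply: contraNF lk => /eqP e; rewrite -val_eqE /= e.
Qed.

Lemma prod_qint c s : (s <= c)%N ->
  \prod_(0 <= t < s) qint a (c - t) =
  a ^ (- (2 * s%:Z * (c%:Z - 1)) + s%:Z * (s%:Z - 1)) * (pq c / pq (c - s)) / (1 - q) ^+ s.
Proof.
elim: s => [|s IH] h.
  by rewrite big_nil subn0 divff ?pq_neq0 // !expr0 !(mul0r, mulr0, add0r, addr0, oppr0) expr0z
    invr1 !mulr1.
rewrite big_nat_recr //= IH; last by lia.
rewrite qintE.
have -> : (c - s = (c - s.+1).+1)%N by lia.
have -> : a ^ (- (2 * s.+1%:Z * (c%:Z - 1)) + s.+1%:Z * (s.+1%:Z - 1)) =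
  a ^ (- (2 * s%:Z * (c%:Z - 1)) + s%:Z * (s%:Z - 1)) * a ^ (- (2 * ((c - s.+1).+1%:Z - 1))).
  rewrite -!pwD; congr (_ ^ _).
  have -> : (c - s.+1).+1%:Z = c%:Z - s%:Z by lia.
  by rewrite -[s.+1]addn1 PoszD; ring.
rewrite pqS (exprS (1 - q)).
have := pq_neq0 (c - s.+1); have := qX_neq1 (ltn0Sn (c - s.+1)).
have := qm1_neq0 s; have := qm1_neq0 1; rewrite expr1.
move: (a ^ _) (a ^ _) (pq _) (pq _) (q ^+ _) ((1 - q) ^+ s).
by move=> x y w v Q P h1 h2 h3 h4; field; rewrite ?h1 ?h2 ?h3 ?h4.
Qed.

Lemma prod_qint0 c s : (c < s)%N -> \prod_(0 <= t < s) qint a (c - t) = 0.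
Proof.
by move=> cs; rewrite (big_cat_nat (n := c.+1)) //= big_nat_recr //= subnn qint0 mulr0 mul0r.
Qed.

(** * Twisting antiparallel strands *)

Lemma ent_mul_sFt T x y : ent (T * (sF false)^T) x y = cFf y.+1 * ent T x y.+1.
Proof. by rewrite -ent_tr trM trmxK ent_sFf ent_tr. Qed.

Lemma ent_mul_sKV b T x y : (x <= M)%N -> ent (sKV b * T) x y =
  a ^ (- (2 * wtH b (inord x : 'I_N))) * ent T x y.
Proof.
move=> xM; rewrite /ent !ltnS xM /=; case: ifP => _; rewrite ?mulr0 //.
by rewrite diag_mull mxE.
Qed.

Lemma ent_dFtf T x y : (x <= M)%N ->
  ent (dF true false T) x y =
  a ^ (- (2 * (M%:Z - 2 * x%:Z))) * cFf y.+1 * ent T x y.+1 + qint a x * ent T x.-1 y.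
Proof.
move=> xM; rewrite /dF entD ent_sFt // ent_mul_sFt ent_mul_sKV // /wtH /= weightE inordK //.
by rewrite mulrA (mulrC (cFf _)); congr (a ^ _ * _ * _ + _); lia.
Qed.

Definition dFcoef (c j i : nat) : F :=
  (\prod_(0 <= t < j - i) qint a (c - t)) * a ^ (- (2 * (M%:Z - 2 * (c - (j - i))%N%:Z) * i%:Z)) *
  \prod_(0 <= t < i) cFf t.+1.

(** K^-1 (x) F and F (x) 1 q-commute, as in [iter_dE_bs]. The innermost [dF] is peeled off, so that
    the induction always reads the same entry (c, 0). *)
Lemma iter_dFtf c j T : (c <= M)%N -> ent (iter j (dF true false) T) c 0 =
  \sum_(i < j.+1) gbin j i * (dFcoef c j i * ent T (c - (j - i)) i).
Proof.
move=> cM; elim: j T => [|j IH] T.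
  by rewrite big_ord1 gbin0 /dFcoef !big_nil mulr0 oppr0 expr0z !subn0 !mul1r.
rewrite iterSr IH (sum_gbinS j (fun i => dFcoef c j.+1 i * ent T (c - (j.+1 - i)) i)).
apply: eq_bigr => i _; have ij : (i <= j)%N by rewrite -ltnS.
congr (_ * _); rewrite ent_dFtf; last by rewrite (leq_trans (leq_subr _ _)).
rewrite mulrDr addrC subSS; congr (_ + _).
  rewrite subSn // subnS mulrA mulrA; congr (_ * _).
  rewrite /dFcoef subSn // big_nat_recr //= subnS.
  (* If this index is 0 then [0] = 0 kills both sides, and the truncated predecessor does no
     harm. *)
  case e : (c - (j - i))%N => [|r]; first by rewrite qint0 !(mulr0, mul0r).
  rewrite /= qE.
  have -> : a ^ (- (2 * (M%:Z - 2 * r.+1%:Z) * i%:Z)) =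
    a ^ (- (2 * (M%:Z - 2 * r%:Z) * i%:Z)) * a ^ (4 * i%:Z).
    by rewrite -pwD; congr (_ ^ _); rewrite -[r.+1]addn1 PoszD; ring.
  by move: (a ^ _) (a ^ _) (\prod_(_ <= _ < _) _) (\prod_(_ <= _ < _) _) => *; ring.
rewrite mulrA; congr (_ * _).
rewrite /dFcoef subSS big_nat_recr //=.
have -> : a ^ (- (2 * (M%:Z - 2 * (c - (j - i))%N%:Z) * i.+1%:Z)) =
  a ^ (- (2 * (M%:Z - 2 * (c - (j - i))%N%:Z) * i%:Z)) * a ^ (- (2 * (M%:Z - 2 *
    (c - (j - i))%N%:Z))).
  by rewrite -pwD; congr (_ ^ _); rewrite -[i.+1]addn1 PoszD; ring.
by move: (a ^ _) (a ^ _) (\prod_(_ <= _ < _) _) (\prod_(_ <= _ < _) _) => *; ring.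
Qed.

Lemma ent_sEtX n T i j : ent (sE true ^+ n * T) i j = (\prod_(0 <= t < n) qint a (M - i - t)) *
  ent T (i + n) j.
Proof.
elim: n i T => [|n IH] i T; first by rewrite expr0 big_nil !mul1r addn0.
rewrite exprSr -mulrA IH ent_sEt addnS mulrA big_nat_recr //=.
by rewrite subnDA.
Qed.

Lemma ent_mul_sFtX n T i j : ent (T * (sF false)^T ^+ n) i j =
  (\prod_(0 <= t < n) cFf (j + t).+1) * ent T i (j + n).
Proof.
elim: n j T => [|n IH] j T; first by rewrite expr0 big_nil mulr1 mul1r addn0.
by rewrite exprS mulrA IH ent_mul_sFt addnS mulrA big_nat_recr //=.
Qed.

Lemma ent_sEf0X n T j : (0 < n)%N -> ent (sE false ^+ n * T) 0 j = 0.
Proof. by case: n => // n _; rewrite exprS -mulrA ent_sEf0. Qed.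

Lemma ent_sig b c T x y : (x <= M)%N -> (y <= M)%N -> ent (sig b c T) x y =
  a ^ (wtH b (inord y : 'I_N) * wtH c (inord x : 'I_N)) *
  \sum_(n < N) thetac n * ent (sE b ^+ n * T * (sF c)^T ^+ n) y x.
Proof.
move=> xM yM; rewrite /sig ent_tr {1}/ent !ltnS xM yM /= mxE mul1r; congr (_ * _).
have <- : ent (theta b c T) y x = theta b c T (inord y) (inord x) by rewrite /ent !ltnS xM yM.
by rewrite /theta ent_sum; apply: eq_bigr => n _; rewrite entZ.
Qed.

Lemma thetac0 : thetac 0 = 1.
Proof. by rewrite /thetac mul0n !expr0 /qfact big_geq // invr1 !mulr1. Qed.

Lemma wtH_inord b (x : nat) : (x <= M)%N ->
  wtH b (inord x : 'I_N) = if b then M%:Z - 2 * x%:Z else - (M%:Z - 2 * x%:Z).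
Proof. by move=> xM; rewrite /wtH /strandH weightE inordK // PoszM. Qed.

Lemma ent_sig_ft0 T k : (k <= M)%N -> ent (sig false true T) k 0 =
  a ^ (- (M%:Z * (M%:Z - 2 * k%:Z))) * ent T 0 k.
Proof.
move=> kM; rewrite ent_sig // !wtH_inord // big_ord_recl [X in _ * (_ + X)]big1 => [|n _];
  last first.
  by rewrite -mulrA ent_sEf0X // mulr0.
rewrite -[nat_of_ord ord0]/0%N !expr0 mul1r mulr1 thetac0 mul1r addr0.
by congr (a ^ _ * _); ring.
Qed.

Lemma ent_sig_tf0 T k : (k <= M)%N -> ent (sig true false T) 0 k =
  a ^ (- (M%:Z * (M%:Z - 2 * k%:Z))) *
  \sum_(n < (M - k).+1) thetac n * (\prod_(0 <= t < n) qint a (M - k - t)) *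
    (\prod_(0 <= t < n) cFf t.+1) * ent T (k + n) n.
Proof.
move=> kM; rewrite ent_sig // !wtH_inord //=; congr (_ * _).
  by congr (a ^ _); ring.
pose G n := thetac n * (\prod_(0 <= t < n) qint a (M - k - t)) * (\prod_(0 <= t < n) cFf t.+1) *
  ent T (k + n) n.
transitivity (\sum_(n < N) G n).
  apply: eq_bigr => n _; rewrite ent_mul_sFtX ent_sEtX /G.
  move: (\prod_(_ <= _ < _) _) (\prod_(_ <= _ < _) _) => *; rewrite add0n; ring.
rewrite -(big_mkord xpredT G) (big_cat_nat (n := (M - k).+1)) //= ?ltnS ?leq_subr //.
rewrite [X in _ + X]big1_seq ?addr0; last first.
  move=> n /andP[_]; rewrite mem_index_iota => /andP[h _].
  by rewrite /G ent_out ?mulr0 //; apply/orP; left; lia.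
by rewrite big_mkord.
Qed.

(** Times [gbin (M - k) j], this is the coefficient of the (k + j, 0) entry of F^j T in the (k, 0)
    entry of the full twist of T. *)
Definition sig2_coef (k j : nat) : F := (-1) ^+ j * (1 - q) ^+ j *
  a ^ (3 * j%:Z * j%:Z + j%:Z + 6 * k%:Z * j%:Z - 4 * M%:Z * j%:Z + 4 * k%:Z * k%:Z + 4 *
    k%:Z - 2 * M%:Z * (M%:Z + 2)).

(** Both sides are the coefficient of the entry (k + i, i) of T in the (k, 0) entry of its full
    twist. *)
Lemma sum_sig2_coef k i : (k + i <= M)%N ->
  \sum_(j < (M - k).+1) gbin (M - k) j * gbin j i * (sig2_coef k j * dFcoef (k + j) j i) =
  a ^ (- (2 * M%:Z * (M%:Z - 2 * k%:Z))) *
  (thetac i * (\prod_(0 <= t < i) qint a (M - k - t)) * (\prod_(0 <= t < i) cFf t.+1)).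
Proof.
move=> kiM; rewrite (@sum_triangle (M - k) i _ (fun j => sig2_coef k j * dFcoef (k + j) j i)) //.
have [B hB] : exists B, M = (k + i + B)%N by exists (M - (k + i))%N; lia.
have -> : (M - k - i = B)%N by lia.
pose C := (-1) ^+ i * (1 - q) ^+ i * (\prod_(0 <= t < i) cFf t.+1) *
  a ^ (3 * i%:Z * i%:Z + i%:Z + 6 * k%:Z * i%:Z - 4 * M%:Z * i%:Z + 4 * k%:Z * k%:Z + 4 *
    k%:Z - 2 * M%:Z * (M%:Z + 2)
    - 2 * (M%:Z - 2 * k%:Z - 2 * i%:Z) * i%:Z).
transitivity (gbin (M - k) i * (C * \sum_(s < B.+1) gbin B s *
  ((-1) ^+ s * a ^ (2 * s%:Z * (s%:Z - 1) + 4 * s%:Z - 4 * B%:Z * s%:Z) * qpoch q (q ^+ (k +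
    i).+1) s * qpoch q (0 * q ^+ s) (B - s)))).
  congr (_ * _); rewrite mulr_sumr; apply: eq_bigr => s _.
  rewrite [qpoch q (0 * _) _](_ : _ = 1); last first.
    by rewrite /qpoch big1 // => t _; rewrite !mul0r subr0.
  move: {s}(nat_of_ord s) => s.
  rewrite /sig2_coef /dFcoef /C (_ : i + s - i = s)%N; last by lia.
  rewrite prod_qint; last by lia.
  rewrite (_ : k + (i + s) - s = k + i)%N; last by lia.
  rewrite (_ : k + (i + s) = k + i + s)%N; last by lia.
  rewrite pqD (mulrAC (pq (k + i))) divff ?pq_neq0 ?mul1r // !exprD.
  have := qm1_neq0 s; move: (\prod_(_ <= _ < _) _) (qpoch q _ _) ((1 - q) ^+ i) ((1 - q) ^+ s)
    ((-1) ^+ i) ((-1) ^+ s).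
  move=> P Q u w e e' w0.
  set A1 := a ^ _; set A2 := a ^ _; set A3 := a ^ _; set A4 := a ^ _; set A5 := a ^ _.
  have hA : A1 * A2 * A3 = A4 * A5.
    rewrite /A1 /A2 /A3 /A4 /A5 -!pwD; congr (_ ^ _); rewrite hB; ring.
  transitivity (e * e' * u * P * Q * gbin B s * (A1 * A2 * A3)); last first.
    by rewrite hA; move: (gbin _ _) A4 A5 {hA} => *; ring.
  by move: (gbin _ _) A1 A2 A3 {hA} => *; field.
(* With c = 0 and b = q^(k+i+1) the product on the right is the power b^B, with B = M - k - i. *)
rewrite q_vandermonde (eq_bigr (fun=> q ^+ (k + i).+1)); last by move=> t _; rewrite mul0r subr0.
rewrite big_const_nat subn0 iter_mulr_1.
rewrite prod_qint; last by lia.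
rewrite /C /thetac qfactE dl_exp gbinE; last by lia.
have -> : a ^+ (i * i.-1) = a ^ (i%:Z * (i%:Z - 1)).
  by rewrite exprnP; congr (_ ^ _); case: (i) => // m; rewrite PoszM; ring.
have -> : (M - k - i = B)%N by lia.
have := qm1_neq0 i; have := pq_neq0 i; have := pq_neq0 B.
rewrite qE pwX -!pwV.
move: (\prod_(_ <= _ < _) _) (pq _) (pq _) (pq _) ((1 - q) ^+ i) ((-1) ^+ i) =>
  P Q1 Q2 Q3 u e h1 h2 h3.
set A1 := a ^ _; set A2 := a ^ _; set A3 := a ^ _; set A4 := a ^ _.
set A5 := a ^ _; set A6 := a ^ _.
have hA : A1 * A2 = A4 * A4 * A6 / (A3 * A5).
  rewrite /A1 /A2 /A3 /A4 /A5 /A6 -!pwD pwV -pwD; congr (_ ^ _).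
  rewrite -subzn; last by lia.
  by rewrite hB; ring.
have a3 : A3 != 0 by apply: pw_neq0.
have a4 : A4 != 0 by apply: pw_neq0.
have a5 : A5 != 0 by apply: pw_neq0.
transitivity (Q1 / (Q3 * Q2) * (e * u * P * (A1 * A2))); first by rewrite !mulrA.
rewrite hA; move: A3 A4 A5 A6 a3 a4 a5 {hA} => A3 A4 A5 A6 a3 a4 a5.
by field; rewrite ?h1 ?h2 ?h3 ?a3 ?a4 ?a5.
Qed.

Lemma ent_sig2_k0 k T : (k <= M)%N ->
  ent (sig false true (sig true false T)) k 0 =
  \sum_(j < (M - k).+1) (gbin (M - k) j * sig2_coef k j) * ent (iter j (dF true false) T) (k + j) 0.
Proof.
move=> kM; rewrite ent_sig_ft0 // ent_sig_tf0 // mulrA -pwD.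
pose G j i := gbin (M - k) j * gbin j i * (sig2_coef k j * dFcoef (k + j) j i) * ent T (k + i) i.
transitivity (\sum_(j < (M - k).+1) \sum_(i < (M - k).+1) G j i); last first.
  apply: eq_bigr => j _; have jM : (j <= M - k)%N by rewrite -ltnS.
  rewrite iter_dFtf; last by lia.
  rewrite -(big_mkord xpredT (fun i => G j i)) (big_cat_nat (n :=
    j.+1)) //= [X in _ + X]big1_seq ?addr0; last first.
    move=> i /andP[_]; rewrite mem_index_iota => /andP[ji _].
    by rewrite /G (gbin_small ji) mulr0 !mul0r.
  rewrite big_mkord mulr_sumr; apply: eq_bigr => i _; have ij : (i <= j)%N by rewrite -ltnS.
  rewrite /G (_ : k + j - (j - i) = k + i)%N; last by lia.
  by move: (gbin _ _) (gbin _ _) (sig2_coef _ _) (dFcoef _ _ _) (ent _ _ _) => *; ring.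
rewrite exchange_big mulr_sumr; apply: eq_bigr => i _.
have iM : (k + i <= M)%N by have := ltn_ord i; lia.
rewrite /G -mulr_suml sum_sig2_coef // mulrA; congr (_ * _ * _).
by congr (_ ^ _); ring.
Qed.

Definition Ffunc (k : nat) (T : mat) : F :=
  \sum_(i < k.+1) gbin k i * ((-1) ^+ i * a ^ (2 * i%:Z * (i%:Z - 1)) * ent T i i).

Lemma prod_cFf_up i : (i <= M)%N -> \prod_(0 <= t < i) cFf t.+1 =
  (-1) ^+ i * a ^ (2 * M%:Z * i%:Z - 2 * i%:Z * (i%:Z + 1)) * qfact a i.
Proof.
elim: i => [|i IH] iM.
  by rewrite big_nil /qfact big_geq // !expr0 !mulr0 mul0r subr0 expr0z !mulr1.
rewrite big_nat_recr //= (IH (ltnW iM)) /cFf (_ : qfact a i.+1 =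
  qfact a i * qint a i.+1) ?(exprS (-1)); last first.
  by rewrite /qfact big_nat_recr.
have -> : a ^ (2 * M%:Z * i.+1%:Z - 2 * i.+1%:Z * (i.+1%:Z + 1)) =
   a ^ (2 * M%:Z * i%:Z - 2 * i%:Z * (i%:Z + 1)) * a ^ (2 * (M%:Z - (2 * i.+1)%N%:Z)).
  by rewrite -pwD; congr (_ ^ _); rewrite PoszM -[i.+1]addn1 PoszD; ring.
by move: (a ^ _) (a ^ _) (qint _ _) (_ ^+ i) (qfact _ _) => *; ring.
Qed.

(** For j = c = k the entries met in [iter_dFtf] are diagonal, and the two products in [dFcoef] are,
    up to sign and a power of [a], [k]!/[i]! and [i]!. *)
Lemma FfuncE k T : (k <= M)%N -> ent (iter k (dF true false) T) k 0 = qfact a k * Ffunc k T.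
Proof.
move=> kM; rewrite iter_dFtf // /Ffunc mulr_sumr; apply: eq_bigr => i _.
have ik : (i <= k)%N by rewrite -ltnS.
have iM : (i <= M)%N by apply: leq_trans kM.
rewrite subKn // [RHS]mulrCA; congr (_ * _); rewrite mulrA; congr (_ * _).
rewrite /dFcoef subKn // prod_cFf_up // prod_qint ?leq_subr // subKn // !qfactE.
move: {i}(nat_of_ord i) ik iM => i ik iM.
have [r ->] : exists r, k = (i + r)%N by exists (k - i)%N; lia.
rewrite addKn (exprD (1 - q)).
have := qm1_neq0 i; have := qm1_neq0 r; have := pq_neq0 i.
move: (pq _) (pq _) ((1 - q) ^+ i) ((1 - q) ^+ r) ((-1) ^+ i) => Q1 Q2 u w e h1 h2 h3.
set A1 := a ^ _; set A2 := a ^ _; set A3 := a ^ _; set A4 := a ^ _; set A5 := a ^ _;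
  set A6 := a ^ _.
have hA : A1 * A2 * A3 * A4 = A5 * A6.
  by rewrite /A1 /A2 /A3 /A4 /A5 /A6 -!pwD; congr (_ ^ _); ring.
transitivity (Q1 * e / (u * w) * (A1 * A2 * A3 * A4)).
  by move: A1 A2 A3 A4 {hA} => *; field; rewrite ?h1 ?h2 ?h3.
by rewrite hA; move: A5 A6 {hA} => *; field; rewrite ?h1 ?h2 ?h3.
Qed.

Lemma iter_sig2 n T : sig false true (sig true false (iter n (dF true false) T)) =
  iter n (dF true false) (sig false true (sig true false T)).
Proof. by elim: n => //= n <-; rewrite !sig_dF. Qed.

(** The quotient of (q^(-M))_l by (q^(-M))_k contains (q)_(M-k) / (q)_(M-l); it turns the
    [gbin (M - k) (l - k)] of [ent_sig2_k0], together with [l]!/[k]!, into [gbin l k]. *)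
Definition Ffunc_norm (l : nat) : F := a ^ (4 * l%:Z) * qpoch q (a ^ (- (4 * M%:Z))) l.
Definition Ffunc' (k : nat) (T : mat) : F := Ffunc_norm k * Ffunc k T.

(** The twist commutes with F^k, and F^j F^k T read at (k + j, 0) is the functional of index k + j.
    The matrix entry is the factor of the theorem attached to a step of the chain t. *)
Lemma Ffunc'_sig2 k T : (k <= M)%N ->
  Ffunc' k (sig false true (sig true false T)) =
  a ^ (- (2 * M%:Z * (M%:Z + 2))) * \sum_(l < N) a ^ (4 * (k%:Z * k%:Z + k%:Z)) * gbin l k *
    Ffunc' l T.
Proof.
move=> kM; apply: (mulfI (qfact_neq0 k)); rewrite /Ffunc' mulrCA -FfuncE //.
rewrite -iter_sig2 ent_sig2_k0 //.
pose H l := a ^ (4 * (k%:Z * k%:Z + k%:Z)) * gbin l k * (Ffunc_norm l * Ffunc l T).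
rewrite -(big_mkord xpredT H) (big_cat_nat (n := k)) ?leqW //=.
rewrite [X in _ * (_ * (X + _))]big1_seq ?add0r; last first.
  by move=> l /andP[_]; rewrite mem_index_iota => /andP[_ lk];
    rewrite /H (gbin_small lk) mulr0 mul0r.
rewrite -[X in _ = _ * (_ * X)]/(\sum_(0 + k <= l < N) H l) big_addn subSn // big_mkord !mulr_sumr.
apply: eq_bigr => j _; have jM : (j <= M - k)%N by rewrite -ltnS.
move: {j}(nat_of_ord j) jM => j jM.
rewrite -iterD [(j + k)%N]addnC FfuncE /H; last by lia.
rewrite !mulrA; congr (_ * _).
have [r hr] : exists r, M = (k + j + r)%N by exists (M - (k + j))%N; lia.
have kjM : (k + j <= M)%N by lia.
rewrite /sig2_coef /Ffunc_norm (qpoch_negE kM) (qpoch_negE kjM) (gbinE jM) (gbinE (leq_addr j k)).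
rewrite !qfactE addKn.
have -> : (M - k - j = r)%N by lia.
have -> : (M - (k + j) = r)%N by lia.
rewrite !exprD.
have := qm1_neq0 k; have := qm1_neq0 j; have := pq_neq0 k; have := pq_neq0 j; have := pq_neq0 r.
have := pq_neq0 (M - k).
move: (pq (M - k)) (pq r) (pq j) (pq k) (pq M) (pq (k + j)) ((1 - q) ^+ k) ((1 - q) ^+ j) =>
  Q1 Q2 Q3 Q4 Q5 Q6 u w h1 h2 h3 h4 h5 h6.
set A1 := a ^ _; set A2 := a ^ _; set A3 := a ^ _; set A4 := a ^ _; set A5 := a ^ _;
  set A6 := a ^ _; set A7 := a ^ _; set A8 := a ^ _; set A9 := a ^ _.
have hA : A1 * A2 * A3 * A4 = A5 * A6 * A7 * A8 * A9.
  by rewrite /A1 /A2 /A3 /A4 /A5 /A6 /A7 /A8 /A9 -!pwD; congr (_ ^ _); ring.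
transitivity ((-1) ^+ k * (-1) ^+ j * Q5 * Q6 / (Q2 * Q3 * u) * (A1 * A2 * A3 * A4)).
  by move: ((-1) ^+ k) ((-1) ^+ j) A1 A2 A3 A4 {hA} => *; field; rewrite ?h1 ?h2 ?h3 ?h4 ?h5 ?h6.
by rewrite hA; move: ((-1) ^+ k) ((-1) ^+ j) A5 A6 A7 A8 A9 {hA} => *; field;
  rewrite ?h1 ?h2 ?h3 ?h4 ?h5 ?h6.
Qed.

(** Inversion of the q-differences: the coefficient of each other diagonal entry is a vanishing
    q-binomial sum. The denominator (q)_(n_1) of the theorem originates here. *)
Lemma Ffunc'_sum T : ent T M M = \sum_(k < N) Ffunc' k T / pq k.
Proof.
pose G k i := gbin M k * gbin k i * ((-1) ^+ k * a ^ (4 * k%:Z + 2 * k%:Z * (k%:Z - 1) - 4 *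
  M%:Z * k%:Z)) *
  ((-1) ^+ i * a ^ (2 * i%:Z * (i%:Z - 1)) * ent T i i).
transitivity (\sum_(k < N) \sum_(i < N) G k i); last first.
  apply: eq_bigr => k _; have kM : (k <= M)%N by rewrite -ltnS.
  rewrite -(big_mkord xpredT (fun i => G k i)) (big_cat_nat (n :=
    k.+1)) //= [X in _ + X]big1_seq ?addr0; last first.
    move=> i /andP[_]; rewrite mem_index_iota => /andP[ji _].
    by rewrite /G (gbin_small ji) mulr0 !mul0r.
  rewrite big_mkord /Ffunc' /Ffunc mulr_sumr mulr_suml; apply: eq_bigr => i _.
  rewrite /G /Ffunc_norm (qpoch_negE kM) (gbinE kM).
  have -> : a ^ (4 * k%:Z + 2 * k%:Z * (k%:Z - 1) - 4 * M%:Z * k%:Z) =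
     a ^ (4 * k%:Z) * a ^ (2 * k%:Z * (k%:Z - 1) - 4 * M%:Z * k%:Z) by rewrite -pwD;
       congr (_ ^ _); ring.
  have := pq_neq0 k; have := pq_neq0 (M - k).
  move: (gbin _ _) (pq _) (pq _) (pq _) (a ^ _) (a ^ _) (a ^ _) (_ ^+ k) (_ ^+ i) =>
    x1 x2 x3 x4 x5 x6 x7 x8 x9 h1 h2.
  by field; rewrite ?h1 ?h2.
rewrite exchange_big /=.
have S i : (i <= M)%N -> \sum_(k < N) G k i = if i == M then ent T M M else 0.
  move=> iM; rewrite /G -mulr_suml.
  rewrite (@sum_triangle M i N (fun k => (-1) ^+ k * a ^ (4 * k%:Z + 2 * k%:Z * (k%:Z - 1) - 4 *
    M%:Z * k%:Z))) ?ltnSn //.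
  case: eqP => [->|/eqP iM'].
    rewrite subnn big_ord1 !gbinn addn0 !mul1r.
    have -> : a ^ (4 * M%:Z + 2 * M%:Z * (M%:Z - 1) - 4 * M%:Z * M%:Z) =
      (a ^ (2 * M%:Z * (M%:Z - 1)))^-1.
      by rewrite pwV; congr (_ ^ _); ring.
    have := pw_neq0 (2 * M%:Z * (M%:Z - 1)); rewrite -(signr_odd _ M).
    by move: (a ^ _) (ent _ _ _) => x y x0; case: odd; rewrite ?expr0 ?expr1; field.
  transitivity (gbin M i * ((-1) ^+ i * a ^ (4 * i%:Z + 2 * i%:Z * (i%:Z - 1) - 4 * M%:Z * i%:Z)
    * \sum_(s < (M - i).+1) gbin (M - i) s * ((-1) ^+ s * a ^ (2 * s%:Z * (s%:Z - 1)) *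
      (a ^ (- (4 * (M - i).-1%:Z))) ^+ s))
    * ((-1) ^+ i * a ^ (2 * i%:Z * (i%:Z - 1)) * ent T i i)).
    congr (_ * _ * _); rewrite mulr_sumr; apply: eq_bigr => s _.
    rewrite pwX exprD.
    set A1 := a ^ _; set A2 := a ^ _; set A3 := a ^ _; set A4 := a ^ _.
    have -> : A1 = A2 * A3 * A4.
      rewrite /A1 /A2 /A3 /A4 -!pwD; congr (_ ^ _).
      have -> : (M - i).-1%:Z = M%:Z - i%:Z - 1 by lia.
      ring.
    by move: (gbin _ _) A2 A3 A4 (_ ^+ i) (_ ^+ s) => *; ring.
  by rewrite qbinomial_theorem qpoch_pw_eq0 ?mulr0 ?mul0r //; lia.
rewrite (eq_bigr (fun i : 'I_N => if i == ord_max then ent T M M else 0)) => [|i _].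
  by rewrite -big_mkcond big_pred1_eq.
by rewrite S // -ltnS.
Qed.

(** The vector e_M of V is not in the image of E, so at the corner the unpaired one of the 2m - 1
    half-twists only costs a power of [a]. *)
Lemma ent_sig_tfMM T : ent (sig true false T) M M = a ^ (- (M%:Z * M%:Z)) * ent T M M.
Proof.
rewrite ent_sig // !wtH_inord // big_ord_recl [X in _ * (_ + X)]big1 => [|n _]; last first.
  by rewrite -mulrA ent_sEtX subnn big_nat_recl // sub0n qint0 !mul0r mulr0.
rewrite -[nat_of_ord ord0]/0%N !expr0 mul1r mulr1 thetac0 mul1r addr0.
by congr (a ^ _ * _); ring.
Qed.

Lemma ent_dFft T j : (j <= M)%N ->
  ent (dF false true T) M j = a ^ (- (2 * M%:Z)) * (qint a j * ent T M j.-1).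
Proof.
move=> jM; rewrite /dF entD ent_sFf [X in _ + _ * X]ent_out ?ltnSn // mulr0 addr0.
rewrite -mulrA ent_mul_sKV // -ent_tr trM trmxK ent_sFt // ent_tr wtH_inord //.
by congr (a ^ (- _) * _); ring.
Qed.

(** On the dual F never produces e^M, so only K^-1 (x) F acts on row M. This moves the entry (M, M -
    t) to the corner, where [ent_sig_odd] applies. *)
Lemma iter_dFft t T : (t <= M)%N ->
  ent (iter t (dF false true) T) M M =
  a ^ (- (2 * M%:Z * t%:Z)) * (\prod_(0 <= r < t) qint a (M - r)) * ent T M (M - t).
Proof.
elim: t T => [|t IH] T tM; first by rewrite big_nil mulr0 oppr0 expr0z !mul1r subn0.
rewrite iterSr (IH _ (ltnW tM)) ent_dFft ?leq_subr // big_nat_recr //= subnS.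
have -> : a ^ (- (2 * M%:Z * t.+1%:Z)) = a ^ (- (2 * M%:Z * t%:Z)) * a ^ (- (2 * M%:Z)).
  by rewrite -pwD; congr (_ ^ _); ring.
by move: (a ^ _) (a ^ _) (\prod_(_ <= _ < _) _) (qint _ _) (ent _ _ _) => *; ring.
Qed.

(** The row vector of the 1 / (q)_l from [Ffunc'_sum], times the k-th power of the matrix in
    [Ffunc'_sig2]. *)
Fixpoint antiparallel_coef (k l : nat) : F :=
  if k is k'.+1 then \sum_(j < N) antiparallel_coef k' j * (a ^ (4 * (j%:Z * j%:Z + j%:Z)) *
    gbin l j) else (pq l)^-1.

Definition sig2 (T : mat) : mat := sig false true (sig true false T).

Lemma ent_sig_odd k T :
  ent (sig true false (iter k sig2 T)) M M =
  a ^ (- (M%:Z * M%:Z) - 2 * M%:Z * (M%:Z + 2) * k%:Z) * \sum_(l < N) antiparallel_coef k l *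
    Ffunc' l T.
Proof.
elim: k T => [|k IH] T.
  rewrite ent_sig_tfMM Ffunc'_sum mulr0 subr0; congr (_ * _).
  by apply: eq_bigr => l _; rewrite mulrC.
rewrite iterSr IH.
have -> : a ^ (- (M%:Z * M%:Z) - 2 * M%:Z * (M%:Z + 2) * k.+1%:Z) =
  a ^ (- (M%:Z * M%:Z) - 2 * M%:Z * (M%:Z + 2) * k%:Z) * a ^ (- (2 * M%:Z * (M%:Z + 2))).
  by rewrite -pwD; congr (_ ^ _); ring.
rewrite -[RHS]mulrA; congr (_ * _); rewrite mulr_sumr.
transitivity (\sum_(l < N) \sum_(l' < N) a ^ (- (2 * M%:Z * (M%:Z + 2))) *
  (antiparallel_coef k l * (a ^ (4 * (l%:Z * l%:Z + l%:Z)) * gbin l' l) * Ffunc' l' T)).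
  apply: eq_bigr => l _; have lM : (l <= M)%N by rewrite -ltnS.
  rewrite /sig2 Ffunc'_sig2 // mulrCA mulr_sumr mulr_sumr; apply: eq_bigr => l' _.
  by rewrite !mulrA.
rewrite exchange_big /=; apply: eq_bigr => l' _.
by rewrite mulr_suml mulr_sumr.
Qed.

Lemma iter_sig2_dF n k T : iter k sig2 (iter n (dF true false) T) =
  iter n (dF true false) (iter k sig2 T).
Proof. by elim: k => //= k ->; rewrite /sig2 iter_sig2. Qed.

Lemma iter_sig_dF n T : sig true false (iter n (dF true false) T) =
  iter n (dF false true) (sig true false T).
Proof. by elim: n => //= n <-; rewrite sig_dF. Qed.

(** Since E e^M = 0, only the summand E (x) K of Delta E acts. *)
Lemma iter_dE_bsM x : iter x (dE false false) (bs 0 M) =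
  ((\prod_(0 <= t < x) cEf t) * a ^ (2 * M%:Z * x%:Z)) *: bs x M.
Proof.
elim: x => [|x IH]; first by rewrite big_nil mulr0 expr0z mulr1 scale1r.
rewrite iterS IH -[X in dE _ _ X]addr0 dE_linear dE_bs [bs x M.+1]bs_out ?ltnSn ?orbT // scaler0
  add0r.
have -> : dE false false 0 = 0 by rewrite /dE mul0r mulr0 mul0r addr0.
rewrite addr0 scalerA big_nat_recr //=; congr (_ *: _).
have -> : a ^ (2 * M%:Z * x.+1%:Z) = a ^ (2 * M%:Z * x%:Z) * a ^ (2 * (2 * M%:Z - M%:Z)).
  by rewrite -pwD; congr (_ ^ _); ring.
by move: (a ^ _) (a ^ _) (\prod_(_ <= _ < _) _) (cEf _) => *; ring.
Qed.

Lemma prod_cEf_neq0 x : (x <= M)%N -> \prod_(0 <= t < x) cEf t != 0.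
Proof.
move=> xM; have := @prod_cEf 0 x xM; rewrite (eq_bigr (fun t => cEf t)) // => ->.
by rewrite !mulf_neq0 ?invr_eq0 ?signr_eq0 ?pw_neq0 ?pq_neq0 ?qm1_neq0.
Qed.

Lemma prod_cEf_eq0 y : (M < y)%N -> \prod_(0 <= t < y) cEf t = 0.
Proof.
move=> My; rewrite (big_cat_nat (n := M.+1)) //= big_nat_recr //=.
by rewrite [cEf M]/cEf subnn qint0 mul0r oppr0 mulr0 mul0r.
Qed.

Lemma ent_iter_dE n x d : (n <= M)%N -> (d <= M)%N ->
  ent (iter (x + n) (dE false false) (bs 0 (M - n))) (x + d) (M - d) =
  gbin (x + n) (x + d) * dEcoef (M - n) (x + n) (x + d).
Proof.
move=> nM dM; rewrite iter_dE_bs ent_sum.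
case: (leqP (x + d) M) => xdM; last first.
  rewrite big1 => [|i _]; last by rewrite entZ ent_out ?mulr0 // xdM.
  by rewrite /dEcoef prod_cEf_eq0 // !(mulr0, mul0r).
pose G i := gbin (x + n) i * dEcoef (M - n) (x + n) i.
transitivity (\sum_(i < (x + n).+1) (if (x + d == i)%N then G i else 0)).
  apply: eq_bigr => i _; rewrite entZ ent_bs ?leq_subr //; case: eqP => [e|_];
    last by rewrite mulr0.
  rewrite -e /G; have := ltn_ord i; rewrite -e => h.
  by rewrite (_ : (M - d == _)%N) ?mulr1 //; lia.
rewrite sum_pick ltnS; case: leqP => // h.
by rewrite gbin_small // mul0r.
Qed.

(** * The pairing *)

(** The contribution of the outgoing index z = M - d, of the l-th functional and of the n-th vector,
    without their norms. The three lines come from closing z and [iter_dFft], from [Ffunc'_iter_dF],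
    and from [ent_slice_top]. *)
Definition pairing_term (d l x n : nat) : F :=
  a ^ (2 * (M%:Z - 2 * (M%:Z - d%:Z)) + 2 * M%:Z * d%:Z) / (\prod_(0 <= r < d) qint a (M - r)) *
  (gbin (l + d) (x + d) * dFcoef l (l + d) (x + d) / qfact a l) *
  ((gbin (x + n) (x + d) * dEcoef (M - n) (x + n) (x + d)) / ((\prod_(0 <= t < x) cEf t) *
    a ^ (2 * M%:Z * x%:Z))).

Lemma pairing_termE d l x n : (d <= n)%N -> (x <= l)%N -> (n <= M)%N -> (l <= M)%N ->
  pairing_term d l x n =
  (-1) ^+ n * a ^ (- (3 * n%:Z * n%:Z) + 3 * n%:Z + 2 * M%:Z * (n%:Z - 1)) / (1 - q) ^+ n /
    (pq l * pq M) *
  (gbin l x * gbin n d *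
    ((-1) ^+ (x + d) *
     a ^ (2 * (x + d)%N%:Z * ((x + d)%N%:Z - 1) + 4 * d%:Z - 4 * n%:Z * (x + d)%N%:Z)) *
    (pq (l + d) * (pq (x + n) / pq (x + d)) * (falling (M%:Z - x%:Z) d * pq (M - d)))).
Proof.
move=> dn xl nM lM.
have dM : (d <= M)%N by lia.
have xM : (x <= M)%N by lia.
case: (leqP (x + d) M) => xdM; last first.
  rewrite subzn // falling_small; last by lia.
  by rewrite mul0r !mulr0 /pairing_term /dEcoef (prod_cEf_eq0 xdM) !(mulr0, mul0r).
have fE : falling (M%:Z - x%:Z) d = pq (M - x) / pq (M - x - d).
  have h : (d <= M - x)%N by lia.
  rewrite subzn // -(fallingE h).
  by rewrite mulfK ?pq_neq0.
rewrite fE /pairing_term /dFcoef /dEcoef prod_qint //.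
rewrite (_ : l + d - (x + d) = l - x)%N; last by lia.
rewrite prod_qint ?leq_subr // subKn //.
rewrite (_ : x + n - (x + d) = n - d)%N; last by lia.
rewrite prod_cEf; last by lia.
have pe y : (y <= M)%N -> \prod_(0 <= t < y) cEf t = (-1) ^+ y * a ^ (y%:Z * (- (4 * M%:Z) + 6 *
  0%:Z + 6) + 3 * y%:Z * (y%:Z - 1)) *
  (pq (M - 0) / pq (M - 0 - y)) / (1 - q) ^+ y.
  by move=> yM; rewrite -(@prod_cEf 0 y yM).
rewrite !pe // prod_cFf_up // !qfactE !subn0.
rewrite !gbinE; try lia.
have [x' hl] : exists x', l = (x + x')%N by exists (l - x)%N; lia.
have [d' hn] : exists d', n = (d + d')%N by exists (n - d)%N; lia.
have [w hM] : exists w, M = (x + d + w)%N by exists (M - (x + d))%N; lia.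
have [w' hM'] : exists w', M = (n + w')%N by exists (M - n)%N; lia.
rewrite (_ : M - (M - n) = n)%N; last by lia.
rewrite (_ : n - (n - d) = d)%N; last by lia.
rewrite (_ : M - x - d = M - (x + d))%N; last by lia.
rewrite (_ : l + d - (x + d) = l - x)%N; last by lia.
rewrite (_ : x + n - (x + d) = n - d)%N; last by lia.
rewrite (_ : l - x = x')%N; last by lia.
rewrite (_ : n - d = d')%N; last by lia.
have el : (1 - q) ^+ l = (1 - q) ^+ x * (1 - q) ^+ x' by rewrite hl exprD.
have en : (1 - q) ^+ n = (1 - q) ^+ d * (1 - q) ^+ d' by rewrite hn exprD.
have sn : (-1) ^+ n = (-1) ^+ d * (-1) ^+ d' :> F by rewrite hn exprD.
rewrite el en sn !exprD -(signr_odd _ x) -(signr_odd _ d).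
have := qm1_neq0 x; have := qm1_neq0 x'; have := qm1_neq0 d; have := qm1_neq0 d'.
have := pq_neq0 M; have := pq_neq0 (M - d); have := pq_neq0 (x + d);
  have := pq_neq0 (M - (x + d)); have := pq_neq0 (M - x).
have := pq_neq0 l; have := pq_neq0 x; have := pq_neq0 d; have := pq_neq0 d'; have := pq_neq0 x'.
move: ((1 - q) ^+ x) ((1 - q) ^+ x') ((1 - q) ^+ d) ((1 - q) ^+ d') ((-1) ^+ d').
move: (pq M) (pq (M - d)) (pq (x + d)) (pq (M - (x + d))) (pq (M - x)).
move: (pq l) (pq x) (pq d) (pq d') (pq x') (pq (l + d)) (pq (x + n)) (pq n).
move=> Q1 Q2 Q3 Q4 Q5 Q6 Q7 Q8 Q9 Q10 Q11 Q12 Q13 u1 u2 u3 u4 e h1 h2 h3 h4 h5 h6 h7 h8 h9 h10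
  h11 h12 h13 h14.
set A1 := a ^ _; set A2 := a ^ _; set A3 := a ^ _; set A4 := a ^ _; set A5 := a ^ _;
  set A6 := a ^ _; set A7 := a ^ _; set A8 := a ^ _; set A9 := a ^ _; set A10 := a ^ _;
  set A11 := a ^ _; set A12 := a ^ _; set A13 := a ^ _; set A14 := a ^ _.
have -> : A14 = A1 * A3 * A4 * A5 * A6 * A8 * A9 * A10 / (A2 * A7 * A11 * A12 * A13).
  rewrite /A1 /A2 /A3 /A4 /A5 /A6 /A7 /A8 /A9 /A10 /A11 /A12 /A13 /A14 -!pwD pwV -pwD;
    congr (_ ^ _).
  by rewrite -subzn // hl hn; ring.
have g2 : A2 != 0 by apply: pw_neq0.
have g7 : A7 != 0 by apply: pw_neq0.
have g11 : A11 != 0 by apply: pw_neq0.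
have g12 : A12 != 0 by apply: pw_neq0.
have g13 : A13 != 0 by apply: pw_neq0.
move: A1 A2 A3 A4 A5 A6 A7 A8 A9 A10 A11 A12 A13 {A14} g2 g7 g11 g12 g13.
move=> A1 A2 A3 A4 A5 A6 A7 A8 A9 A10 A11 A12 A13 g2 g7 g11 g12 g13.
have m1 : (-1 : F) != 0 by rewrite oppr_eq0 oner_eq0.
case: (odd x); case: (odd d); rewrite ?expr0 ?expr1; field;
by rewrite ?h1 ?h2 ?h3 ?h4 ?h5 ?h6 ?h7 ?h8 ?h9 ?h10 ?h11 ?h12 ?h13 ?h14 ?g2 ?g7 ?g11 ?g12 ?g13 ?m1.
Qed.

Lemma pairing_term_eq0 d l x n : (n < d)%N -> pairing_term d l x n = 0.
Proof. by move=> nd; rewrite /pairing_term [gbin (x + n) _]gbin_small ?ltn_add2l // !mul0r mulr0.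
  Qed.

(** In terms of N = M + 1, q^(M+2) is q^(1+N) and q^(-M) is q^(1-N), so this is the diagonal pairing
    with the two q-factorials of the theorem. *)
Lemma sum_pairing_term l n : (l <= M)%N -> (n <= M)%N ->
  Ffunc_norm l * Evec_norm n * \sum_(x < l.+1) \sum_(d < N) pairing_term d l x n =
  if l == n then a ^ (- (2 * M%:Z)) * qpoch q (a ^ (4 * (M%:Z + 2))) n * qpoch q (a ^ (- (4 *
    M%:Z))) n else 0.
Proof.
move=> lM nM.
have -> : \sum_(x < l.+1) \sum_(d < N) pairing_term d l x n =
  (-1) ^+ n * a ^ (- (3 * n%:Z * n%:Z) + 3 * n%:Z + 2 * M%:Z * (n%:Z - 1)) / (1 - q) ^+ n /
    (pq l * pq M) *
  (if l == n then
    pq l * pq M * qpoch q (a ^ (- (4 * n%:Z))) n *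
    \prod_(0 <= t < n) (q ^+ n.+1 - a ^ (- (4 * M%:Z)) * q ^+ t) /
    qpoch q (a ^ (- (4 * M%:Z))) n
  else 0).
  rewrite -pairing_sum // mulr_sumr; apply: eq_bigr => x _.
  have xl : (x <= l)%N by rewrite -ltnS.
  rewrite -(big_mkord xpredT (fun d => pairing_term d l x n)) (big_cat_nat (n :=
    n.+1)) //= [X in _ + X]big1_seq ?addr0; last first.
    by move=> d /andP[_]; rewrite mem_index_iota => /andP[nd _]; rewrite pairing_term_eq0.
  rewrite big_mkord mulr_sumr; apply: eq_bigr => d _.
  by rewrite pairing_termE // -ltnS.
case: eqP => [->|_]; last by rewrite !mulr0.
(* From each factor -q^(t-M) is taken out, which leaves 1 - q^(M+2) q^(n-1-t): the factors of
   (q^(M+2))_n in reverse order. *)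
have -> : \prod_(0 <= t < n) (q ^+ n.+1 - a ^ (- (4 * M%:Z)) * q ^+ t) =
    (-1) ^+ n * a ^ (- (4 * M%:Z * n%:Z) + 2 * n%:Z * (n%:Z - 1)) * qpoch q (a ^ (4 * (M%:Z +
      2))) n.
  have e t : (t < n)%N -> q ^+ n.+1 - a ^ (- (4 * M%:Z)) * q ^+ t =
      (- a ^ (- (4 * M%:Z) + 4 * t%:Z)) * (1 - a ^ (4 * (M%:Z + 2)) * q ^+ (n.-1 - t)).
    move=> tn; rewrite !qE mulrBr mulr1 mulNr opprK [RHS]addrC -!pwD.
    by congr (a ^ _ - _); lia.
  rewrite (eq_big_nat _ _ (F2 := fun t => (- a ^ (- (4 * M%:Z) + 4 * t%:Z)) * (1 - a ^ (4 *
    (M%:Z + 2)) * q ^+ (n.-1 - t)))); last first.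
    by move=> t /andP[_ tn]; apply: e.
  rewrite big_split /=; congr (_ * _).
    elim: (n) => [|m IH]; first by rewrite big_nil expr0 !mulr0 oppr0 mul0r addr0 expr0z mulr1.
    rewrite big_nat_recr //= IH (exprS (-1)).
    have -> : a ^ (- (4 * M%:Z * m.+1%:Z) + 2 * m.+1%:Z * (m.+1%:Z - 1)) =
      a ^ (- (4 * M%:Z * m%:Z) + 2 * m%:Z * (m%:Z - 1)) * a ^ (- (4 * M%:Z) + 4 * m%:Z).
      by rewrite -pwD; congr (_ ^ _); ring.
    by move: (a ^ _) (a ^ _) (_ ^+ m) => *; ring.
  rewrite /qpoch [RHS]big_nat_rev add0n; apply: eq_big_nat => t /andP[_ tn].
  by congr (1 - _ * _ ^+ _); lia.
rewrite (@qpoch_negE n n (leqnn n)) subnn qpoch0 divr1 /Ffunc_norm /Evec_norm.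
rewrite (_ : gbin M n = (-1) ^+ n * a ^ (- (2 * n%:Z * (n%:Z - 1) - 4 * M%:Z * n%:Z)) *
  qpoch q (a ^ (- (4 * M%:Z))) n / pq n); last first.
  rewrite (qpoch_negE nM) gbinE // -pwV.
  have := pw_neq0 (2 * n%:Z * (n%:Z - 1) - 4 * M%:Z * n%:Z); have := pq_neq0 n;
    have := pq_neq0 (M - n).
  rewrite -(signr_odd _ n); move: (a ^ _) (pq _) (pq _) (pq _) => x y z w h1 h2 h3.
  by case: odd; rewrite ?expr0 ?expr1; field; rewrite ?h1 ?h2 ?h3.
have := qpoch_neg_neq0 nM; have := pq_neq0 n; have := pq_neq0 M; have := qm1_neq0 n.
move: (qpoch q (a ^ (- (4 * M%:Z))) n) (qpoch q (a ^ (4 * (M%:Z +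
  2))) n) (pq n) (pq M) ((1 - q) ^+ n) => P R Q1 Q2 u h1 h2 h3 h4.
set A1 := a ^ _; set A2 := a ^ _; set A3 := a ^ _; set A4 := a ^ _; set A5 := a ^ _;
  set A6 := a ^ _; set A7 := a ^ _.
have -> : A7 = A1 * A2 * A3 * A4 * A5 * A6.
  by rewrite /A1 /A2 /A3 /A4 /A5 /A6 /A7 -!pwD; congr (_ ^ _); ring.
rewrite -(signr_odd _ n); move: A1 A2 A3 A4 A5 A6 {A7} => *.
by case: odd; rewrite ?expr0 ?expr1; field; rewrite ?h1 ?h2 ?h3 ?h4.
Qed.

(** * The cut tangle at the extreme weight *)

Lemma linear_scale (f : mat -> mat) c T : linear f -> f (c *: T) = c *: f T.
Proof.
move=> fl; have f0 : f 0 = 0 by have := fl (-1) 0 0; rewrite scaler0 addr0 scaleN1r addNr.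
by rewrite -[c *: T]addr0 fl f0 !addr0.
Qed.

Lemma iter_comm (f g : mat -> mat) n T : (forall T, f (g T) = g (f T)) -> f (iter n g T) =
  iter n g (f T).
Proof. by move=> h; elim: n => //= n <-. Qed.

(* Let B act on strands 1 and 2 and A on strands 0 and 1 of the 4-plat; then
   closure_scalar A B w is the w-th diagonal entry of the tangle obtained by
   cutting the outer strand. *)
Definition slice (B : mat -> mat) (w z : nat) : mat := \matrix_(x, y) ent (B (bs x w)) y z.

Definition closure_scalar (A B : mat -> mat) (w : nat) : F :=
  \sum_(z < N) a ^ (2 * (M%:Z - 2 * z%:Z)) * ent (A (slice B w z)) w z.

(** By [iter_dE_bsM], e^x (x) e^M is a multiple of E^x (e^0 (x) e^M), and E^x passes through B;
    hence B is needed on e^0 (x) e^M only. *)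
Lemma ent_slice_top B (g : nat -> F) x d : linear B -> (forall T, B (dE false false T) =
  dE false false (B T)) ->
  B (bs 0 M) = \sum_(n < N) g n *: Evec' n -> (x <= M)%N -> (d <= M)%N ->
  ent (slice B M (M - d)) x (x + d) =
  \sum_(n < N) g n * Evec_norm n * ((gbin (x + n) (x + d) * dEcoef (M - n) (x + n) (x + d)) /
     ((\prod_(0 <= t < x) cEf t) * a ^ (2 * M%:Z * x%:Z))).
Proof.
move=> Bl BE B0 xM dM.
have cx : (\prod_(0 <= t < x) cEf t) * a ^ (2 * M%:Z * x%:Z) != 0 by rewrite mulf_neq0
  ?prod_cEf_neq0 ?pw_neq0.
transitivity (ent (B (bs x M)) (x + d) (M - d)).
  case: (leqP (x + d) M) => xd; last by rewrite !ent_out // xd ?orbT.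
  by rewrite {1}/ent !ltnS xM xd /= mxE !inordK // ltnS.
have -> : B (bs x M) = ((\prod_(0 <= t < x) cEf t) * a ^ (2 * M%:Z *
  x%:Z))^-1 *: iter x (dE false false) (B (bs 0 M)).
  rewrite -iter_comm // iter_dE_bsM.
  by rewrite (linear_scale _ _ Bl) scalerA mulVf // scale1r.
rewrite B0 linear_comb; last exact/iter_linear/dE_linear.
rewrite entZ ent_sum mulr_sumr; apply: eq_bigr => n _; have nM : (n <= M)%N by rewrite -ltnS.
rewrite entZ /Evec'.
have -> : iter x (dE false false) (Evec_norm n *: Evec n) =
  Evec_norm n *: iter (x + n) (dE false false) (bs 0 (M - n)).
  by rewrite linear_scale ?iterD //; apply/iter_linear/dE_linear.
rewrite entZ ent_iter_dE //.
by move: (_^-1) (Evec_norm _) (gbin _ _) (dEcoef _ _ _) => *; ring.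
Qed.

(** The l-th functional reads F^l T at (l, 0), so on F^d T it reads F^(l+d) T there. Terms with i <
    d drop out, as they would lower the index l more than l times; hence i = x + d. *)
Lemma Ffunc'_iter_dF l d T : (l <= M)%N ->
  Ffunc' l (iter d (dF true false) T) = Ffunc_norm l / qfact a l *
  \sum_(x < l.+1) gbin (l + d) (x + d) * (dFcoef l (l + d) (x + d) * ent T x (x + d)).
Proof.
move=> lM; rewrite /Ffunc' -mulrA; congr (_ * _).
apply: (mulfI (qfact_neq0 l)); rewrite -FfuncE // mulrA mulfV ?qfact_neq0 ?mul1r //.
rewrite -iterD iter_dFtf //.
pose G i := gbin (l + d) i * (dFcoef l (l + d) i * ent T (l - (l + d - i)) i).
rewrite -(big_mkord xpredT G) (big_cat_nat (n := d)) //=; last by lia.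
rewrite [X in X + _]big1_seq ?add0r; last first.
  move=> i /andP[_]; rewrite mem_index_iota => /andP[_ id].
  rewrite /G /dFcoef prod_qint0 ?mul0r ?mulr0 //; lia.
rewrite -[LHS]/(\sum_(0 + d <= i < (l + d).+1) G i) big_addn subSn ?leq_addl // addnK big_mkord.
apply: eq_bigr => x _; have xl : (x <= l)%N by rewrite -ltnS.
by rewrite /G subnDr subKn.
Qed.

Lemma closure_scalar_top B (g : nat -> F) k : linear B -> (forall T, B (dE false false T) =
  dE false false (B T)) ->
  B (bs 0 M) = \sum_(n < N) g n *: Evec' n ->
  \sum_(z < N) a ^ (2 * (M%:Z - 2 * z%:Z)) * ent (sig true false (iter k sig2 (slice B M z))) M z =
  a ^ (- (M%:Z * (M%:Z + 2)) - 2 * M%:Z * (M%:Z + 2) * k%:Z) *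
  \sum_(n < N) antiparallel_coef k n * g n * (qpoch q (a ^ (4 * (M%:Z + 2))) n *
    qpoch q (a ^ (- (4 * M%:Z))) n).
Proof.
move=> Bl BE B0.
(* The new index d = M - z is the number of times F is applied to reach the corner. *)
rewrite (reindex_inj rev_ord_inj) /=.
transitivity (\sum_(d < N) \sum_(l < N) \sum_(x < l.+1) \sum_(n < N)
  a ^ (- (M%:Z * M%:Z) - 2 * M%:Z * (M%:Z + 2) * k%:Z) * (antiparallel_coef k l * g n) *
    (Ffunc_norm l * Evec_norm n * pairing_term d l x n)).
  apply: eq_bigr => d _; have dM : (d <= M)%N by rewrite -ltnS.
  rewrite subSS.
  have qn : \prod_(0 <= r < d) qint a (M - r) != 0.
    by rewrite prod_qint // !mulf_neq0 ?invr_eq0 ?pw_neq0 ?pq_neq0 ?qm1_neq0.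
  have := @iter_dFft d (sig true false (iter k sig2 (slice B M (M - d)))) dM.
  rewrite -iter_sig_dF -iter_sig2_dF ent_sig_odd => h.
  have -> : ent (sig true false (iter k sig2 (slice B M (M - d)))) M (M - d) =
     a ^ (2 * M%:Z * d%:Z) / (\prod_(0 <= r < d) qint a (M - r)) *
     (a ^ (- (M%:Z * M%:Z) - 2 * M%:Z * (M%:Z + 2) * k%:Z) *
     \sum_(l < N) antiparallel_coef k l * Ffunc' l (iter d (dF true false) (slice B M (M - d)))).
    rewrite h -pwV; have := pw_neq0 (2 * M%:Z * d%:Z).
    by move: (a ^ _) (\prod_(_ <= _ < _) _) qn (ent _ _ _) => y z z0 w y0; field; rewrite y0 z0.
  rewrite !mulr_sumr; apply: eq_bigr => l _; have lM : (l <= M)%N by rewrite -ltnS.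
  rewrite Ffunc'_iter_dF // !mulr_sumr; apply: eq_bigr => x _.
  have xM : (x <= M)%N by have := ltn_ord x; lia.
  rewrite (ent_slice_top Bl BE B0) // !mulr_sumr; apply: eq_bigr => n _.
  rewrite /pairing_term -subzn //.
  have -> : a ^ (2 * (M%:Z - 2 * (M%:Z - d%:Z)) + 2 * M%:Z * d%:Z) =
    a ^ (2 * (M%:Z - 2 * (M%:Z - d%:Z))) * a ^ (2 * M%:Z * d%:Z) by rewrite pwD.
  move: (_^-1) (_^-1) (_^-1) (Evec_norm _) (gbin _ _) (gbin _ _) (dEcoef _ _ _) (dFcoef _ _ _)
    (Ffunc_norm _) (antiparallel_coef _ _) (g _).
  by move: (a ^ _) (a ^ _) (a ^ _) => *; ring.
rewrite exchange_big /= mulr_sumr.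
apply: eq_bigr => l _; have lM : (l <= M)%N by rewrite -ltnS.
rewrite exchange_big /=.
under eq_bigr => x _ do rewrite exchange_big /=.
rewrite exchange_big /=.
transitivity (\sum_(n < N) a ^ (- (M%:Z * M%:Z) - 2 * M%:Z * (M%:Z + 2) * k%:Z) *
  (antiparallel_coef k l * g n) *
  (if l == n :> nat then a ^ (- (2 * M%:Z)) * qpoch q (a ^ (4 * (M%:Z + 2))) n *
    qpoch q (a ^ (- (4 * M%:Z))) n else 0)).
  apply: eq_bigr => n _; have nM : (n <= M)%N by rewrite -ltnS.
  rewrite -sum_pairing_term // !mulr_sumr; apply: eq_bigr => x _.
  by rewrite !mulr_sumr.
rewrite (bigD1 l) //= eqxx [X in _ + X]big1 ?addr0; last first.
  by move=> n nl; rewrite -val_eqE /= in nl; rewrite eq_sym (negbTE nl) mulr0.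
have -> : a ^ (- (M%:Z * (M%:Z + 2)) - 2 * M%:Z * (M%:Z + 2) * k%:Z) =
  a ^ (- (M%:Z * M%:Z) - 2 * M%:Z * (M%:Z + 2) * k%:Z) * a ^ (- (2 * M%:Z)).
  by rewrite -pwD; congr (_ ^ _); ring.
by move: (a ^ _) (a ^ _) (antiparallel_coef _ _) (g _) (qpoch _ _ _) (qpoch _ _ _) => *; ring.
Qed.

Lemma ent_slice (B : mat -> mat) w z x y : linear B -> ent (slice B w z) x y = ent (B (bs x w)) y z.
Proof.
move=> Bl; have B0 : B 0 = 0 by have := linear_scale 0 0 Bl; rewrite !scale0r.
case: (leqP x M) => xM; last by rewrite ent_out ?xM // bs_out ?xM // B0 ent0.
case: (leqP y M) => yM; last by rewrite !ent_out ?yM ?orbT.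
by rewrite {1}/ent !ltnS xM yM /= mxE !inordK // ltnS.
Qed.

Lemma ent_mul_sEt T x y : ent (T * (sE true)^T) x y = qint a (M - y) * ent T x y.+1.
Proof. by rewrite -ent_tr trM trmxK ent_sEt ent_tr. Qed.

Lemma ent_sK b T x y : (x <= M)%N -> ent (sK b * T) x y =
  a ^ (2 * wtH b (inord x : 'I_N)) * ent T x y.
Proof.
move=> xM; rewrite /ent !ltnS xM /=; case: ifP => _; rewrite ?mulr0 //.
by rewrite diag_mull mxE.
Qed.

Lemma ent_mul_sK b T x y : (y <= M)%N -> ent (T * sK b) x y =
  a ^ (2 * wtH b (inord y : 'I_N)) * ent T x y.
Proof. by move=> yM; rewrite -ent_tr trM sK_tr ent_sK // ent_tr. Qed.

Lemma sK_bs x y : sK false * bs x y = a ^ (2 * (2 * x%:Z - M%:Z)) *: bs x y.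
Proof. by rewrite -bs_tr -{1}sK_tr -trM bs_sK linearZ. Qed.

(** * Schur's lemma for the cut tangle, in coordinates *)

Section Scalar.

Variables A B : mat -> mat.
Hypotheses (Al : linear A) (Bl : linear B).
Hypothesis AE : forall T, A (dE true false T) = dE false true (A T).
Hypothesis BE : forall T, B (dE false false T) = dE false false (B T).
Hypothesis BK : forall T, B (dK false false T) = dK false false (B T).

Let lin0 (f : mat -> mat) : linear f -> f 0 = 0.
Proof. by move=> fl; have := linear_scale 0 0 fl; rewrite !scale0r. Qed.

Let linD (f : mat -> mat) X Y : linear f -> f (X + Y) = f X + f Y.
Proof. by move=> fl; have := fl 1 X Y; rewrite !scale1r. Qed.

(** In this multiplicative form weights can be traded under a product with the entry, without
    deciding which entries vanish. *)
Lemma weight_conservation x w y z : (x <= M)%N -> (w <= M)%N -> (y <= M)%N -> (z <= M)%N ->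
  a ^ (2 * (2 * y%:Z - M%:Z)) * ent (B (bs x w)) y z =
  a ^ (2 * (2 * x%:Z - M%:Z)) * a ^ (2 * (2 * w%:Z - M%:Z)) * a ^ (- (2 * (2 * z%:Z - M%:Z))) *
    ent (B (bs x w)) y z.
Proof.
move=> xM wM yM zM; have := BK (bs x w).
rewrite {1}/dK sK_bs -scalerAl bs_sK scalerA (linear_scale _ _ Bl) => /(congr1 (fun T =>
  ent T y z)).
rewrite entZ /dK ent_mul_sK // ent_sK // !wtH_inord //.
rewrite (_ : - (M%:Z - 2 * z%:Z) = 2 * z%:Z - M%:Z); last by ring.
rewrite (_ : - (M%:Z - 2 * y%:Z) = 2 * y%:Z - M%:Z); last by ring.
have := pw_neq0 (2 * (2 * z%:Z - M%:Z)); rewrite -pwV.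
move: (a ^ _) (a ^ _) (a ^ _) (a ^ _) (ent _ _ _) => u v s t e s0 h.
by apply: (mulfI s0); rewrite -h; field.
Qed.

(** Invariance of the cup on strands 0 and 1 together with [BE] trades E on these two strands, after
    B, for E on the incoming w and on the outgoing z. *)
Lemma dE_slice w z : (w <= M)%N -> (z <= M)%N ->
  dE true false (slice B w z) = a ^ (2 * (M%:Z - 2 * z%:Z)) *:
    (cEf w *: slice B w.+1 z - (if z is z'.+1 then cEf z' *: slice B w z' else 0)).
Proof.
move=> wM zM; apply: entP => x y xM yM.
rewrite [RHS]entZ [X in _ = _ * X]entD entN entZ !ent_slice // /dE entD.
have -> : ent (if z is z'.+1 then cEf z' *: slice B w z' else 0) x y =
   if z is z'.+1 then cEf z' * ent (B (bs x w)) y z' else 0.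
  by case: (z) => [|z']; rewrite ?ent0 // entZ ent_slice.
have := BE (bs x w); rewrite dE_bs (linD _ _ Bl) !(linear_scale _ _ Bl).
move=> /(congr1 (fun T => ent T y z)); rewrite entD !entZ /dE entD ent_mul_sK // wtH_inord //.
have -> : ent (B (bs x w) * (sE false)^T) y z = if z is z'.+1 then cEf z' *
  ent (B (bs x w)) y z' else 0.
  rewrite -ent_tr trM trmxK; case: (z) zM => [|z'] zM; first by rewrite ent_sEf0.
  by rewrite ent_sEf zM ent_tr.
have -> : ent (slice B w z * (sE false)^T) x y = ent (sE false * B (bs x w)) y z.
  rewrite -ent_tr trM trmxK; case: (y) yM => [|y'] yM; first by rewrite !ent_sEf0.
  by rewrite !ent_sEf yM ent_tr ent_slice.
rewrite ent_mul_sK // ent_sEt ent_slice // wtH_inord //.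
set Z := (if z is z'.+1 then _ else _); set X := ent (sE false * _) y z.
move=> h.
have hX : X = a ^ (2 * (M%:Z - 2 * z%:Z)) * (cEf w * ent (B (bs x w.+1)) y z +
   cEf x * a ^ (2 * (2 * w%:Z - M%:Z)) * ent (B (bs x.+1 w)) y z - Z).
  rewrite h [Z + _]addrC addrK mulrN -pwV.
  by rewrite mulrA mulfV ?mul1r ?pw_neq0.
rewrite hX -addrA mulrDr -addrA [RHS]mulrDr; congr (_ + _).
(* What remains are the two terms that raise x. They cancel by weight conservation, and for x = M
   both contain [0]. *)
move: xM; rewrite leq_eqVlt => /orP[/eqP ->|xM].
  by rewrite /cEf subnn !qint0 !mul0r oppr0 !mul0r mulr0 addr0 add0r.
have -> : a ^ (2 * - (M%:Z - 2 * y%:Z)) = a ^ (2 * (2 * y%:Z - M%:Z)) by congr (_ ^ _); ring.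
rewrite [a ^ _ * (qint _ _ * _)]mulrCA weight_conservation //.
rewrite mulrDr [X in X + _ = _]addrC -addrA -[RHS]addr0; congr (_ + _).
rewrite /cEf (_ : 2 * (2 * x.+1%:Z - M%:Z) = - (2 * (M%:Z - (2 * x.+1)%N%:Z)));
  last by rewrite PoszM; ring.
rewrite (_ : - (2 * (2 * z%:Z - M%:Z)) = 2 * (M%:Z - 2 * z%:Z)); last by ring.
by move: (a ^ _) (a ^ _) (a ^ _) (ent _ _ _) (qint _ _) => *; ring.
Qed.

(* Comparing E before and after A relates the terms at w and w.+1, up to terms
   that telescope over z. *)
Lemma closure_scalarS w : (w < M)%N -> closure_scalar A B w.+1 = closure_scalar A B w.
Proof.
move=> wM; have wM' := ltnW wM.
have cw : cEf w != 0.
  have := prod_cEf_neq0 wM; rewrite big_nat_recr //= mulf_eq0 negb_or => /andP[_]; exact.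
have step (z : 'I_N) : qint a (M - z) * ent (A (slice B w z)) w.+1 z.+1 +
   cEf w * (a ^ (2 * (M%:Z - 2 * z%:Z)) * ent (A (slice B w z)) w z) =
   cEf w * (a ^ (2 * (M%:Z - 2 * z%:Z)) * ent (A (slice B w.+1 z)) w.+1 z) +
   (if z : nat is z'.+1 then qint a (M - z') * ent (A (slice B w z')) w.+1 z'.+1 else 0).
  have zM : (z <= M)%N by rewrite -ltnS.
  have := AE (slice B w z); rewrite dE_slice // => /(congr1 (fun T => ent T w.+1 z)).
  rewrite /dE entD ent_mul_sK // wtH_inord // ent_sEf wM ent_mul_sEt.
  rewrite (linear_scale _ _ Al) entZ => h.
  rewrite [cEf w * (_ * _)]mulrCA -h (linD _ _ Al) (linear_scale _ _ Al) entD entZ mulrDr mulrCA;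
    congr (_ + _).
  case: (nat_of_ord z) => [|z']; first by rewrite (_ : A (- 0) = 0) ?ent0 ?mulr0 // oppr0 lin0.
  rewrite -scaleNr (linear_scale _ _ Al) entZ /cEf opprK.
  rewrite (_ : - (2 * (M%:Z - (2 * z'.+1)%N%:Z)) = - (2 * (M%:Z - 2 * z'.+1%:Z)));
    last by rewrite PoszM.
  rewrite -pwV; have := pw_neq0 (2 * (M%:Z - 2 * z'.+1%:Z)).
  by move: (a ^ _) (ent _ _ _) (qint _ _) => u e r u0; field.
apply: (mulfI cw); apply/esym; rewrite /closure_scalar !mulr_sumr.
have : \sum_(z < N) (qint a (M - z) * ent (A (slice B w z)) w.+1 z.+1 +
   cEf w * (a ^ (2 * (M%:Z - 2 * z%:Z)) * ent (A (slice B w z)) w z)) =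
   \sum_(z < N) (cEf w * (a ^ (2 * (M%:Z - 2 * z%:Z)) * ent (A (slice B w.+1 z)) w.+1 z) +
   (if z : nat is z'.+1 then qint a (M - z') * ent (A (slice B w z')) w.+1 z'.+1 else 0)).
  by apply: eq_bigr => z _; apply: step.
rewrite !big_split /= big_ord_recr /= subnn qint0 mul0r addr0.
rewrite [X in _ = _ + X]big_ord_recl /= add0r [RHS]addrC.
by move=> h; apply: (addrI _ h).
Qed.

Lemma closure_scalar_const w : (w <= M)%N -> closure_scalar A B w = closure_scalar A B M.
Proof.
move=> wM; have [d ->] : exists d, w = (M - d)%N by exists (M - w)%N; lia.
elim: d => [|d IH]; first by rewrite subn0.
case: (leqP M d) => Md; first by rewrite -IH; congr (closure_scalar _ _ _); lia.
by rewrite -IH -closure_scalarS; [congr (closure_scalar _ _ _)|]; lia.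
Qed.

End Scalar.

(** * From the diagram to the pairing *)

(** The quantum dimension: closing the outer strand multiplies the scalar by [N], which
    [colored_jones] divides out. *)
Lemma sum_weights : \sum_(w < N) a ^ (- (2 * (M%:Z - 2 * w%:Z))) = qint a N.
Proof.
have -> : \sum_(w < N) a ^ (- (2 * (M%:Z - 2 * w%:Z))) = a ^ (- (2 * M%:Z)) * \sum_(w < N) q ^+ w.
  rewrite mulr_sumr; apply: eq_bigr => w _; rewrite qE -pwD; congr (_ ^ _); ring.
have -> : qint a N = a ^ (- (2 * M%:Z)) * ((1 - q) * \sum_(w < N) q ^+ w) / (1 - q).
  rewrite qintE; congr (a ^ _ * _ / _); first by lia.
  by rewrite -opprB subrX1 -mulNr opprB.
have := qm1_neq0 1; rewrite expr1 => q1.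
by move: (a ^ _) (\sum_(_ < _) _) => x y; field.
Qed.

Definition cups : seq 'I_N -> F :=
  apply_event a [:: true; false] (Cup 2 false)
    (apply_event a [::] (Cup 0 true) (fun s => (s == [::])%:R)).

Lemma cupsE (x y z w : 'I_N) :
  cups [:: x; y; z; w] = a ^ (- (2 * (M%:Z - 2 * w%:Z))) * ent (bs x w) y z.
Proof.
rewrite /cups /= mulr1 /cup_coef /ent !ltn_ord /= mxE !inord_val -!val_eqE /=.
have -> : (y == x :> nat) = (x == y :> nat) by rewrite eq_sym.
case: (x == y :> nat) => /=; last by rewrite !mulr0.
case: eqP => [e|_]; last by rewrite mul0r mulr0.
by rewrite !mulr1 weightE e PoszM.
Qed.

Definition braid_op (s b c : bool) (T : mat) : mat := if s then sig b c T else sigV b c T.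

Lemma apply_diagram_cat o D1 D2 (psi0 : seq 'I_N -> F) :
  apply_diagram a o (D1 ++ D2) psi0 =
  apply_diagram a (foldl orient_step o D1) D2 (apply_diagram a o D1 psi0).
Proof. by elim: D1 o psi0 => //= e D1 IH o psi0; rewrite IH. Qed.

Lemma orient_parallel n s :
  foldl orient_step [:: true; false; false; true] (nseq n (Cross 1 s)) = [:: true; false; false;
    true].
Proof. by elim: n. Qed.

Lemma apply_parallel n s (psi0 : seq 'I_N -> F) x y z w :
  apply_diagram a [:: true; false; false; true] (nseq n (Cross 1 s)) psi0 [:: x; y; z; w] =
  (iter n (braid_op s false false) (\matrix_(y', z') psi0 [:: x; y'; z'; w])) y z.
Proof.
elim: n psi0 => [|n IH] psi0; first by rewrite /= mxE.
rewrite iterSr /= IH; congr (fun_of_matrix (iter n _ _) _ _); apply/matrixP => y1 z1.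
rewrite mxE /= /braid_op -cross_coefE; apply: eq_bigr => x' _; apply: eq_bigr => y' _.
by rewrite mxE.
Qed.

(** Each half-twist exchanges the two orientations, so the types of [sig] alternate; two crossings
    make one [sig2], and one crossing is left over. *)
Lemma apply_antiparallel k (psi0 : seq 'I_N -> F) x y z w :
  apply_diagram a [:: true; false; false; true] (nseq k.*2.+1 (Cross 0 true)) psi0 [:: x; y; z; w] =
  (sig true false (iter k sig2 (\matrix_(x', y') psi0 [:: x'; y'; z; w]))) x y.
Proof.
have step b c (phi : seq 'I_N -> F) :
    \matrix_(x', y') apply_event a [:: b; c; false; true] (Cross 0 true) phi [:: x'; y'; z; w] =
    sig b c (\matrix_(x', y') phi [:: x'; y'; z; w]).
  apply/matrixP => x1 y1; rewrite mxE /=.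
  have := @cross_coefE true b c (\matrix_(x', y') phi [:: x'; y'; z; w]) x1 y1.
  move=> /= <-; apply: eq_bigr => x' _; apply: eq_bigr => y' _; by rewrite mxE.
elim: k psi0 => [|k IH] psi0.
  by rewrite -[RHS]/(sig true false (\matrix_(x', y') psi0 [:: x'; y'; z; w]) x y) -step mxE.
rewrite doubleS iterSr -[nseq _ _]/(Cross 0 true :: Cross 0 true :: nseq k.*2.+1 (Cross 0 true)).
rewrite -[LHS]/(apply_diagram a [:: true; false; false; true] (nseq k.*2.+1 (Cross 0 true))
  (apply_event a [:: false; true; false; true] (Cross 0 true)
    (apply_event a [:: true; false; false; true] (Cross 0 true) psi0)) [:: x; y; z; w]) IH /sig2.
congr (fun_of_matrix (sig _ _ (iter _ _ _)) _ _).
by rewrite -!step.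
Qed.

Lemma orient_antiparallel k :
  foldl orient_step [:: true; false; false; true] (nseq k.*2.+1 (Cross 0 true)) = [:: false;
    true; false; true].
Proof. by elim: k. Qed.

Lemma bracketE s n k :
  bracket a N ([:: Cup 0 true; Cup 2 false] ++ nseq n (Cross 1 s) ++ nseq k.*2.+1 (Cross 0 true)
    ++ [:: Cap 1; Cap 0]) =
  \sum_(w < N) a ^ (- (2 * (M%:Z - 2 * w%:Z))) *
     closure_scalar (fun T => sig true false (iter k sig2 T)) (iter n (braid_op s false false)) w.
Proof.
rewrite /bracket !apply_diagram_cat.
rewrite -[foldl _ [::] _]/[:: true; false; false; true] orient_parallel orient_antiparallel.
set P := apply_diagram a _ (nseq k.*2.+1 _) _.
have iB : linear (iter n (braid_op s false false)).
  by apply: iter_linear; rewrite /braid_op; case: (s); [apply: sig_linear|apply: sigV_linear].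
have iA : linear (fun T => sig true false (iter k sig2 T)).
  have s2 : linear (iter k sig2).
    apply: iter_linear => c A B; rewrite /sig2.
    by have -> := @sig_linear true false c A B; apply: sig_linear.
  by move=> c A B; have -> := s2 c A B; apply: sig_linear.
have PE x y z w : P [:: x; y; z; w] = a ^ (- (2 * (M%:Z - 2 * w%:Z))) *
   ent (sig true false (iter k sig2 (slice (iter n (braid_op s false false)) w z))) x y.
  rewrite /P apply_antiparallel -entE -entZ -(linear_scale _ _ iA);
    congr (ent (sig _ _ (iter _ _ _)) _ _).
  apply/matrixP => x' y'; rewrite mxE apply_parallel.
  have -> : \matrix_(y1, z1) cups [:: x'; y1; z1; w] = a ^ (- (2 * (M%:Z - 2 * w%:Z))) *: bs x' w.
    by apply/matrixP => y1 z1; rewrite mxE cupsE entE [RHS]mxE.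
  by rewrite (linear_scale _ _ iB) !mxE entE.
rewrite -[LHS]/(\sum_x \sum_y cap_coef a false x y * (\sum_u \sum_v cap_coef a true u v *
  P [:: x; u; v; y])).
apply: eq_bigr => w _; rewrite (bigD1 w) //= [X in _ + X]big1 ?addr0; last first.
  by move=> y yw; rewrite /cap_coef eq_sym (negbTE yw) mul0r.
rewrite {1}/cap_coef eqxx mul1r /closure_scalar mulr_sumr; apply: eq_bigr => z _.
rewrite (bigD1 z) //= [X in _ + X]big1 ?addr0; last first.
  by move=> y yw; rewrite /cap_coef eq_sym (negbTE yw) mul0r.
rewrite /cap_coef eqxx PE weightE PoszM mulrCA.
by [].
Qed.

Lemma sigV_dE b c T : sigV b c (dE b c T) = dE c b (sigV b c T).
Proof. by apply: (can_inj (sigK c b)); rewrite sig_dE !sigVK. Qed.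

Lemma sigV_dK b c T : sigV b c (dK b c T) = dK c b (sigV b c T).
Proof. by apply: (can_inj (sigK c b)); rewrite sig_dK !sigVK. Qed.

(** By [closure_scalar_const] every summand of [bracketE] has the same scalar, the one at M, so the
    sum over w yields [N]. *)
Lemma bracket_sum s n k (g : nat -> F) :
  iter n (braid_op s false false) (bs 0 M) = \sum_(l < N) g l *: Evec' l ->
  bracket a N ([:: Cup 0 true; Cup 2 false] ++ nseq n (Cross 1 s) ++ nseq k.*2.+1 (Cross 0 true)
    ++ [:: Cap 1; Cap 0]) =
  qint a N * (a ^ (- (M%:Z * (M%:Z + 2)) - 2 * M%:Z * (M%:Z + 2) * k%:Z) *
  \sum_(l < N) antiparallel_coef k l * g l * (qpoch q (a ^ (4 * (M%:Z + 2))) l *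
    qpoch q (a ^ (- (4 * M%:Z))) l)).
Proof.
move=> B0; have lA : linear (fun T => sig true false (iter k sig2 T)).
  have s2 : linear (iter k sig2).
    apply: iter_linear => c A B; rewrite /sig2.
    by have -> := @sig_linear true false c A B; apply: sig_linear.
  by move=> c A B; have -> := s2 c A B; apply: sig_linear.
have lB : linear (iter n (braid_op s false false)).
  by apply: iter_linear; rewrite /braid_op; case: (s); [apply: sig_linear|apply: sigV_linear].
have bE T : braid_op s false false (dE false false T) = dE false false (braid_op s false false T).
  by rewrite /braid_op; case: (s); rewrite ?sig_dE ?sigV_dE.
have bK T : braid_op s false false (dK false false T) = dK false false (braid_op s false false T).
  by rewrite /braid_op; case: (s); rewrite ?sig_dK ?sigV_dK.
have BE T : iter n (braid_op s false false) (dE false false T) =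
  dE false false (iter n (braid_op s false false) T).
  by elim: (n) => //= r ->; rewrite bE.
have BK T : iter n (braid_op s false false) (dK false false T) =
  dK false false (iter n (braid_op s false false) T).
  by elim: (n) => //= r ->; rewrite bK.
have AE T : sig true false (iter k sig2 (dE true false T)) =
  dE false true (sig true false (iter k sig2 T)).
  rewrite -sig_dE; congr (sig _ _ _); elim: (k) => //= r ->.
  by rewrite /sig2 !sig_dE.
rewrite bracketE -(@closure_scalar_top _ g k lB BE B0) -sum_weights mulr_suml;
  apply: eq_bigr => w _.
have wM : (w <= M)%N by rewrite -ltnS.
by rewrite (closure_scalar_const lA lB AE BE BK wM).
Qed.

(** Row 0 of the p-th power of the matrix [tw], because the twisting starts from e^0 (x) e^M, which
    is [Evec' 0]. *)
Fixpoint parallel_coef (tw : nat -> nat -> F) (p n : nat) : F :=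
  if p is p'.+1 then \sum_(j < N) parallel_coef tw p' j * tw j n else (n == 0)%:R.

Lemma Evec'0 : Evec' 0 = bs 0 M.
Proof.
rewrite /Evec' /Evec_norm /Evec subn0 /= gbin0 expr0 !mulr0 subr0 expr0z !mulr1.
by rewrite scale1r.
Qed.

Lemma iter_twist (f : mat -> mat) (tw : nat -> nat -> F) (c : int) (p : nat) : linear f ->
  (forall k, (k <= M)%N -> f (f (Evec' k)) = a ^ c *: \sum_(l < N) tw k l *: Evec' l) ->
  iter p.*2 f (bs 0 M) = \sum_(l < N) (a ^ (c * p%:Z) * parallel_coef tw p l) *: Evec' l.
Proof.
move=> fl h; elim: p => [|p IH].
  rewrite /= mulr0 expr0z big_ord_recl /= mulr1 scale1r Evec'0 big1 ?addr0 // => i _.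
  by rewrite mulr0 scale0r.
rewrite doubleS !iterS IH !linear_comb //.
transitivity (\sum_(j < N) \sum_(l < N) (a ^ (c * p.+1%:Z) * (parallel_coef tw p j *
  tw j l)) *: Evec' l).
  apply: eq_bigr => j _; have jM : (j <= M)%N by rewrite -ltnS.
  rewrite (h _ jM) scalerA scaler_sumr; apply: eq_bigr => l _.
  rewrite scalerA; congr (_ *: _).
  have -> : a ^ (c * p.+1%:Z) = a ^ (c * p%:Z) * a ^ c.
    by rewrite -pwD; congr (_ ^ _); rewrite -[p.+1]addn1 PoszD; ring.
  by move: (a ^ _) (a ^ _) => *; ring.
rewrite exchange_big /=; apply: eq_bigr => l _.
by rewrite -scaler_suml mulr_sumr.
Qed.

(** * Sums over chains *)

Lemma chain_rcons n m (t : m.+1.-tuple 'I_N) (x : 'I_N) :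
  chain_to n [tuple of rcons t x] =
  (x == n :> nat) && chain_to (last 0%N (map val t)) t && (last 0%N (map val t) <= n)%N.
Proof.
rewrite /chain_to /= map_rcons last_rcons eqxx andbT.
case: t => -[|y t] //= _; rewrite rcons_path /=.
by case: eqP => [->|_]; rewrite ?andbT ?andbF.
Qed.

Lemma entry_rcons m (t : m.+1.-tuple 'I_N) (x : 'I_N) i :
  (0 < i <= m.+1)%N -> entry [tuple of rcons t x] i = entry t i.
Proof.
move=> /andP[i0 im]; rewrite /entry /= map_rcons nth_rcons size_map size_tuple.
by rewrite (_ : (i.-1 < m.+1)%N) // prednK.
Qed.

Lemma entry_rcons_last m (t : m.+1.-tuple 'I_N) (x : 'I_N) : entry [tuple of rcons t x] m.+2 = x.
Proof. by rewrite /entry /= map_rcons nth_rcons size_map size_tuple ltnn eqxx. Qed.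

Lemma entry_last m (t : m.+1.-tuple 'I_N) : entry t m.+1 = last 0%N (map val t).
Proof. by rewrite /entry -nth_last size_map size_tuple. Qed.

(** Here m counts the steps, so the tuples have m + 1 entries; the m and p of the theorem exceed the
    indices used from here on by one. *)
Definition chain_sum (w : nat -> F) (f : nat -> nat -> F) (m n : nat) : F :=
  \sum_(t : m.+1.-tuple 'I_N | chain_to n t)
    w (entry t 1) * \prod_(1 <= i < m.+1) f (entry t i) (entry t i.+1).

(** Tuples are split at their last entry, since it is the one that a chain prescribes. *)
Lemma sum_tuple_rcons m (G : m.+1.-tuple 'I_N -> F) :
  \sum_(t : m.+1.-tuple 'I_N) G t = \sum_(x < N) \sum_(t : m.-tuple 'I_N) G [tuple of rcons t x].
Proof.
rewrite pair_big /=.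
pose h (p : 'I_N * m.-tuple 'I_N) : m.+1.-tuple 'I_N := [tuple of rcons p.2 p.1].
pose h' (t : m.+1.-tuple 'I_N) : 'I_N * m.-tuple 'I_N :=
  (tnth t ord_max, [tuple tnth t (widen_ord (leqnSn m) i) | i < m]).
apply: (reindex h); exists h' => [[x t] _|t _].
  rewrite /h /h' /=; congr (_, _).
    by rewrite (tnth_nth x) /= nth_rcons size_tuple ltnn eqxx.
  apply: eq_from_tnth => i; rewrite tnth_mktuple !(tnth_nth x) /= nth_rcons size_tuple.
  by rewrite ltn_ord.
apply: eq_from_tnth => i; rewrite /h /h' (tnth_nth (tnth t ord_max)) /= nth_rcons size_map
  size_enum_ord.
case: ltnP => im.
  rewrite (nth_map (Ordinal im)) ?size_enum_ord //; congr tnth; apply: val_inj => /=.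
  by rewrite nth_enum_ord.
have -> : nat_of_ord i = m by apply/eqP; rewrite eqn_leq im -ltnS ltn_ord.
by rewrite eqxx; congr tnth; apply: val_inj => /=; apply/eqP; rewrite eqn_leq im -ltnS ltn_ord.
Qed.

Lemma chain_sum0 w f n : (n <= M)%N -> chain_sum w f 0 n = w n.
Proof.
move=> nM; rewrite /chain_sum big_mkcond sum_tuple_rcons /=.
rewrite (bigD1 (inord n)) //= [X in _ + X]big1 ?addr0 => [|x xn].
  rewrite (big_pred1 [tuple]) => [|t]; last by apply/esym/eqP; rewrite [LHS]tuple0.
  by rewrite /chain_to /= inordK ?eqxx //= big_geq // mulr1 /entry /= inordK.
apply: big1 => t _; rewrite tuple0 /chain_to /=.
case: eqP => // e; case/negP: xn; apply/eqP/val_inj; by rewrite /= inordK.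
Qed.

Lemma chain_sumS w f m n : (n <= M)%N ->
  chain_sum w f m.+1 n = \sum_(k < N) (if (k <= n)%N then chain_sum w f m k * f k n else 0).
Proof.
move=> nM; rewrite /chain_sum big_mkcond sum_tuple_rcons /=.
rewrite (bigD1 (inord n)) //= [X in _ + X]big1 ?addr0 => [|x xn]; last first.
  apply: big1 => t _; rewrite chain_rcons; case: eqP => //= e.
  by case/negP: xn; apply/eqP/val_inj; rewrite /= inordK.
(* A sum over the value k of the last entry of the shorter chain is inserted; exactly one k
   satisfies [chain_to k t] when t is sorted. *)
transitivity (\sum_(t : m.+1.-tuple 'I_N) \sum_(k < N)
   (if (k <= n)%N && chain_to k t then (w (entry t 1) *
     \prod_(1 <= i < m.+1) f (entry t i) (entry t i.+1)) * f k n else 0)).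
  apply: eq_bigr => t _; rewrite chain_rcons inordK // eqxx /=.
  have lt : (last 0%N (map val t) < N)%N by case: t => -[|y t] //= _; rewrite last_map.
  rewrite (bigD1 (Ordinal lt)) //= [X in _ + X]big1 ?addr0 => [|k kl]; last first.
    rewrite /chain_to (_ : (last 0%N _ == k) = false) ?andbF //.
    by apply: contraNF kl => /eqP e; apply/eqP/val_inj.
  rewrite andbC; case: ifP => // _.
  have e i := @entry_rcons m t (inord n) i.
  rewrite big_nat_recr //= entry_rcons_last inordK // (e 1%N) // (e m.+1) ?ltnSn // entry_last
    mulrA.
  congr (_ * _ * _); apply: eq_big_nat => i /andP[i0 im].
  by rewrite !entry_rcons //; lia.
rewrite exchange_big /=; apply: eq_bigr => k _.
case: leqP => kn; last by rewrite big1.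
by rewrite mulr_suml [RHS]big_mkcond.
Qed.

Lemma gbin_guard k n (x : F) : x * gbin n k = if (k <= n)%N then x * qbinom q n k else 0.
Proof. by rewrite /gbin; case: ifP => _; rewrite ?mulr0. Qed.

Lemma antiparallel_coefE k l : (l <= M)%N ->
  antiparallel_coef k l = chain_sum (fun n => (pq n)^-1) (fun i j =>
    q ^+ (i ^ 2 + i) * qbinom q j i) k l.
Proof.
elim: k l => [|k IH] l lM; first by rewrite chain_sum0.
rewrite chain_sumS // [LHS]/=; apply: eq_bigr => j _; have jM : (j <= M)%N by rewrite -ltnS.
rewrite gbin_guard; case: ifP => _; last by rewrite mulr0.
rewrite -IH //; congr (_ * (_ * _)).
by rewrite qE; congr (_ ^ _); rewrite PoszD -mulnn PoszM.
Qed.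

(** A step of [twistP] from j to n carries q^(n + j^2). Along the chain the q^j of each step joins
    the q^(j^2) of the next one, and the last q^n is left over. *)
Lemma parallel_coefPE p n : (n <= M)%N ->
  parallel_coef twistP p.+1 n = q ^+ n * chain_sum (fun=> 1) (fun i j =>
    q ^+ (i ^ 2 + i) * qbinom q j i) p n.
Proof.
elim: p n => [|p IH] n nM.
  rewrite chain_sum0 // mulr1 /= big_ord_recl /= big1 => [|j _]; last by rewrite mul0r.
  by rewrite mul1r addr0 /twistP gbin0 mulr1 !mulr0 addr0 qE.
rewrite chain_sumS // -[LHS]/(\sum_(j < N) parallel_coef twistP p.+1 j * twistP j n) mulr_sumr.
apply: eq_bigr => j _; have jM : (j <= M)%N by rewrite -ltnS.
rewrite /twistP gbin_guard; case: ifP => jn; last by rewrite !mulr0.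
rewrite IH // !qE.
have -> : a ^ (4 * (n%:Z + j%:Z * j%:Z)) = a ^ (4 * n%:Z) * a ^ (4 * (j ^ 2)%N%:Z).
  by rewrite -pwD; congr (_ ^ _); rewrite -mulnn PoszM; ring.
have -> : a ^ (4 * (j ^ 2 + j)%N%:Z) = a ^ (4 * (j ^ 2)%N%:Z) * a ^ (4 * j%:Z).
  by rewrite -pwD; congr (_ ^ _); rewrite PoszD; ring.
by move: (a ^ _) (a ^ _) (a ^ _) (qbinom _ _ _) (chain_sum _ _ _ _) => *; ring.
Qed.

Lemma qX_bin2 n : q ^- 'C(n.+1, 2) = a ^ (- (2 * n%:Z * (n%:Z + 1))).
Proof.
rewrite qE pwV; congr (_ ^ (- _)).
have : (n.+1 * n = 'C(n.+1, 2) * 2)%N by elim: n => // n IH; rewrite binS bin1 mulnDl -IH; lia.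
move=> /(congr1 Posz); rewrite !PoszM => h.
have -> (x : int) : 4 * x = 2 * (x * 2) by ring.
by rewrite -h intS; ring.
Qed.

(** The signs and the triangular exponents in [twistN] telescope along the chain; they leave those
    of the end n and the factors q^(-s_j - s_(j+1) s_j). *)
Lemma parallel_coefNE p n : (n <= M)%N ->
  parallel_coef twistN p.+1 n = (-1) ^+ n * q ^- 'C(n.+1, 2) *
    chain_sum (fun=> 1) (fun i j => q ^- (i + j * i) * qbinom q j i) p n.
Proof.
elim: p n => [|p IH] n nM.
  rewrite chain_sum0 // mulr1 /= big_ord_recl /= big1 => [|j _]; last by rewrite mul0r.
  rewrite mul1r addr0 /twistN gbin0 mulr1 add0n qX_bin2; congr (_ * _ ^ _); ring.
rewrite chain_sumS // -[LHS]/(\sum_(j < N) parallel_coef twistN p.+1 j * twistN j n) mulr_sumr.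
apply: eq_bigr => j _; have jM : (j <= M)%N by rewrite -ltnS.
rewrite /twistN gbin_guard; case: ifP => jn; last by rewrite !mulr0.
rewrite IH // !qX_bin2 qE pwV.
have -> : a ^ (- (2 * n%:Z * (n%:Z + 1)) + 2 * j%:Z * (j%:Z + 1) - 4 * j%:Z - 4 * j%:Z * n%:Z) =
  a ^ (- (2 * n%:Z * (n%:Z + 1))) * (a ^ (- (2 * j%:Z * (j%:Z + 1))))^-1 * a ^ (- (4 * (j + n *
    j)%N%:Z)).
  by rewrite pwV -!pwD; congr (_ ^ _); rewrite PoszD PoszM; ring.
have := pw_neq0 (- (2 * j%:Z * (j%:Z + 1))); rewrite exprD -(signr_odd _ j).
move: (a ^ _) (a ^ _) (a ^ _) (qbinom _ _ _) (chain_sum _ _ _ _) (_ ^+ n) => x y z b c e y0.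
by case: odd; rewrite ?expr0 ?expr1; field.
Qed.

(** * Half-twists, writhe and framing *)

Lemma half_twistsP i (p : nat) : half_twists i (2 * p%:Z) = nseq p.*2 (Cross i true).
Proof. by rewrite /half_twists -PoszM mul2n. Qed.

Lemma half_twistsN i (p : nat) : (0 < p)%N -> half_twists i (2 * - p%:Z) =
  nseq p.*2 (Cross i false).
Proof.
move=> p0; rewrite /half_twists mulrN -PoszM mul2n abszN absz_nat oppr_ge0.
by rewrite -[0]/(0%N%:Z) lez_nat leqn0 double_eq0 -[(p == 0)%N]negbK -lt0n p0.
Qed.

Lemma half_twists_odd i (k : nat) : half_twists i (2 * k.+1%:Z - 1) = nseq k.*2.+1 (Cross i true).
Proof.
have -> : 2 * k.+1%:Z - 1 = k.*2.+1%:Z by lia.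
by [].
Qed.

Lemma writhe_from_cat o D1 D2 :
  writhe_from o (D1 ++ D2) = writhe_from o D1 + writhe_from (foldl orient_step o D1) D2.
Proof. by elim: D1 o => [|e D1 IH] o /=; rewrite ?add0r // IH addrA. Qed.

Lemma writhe_parallel n s :
  writhe_from [:: true; false; false; true] (nseq n (Cross 1 s)) = if s then n%:Z else - n%:Z.
Proof.
elim: n => [|n IH] /=; first by case: s.
by rewrite -/[:: true; false; false; true] IH; case: (s) => /=; lia.
Qed.

(** The strands of this region are antiparallel, so a right-handed half-twist is a negative
    crossing. *)
Lemma writhe_antiparallel k :
  writhe_from [:: true; false; false; true] (nseq k.*2.+1 (Cross 0 true)) = - k.*2.+1%:Z.
Proof.
elim: k => [|k IH] //.
rewrite doubleS -[nseq _ _]/(Cross 0 true :: Cross 0 true :: nseq k.*2.+1 (Cross 0 true)).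
rewrite -[LHS]/(-1 + (-1 + writhe_from [:: true; false; false;
  true] (nseq k.*2.+1 (Cross 0 true)))) IH.
lia.
Qed.

Lemma writheE n s k :
  writhe ([:: Cup 0 true; Cup 2 false] ++ nseq n (Cross 1 s) ++ nseq k.*2.+1 (Cross 0 true) ++
    [:: Cap 1; Cap 0]) =
  (if s then n%:Z else - n%:Z) - k.*2.+1%:Z.
Proof.
rewrite /writhe !writhe_from_cat -[foldl _ [::] _]/[:: true; false; false; true].
by rewrite orient_parallel writhe_parallel writhe_antiparallel /= !addr0 !add0r.
Qed.

Lemma qint_neq0 n : (0 < n)%N -> qint a n != 0.
Proof.
move=> n0; rewrite qintE !mulf_neq0 ?pw_neq0 ?invr_eq0 ?qX_neq1 //.
by have := qm1_neq0 1; rewrite expr1.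
Qed.

Lemma qXz (z : int) : q ^ z = a ^ (4 * z).
Proof. by rewrite q_def exprnP exprz_exp. Qed.

Lemma colored_jones_sum s p k (g : nat -> F) (c : int) :
  iter p.*2 (braid_op s false false) (bs 0 M) = \sum_(l < N) (a ^ (c * p%:Z) * g l) *: Evec' l ->
  c = (if s then -2 else 2) * M%:Z * (M%:Z + 2) ->
  colored_jones a N ([:: Cup 0 true; Cup 2 false] ++ nseq p.*2 (Cross 1 s) ++ nseq k.*2.+1 (Cross
    0 true) ++ [:: Cap 1; Cap 0]) =
  q ^ ((if s then p%:Z else - p%:Z) * (1 - N%:Z ^+ 2)) *
  \sum_(l < N) antiparallel_coef k l * g l * (qpoch q (q ^ (1 + N%:Z)) l *
    qpoch q (q ^ (1 - N%:Z)) l).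
Proof.
move=> h hc; rewrite /colored_jones (@bracket_sum s p.*2 k (fun l =>
  a ^ (c * p%:Z) * g l)) // writheE.
rewrite [_ * (qint a N * _)]mulrCA [LHS]mulrC mulKf ?qint_neq0 //.
have -> : q ^ (1 + N%:Z) = a ^ (4 * (M%:Z + 2)) by rewrite qXz; congr (_ ^ _); lia.
have -> : q ^ (1 - N%:Z) = a ^ (- (4 * M%:Z)) by rewrite qXz; congr (_ ^ _); lia.
rewrite qXz !mulr_sumr; apply: eq_bigr => l _.
set A1 := a ^ _; set A2 := a ^ _; set A3 := a ^ _; set A4 := a ^ (4 * (_ * (1 - _))).
(* The writhe is 2p - (2k + 1) or -2p - (2k + 1), and N^2 - 1 = M (M + 2). The framing correction
   cancels the power of [a] from the antiparallel region and doubles the one from the parallel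
   region. *)
have -> : A4 = A1 * A2 * A3.
  rewrite /A1 /A2 /A3 /A4 -!pwD; congr (_ ^ _); rewrite hc.
  by case: (s); rewrite -!muln2 -[(k * 2).+1]addn1 -[N]addn1 !PoszD !PoszM; ring.
by move: A1 A2 A3 (qpoch _ _ _) (qpoch _ _ _) (antiparallel_coef _ _) (g _) => *; ring.
Qed.

Lemma triple_sum m p n (X c : F) (f g : nat -> nat -> F) :
  \sum_(t : m.+1.-tuple 'I_N | chain_to n t) \sum_(s : p.+1.-tuple 'I_N | chain_to n s)
    X / pq (entry t 1) * c * (\prod_(1 <= i < m.+1) f (entry t i) (entry t i.+1)) *
    (\prod_(1 <= j < p.+1) g (entry s j) (entry s j.+1)) =
  chain_sum (fun n => (pq n)^-1) f m n * (c * chain_sum (fun=> 1) g p n) * X.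
Proof.
rewrite mulr_suml mulr_suml; apply: eq_bigr => t _.
rewrite !mulr_sumr mulr_suml; apply: eq_bigr => s _.
by move: (_^-1) (\prod_(_ <= _ < _) _) (\prod_(_ <= _ < _) _) => *; ring.
Qed.

Lemma colored_jones_pos m p :
  colored_jones a N (double_twist m.+1%:Z p.+1%:Z) =
    q ^ (p.+1%:Z * (1 - N%:Z ^+ 2)) *
    \sum_(n < N)
    \sum_(t : m.+1.-tuple 'I_N | chain_to n t)
    \sum_(s : p.+1.-tuple 'I_N | chain_to n s)
      qpoch q (q ^ (1 + N%:Z)) n * qpoch q (q ^ (1 - N%:Z)) n
        / qpoch q q (entry t 1) * q ^+ n
      * (\prod_(1 <= i < m.+1)
           (q ^+ (entry t i ^ 2 + entry t i)
            * qbinom q (entry t i.+1) (entry t i)))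
      * (\prod_(1 <= j < p.+1)
           (q ^+ (entry s j ^ 2 + entry s j)
            * qbinom q (entry s j.+1) (entry s j))).
Proof.
rewrite /double_twist half_twistsP half_twists_odd.
rewrite (@colored_jones_sum true p.+1 m (parallel_coef twistP p.+1) (- (2 * M%:Z * (M%:Z +
  2)))) //; first last.
- by ring.
- by apply: iter_twist; [exact: sig_linear|exact: sig2_Evec].
congr (_ * _); apply: eq_bigr => n _; have nM : (n <= M)%N by rewrite -ltnS.
rewrite antiparallel_coefE // parallel_coefPE //.
by rewrite -(@triple_sum m p n _ _ (fun i j => q ^+ (i ^ 2 + i) * qbinom q j i) (fun i j =>
  q ^+ (i ^ 2 + i) * qbinom q j i)).
Qed.

Lemma colored_jones_neg m p :
  colored_jones a N (double_twist m.+1%:Z (- p.+1%:Z)) =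
    q ^ (- (p.+1%:Z * (1 - N%:Z ^+ 2))) *
    \sum_(n < N)
    \sum_(t : m.+1.-tuple 'I_N | chain_to n t)
    \sum_(s : p.+1.-tuple 'I_N | chain_to n s)
      qpoch q (q ^ (1 + N%:Z)) n * qpoch q (q ^ (1 - N%:Z)) n
        / qpoch q q (entry t 1) * ((-1) ^+ n * q ^- 'C(n.+1, 2))
      * (\prod_(1 <= i < m.+1)
           (q ^+ (entry t i ^ 2 + entry t i)
            * qbinom q (entry t i.+1) (entry t i)))
      * (\prod_(1 <= j < p.+1)
           (q ^- (entry s j + entry s j.+1 * entry s j)
            * qbinom q (entry s j.+1) (entry s j))).
Proof.
rewrite /double_twist half_twistsN // half_twists_odd.
rewrite (@colored_jones_sum false p.+1 m (parallel_coef twistN p.+1) (2 * M%:Z * (M%:Z + 2))) //;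
  last first.
  by apply: iter_twist; [exact: sigV_linear|exact: sigV2_Evec].
rewrite mulNr; congr (_ * _); apply: eq_bigr => n _; have nM : (n <= M)%N by rewrite -ltnS.
rewrite antiparallel_coefE // parallel_coefNE //.
by rewrite -(@triple_sum m p n _ _ (fun i j => q ^+ (i ^ 2 + i) * qbinom q j i) (fun i j =>
  q ^- (i + j * i) * qbinom q j i)).
Qed.

End DoubleTwist.

(** * Specialization to rational functions in q^(1/4) *)

Lemma q4_neq0 : q4 != 0.
Proof. by rewrite /q4 tofrac_eq0 polyX_eq0. Qed.

Lemma q4_inf n : (0 < n)%N -> q4 ^+ n != 1.
Proof.
move=> n0; rewrite /q4 -tofracXn -tofrac1 tofrac_eq; apply/eqP => /(congr1 (fun p : {poly rat} =>
  size p)).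
by rewrite size_polyXn size_poly1; case: n n0.
Qed.

Theorem theorem1p3 (m p : nat) (m_gt0 : (0 < m)%N) (p_gt0 : (0 < p)%N)
    (N : nat) (N_gt0 : (0 < N)%N) :
  J N (double_twist m%:Z p%:Z) =
    q ^ (p%:Z * (1 - N%:Z ^+ 2)) *
    \sum_(n < N)
    \sum_(t : m.-tuple 'I_N | chain_to n t)
    \sum_(s : p.-tuple 'I_N | chain_to n s)
      qpoch q (q ^ (1 + N%:Z)) n * qpoch q (q ^ (1 - N%:Z)) n
        / qpoch q q (entry t 1) * q ^+ n
      * (\prod_(1 <= i < m)
           (q ^+ (entry t i ^ 2 + entry t i)
            * qbinom q (entry t i.+1) (entry t i)))
      * (\prod_(1 <= j < p)
           (q ^+ (entry s j ^ 2 + entry s j)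
            * qbinom q (entry s j.+1) (entry s j)))
  /\
  J N (double_twist m%:Z (- p%:Z)) =
    q ^ (- (p%:Z * (1 - N%:Z ^+ 2))) *
    \sum_(n < N)
    \sum_(t : m.-tuple 'I_N | chain_to n t)
    \sum_(s : p.-tuple 'I_N | chain_to n s)
      qpoch q (q ^ (1 + N%:Z)) n * qpoch q (q ^ (1 - N%:Z)) n
        / qpoch q q (entry t 1) * ((-1) ^+ n * q ^- 'C(n.+1, 2))
      * (\prod_(1 <= i < m)
           (q ^+ (entry t i ^ 2 + entry t i)
            * qbinom q (entry t i.+1) (entry t i)))
      * (\prod_(1 <= j < p)
           (q ^- (entry s j + entry s j.+1 * entry s j)
            * qbinom q (entry s j.+1) (entry s j))).
Proof.
case: N N_gt0 => // M _; case: m m_gt0 => // m _; case: p p_gt0 => // p _.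
split; first exact: (@colored_jones_pos Qq q4 q erefl q4_neq0 q4_inf M m p).
exact: (@colored_jones_neg Qq q4 q erefl q4_neq0 q4_inf M m p).
Qed.
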